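(* Let $N\ge2$ be an integer, let $B\subset\mathbb{R}^N$ be the open unit ball, let $\delta>0$, and for $\lambda>0$ consider the problem $$(P_\lambda)\qquad -\Delta U=\frac{\lambda+\delta|\nabla U|^2}{1-U},\quad U>0\ \text{ in } B,\qquad U=0\ \text{ on }\partial B .$$ Let $\bar\lambda$ denote the extremal value for $(P_\lambda)$, let $\lambda^*:=N-1-\delta$, and let $\mu_1>0$ be the first eigenvalue of the Dirichlet Laplacian on $B$. Then the following hold. (i) If $0<\delta\le (N-2-2\sqrt{N-1})/2$, then $\bar\lambda=\lambda^*$ and the extremal solution is singular. (ii) If $(N-2-2\sqrt{N-1})/2<\delta<N/2$, then $$\lambda^*<\bar\lambda<\min\left\{\frac{\mu_1}{4},\frac{\mu_1}{\delta}\right\}$$ and the extremal solution is regular. (iii) If $\delta\ge N/2$, then $$N\left(\frac{2}{\delta+1}\right)^{(\delta+1)/(\delta-1)}\le\bar\lambda<\min\left\{\frac{\mu_1}{4},\frac{\mu_1}{\delta}\right\}.$$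
   Context: Solutions considered are radial functions $U=U(r)$, $r=|x|$. A regular solution of $(P_\lambda)$ is a (classical) solution with $0<U<1$ in $B$. A singular solution here means a rupture solution, i.e. a radial solution with $U(0)=1$, which makes the equation singular at the origin. A number $\bar\lambda>0$ is called the extremal value for $(P_\lambda)$ (with $\delta$ fixed) if $(P_\lambda)$ has a regular solution for $\lambda<\bar\lambda$ and no regular solution for $\lambda>\bar\lambda$. The solution for $\lambda=\bar\lambda$ is called the extremal solution.
   Formalization: In (iii) with δ = 1 (possible only for N = 2) the exponent (δ+1)/(δ−1) is undefined; the lower bound is there read as its limit N/e. *)

(* Defs.v *)
From HB Require Import structures.
From mathcomp Require Import all_boot all_order all_algebra.
From mathcomp Require Import all_classical all_reals all_analysis.

Set Implicit Arguments.
Unset Strict Implicit.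
Unset Printing Implicit Defensive.

Import Order.TTheory GRing.Theory Num.Theory.
Import numFieldNormedType.Exports.

Local Open Scope classical_set_scope.
Local Open Scope ring_scope.

Section Euclidean.
Context {R : realType} {N : nat}.
Implicit Types (x : 'rV[R]_N) (f : 'rV[R]_N -> R) (A : set 'rV[R]_N).

(* The library norm `|x| on 'rV[R]_N is the sup norm, hence not |x| here.  Its
   topology is the usual one. *)
Definition enorm x : R := Num.sqrt (\sum_(i < N) x ord0 i ^+ 2).

Definition unit_ball : set 'rV[R]_N := [set x | enorm x < 1].
Definition closed_unit_ball : set 'rV[R]_N := [set x | enorm x <= 1].
Definition unit_sphere : set 'rV[R]_N := [set x | enorm x = 1].
Definition punctured_unit_ball : set 'rV[R]_N :=
  [set x | 0 < enorm x < 1].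

Definition partial (i : 'I_N) f : 'rV[R]_N -> R :=
  fun x => 'D_(delta_mx ord0 i) f x.

Definition sqr_norm_grad f x : R := \sum_(i < N) partial i f x ^+ 2.

Definition laplacian f x : R := \sum_(i < N) partial i (partial i f) x.

(* Meant for an open set A; only the values of f on A matter. *)
Definition C1_on A f : Prop :=
  forall i x, A x ->
    derivable f x (delta_mx ord0 i) /\ {for x, continuous (partial i f)}.

Definition C2_on A f : Prop :=
  C1_on A f /\ forall i, C1_on A (partial i f).

Definition radial_on A f : Prop :=
  exists u : R -> R, forall x, A x -> f x = u (enorm x).

End Euclidean.

Arguments unit_ball R N : clear implicits.
Arguments closed_unit_ball R N : clear implicits.
Arguments unit_sphere R N : clear implicits.
Arguments punctured_unit_ball R N : clear implicits.

Section Problem.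
Context {R : realType}.
Variables (N : nat) (delta : R).
Implicit Types (lambda : R) (U : 'rV[R]_N -> R).

(* U is a radial function, continuous on the closed ball and vanishing on the
   sphere, which satisfies 0 < U < 1 and the equation classically on Om.  The
   bound U < 1 keeps the denominator 1 - U positive, so that the convention
   x / 0 = 0 never plays a role.  Nothing depends on U off the closed ball. *)
Definition radial_solution_on (Om : set 'rV[R]_N) lambda U : Prop :=
  [/\ radial_on (closed_unit_ball R N) U,
      {within closed_unit_ball R N, continuous U},
      C2_on Om U,
      (forall x, Om x -> 0 < U x < 1 /\
        - laplacian U x = (lambda + delta * sqr_norm_grad U x) / (1 - U x)) &
      (forall x, unit_sphere R N x -> U x = 0)].

Definition regular_solution lambda U : Prop :=
  radial_solution_on (unit_ball R N) lambda U.

(* A rupture solution: the equation can only hold off the origin. *)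
Definition singular_solution lambda U : Prop :=
  radial_solution_on (punctured_unit_ball R N) lambda U /\ U 0 = 1.

Definition solution lambda U : Prop :=
  regular_solution lambda U \/ singular_solution lambda U.

Definition is_extremal_value lbar : Prop :=
  [/\ 0 < lbar,
      (forall lambda, 0 < lambda -> lambda < lbar ->
         exists U, regular_solution lambda U) &
      (forall lambda, lbar < lambda -> ~ exists U, regular_solution lambda U)].

(* "The extremal solution satisfies P": the problem at the extremal value lbar
   has exactly one solution, up to the irrelevant values off the closed ball,
   and this solution satisfies P. *)
Definition the_extremal_solution lbar (P : ('rV[R]_N -> R) -> Prop) : Prop :=
  exists U, [/\ solution lbar U,
    (forall V, solution lbar V ->
       forall x, closed_unit_ball R N x -> V x = U x) & P U].

End Problem.

Section Eigenvalue.
Context {R : realType}.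
Variable N : nat.

(* Classical eigenfunctions; on the ball these are exactly the weak (H^1_0)
   ones, by elliptic regularity.  They are not required to be radial. *)
Definition dirichlet_eigenvalue (mu : R) : Prop :=
  exists phi : 'rV[R]_N -> R,
    [/\ {within closed_unit_ball R N, continuous phi},
        C2_on (unit_ball R N) phi,
        (forall x, unit_ball R N x -> - laplacian phi x = mu * phi x),
        (forall x, unit_sphere R N x -> phi x = 0) &
        exists2 x, unit_ball R N x & phi x != 0].

Definition first_dirichlet_eigenvalue (mu : R) : Prop :=
  dirichlet_eigenvalue mu /\ forall nu, dirichlet_eigenvalue nu -> mu <= nu.

End Eigenvalue.

(* N (2 / (delta + 1)) ^ ((delta + 1) / (delta - 1)).  At delta = 1 the exponent
   is undefined, and the expression is read as its limit N / e. *)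
Definition extremal_lower_bound {R : realType} (N : nat) (delta : R) : R :=
  if delta == 1 then N%:R * expR (- 1)
  else N%:R * (2 / (delta + 1)) `^ ((delta + 1) / (delta - 1)).

(* Main.v *)
(* Write N = n + 2 and w = 1 - U.  With phi = F(w), where F(w) is the integral of
   t^(-delta) from w to 1, the equation becomes -Delta phi = lam G(phi) with
   G(phi) = w^(-delta-1), which is convex.

   All regular solutions are rescalings r -> W(s r) / W(s) of one shooting orbit W,
   with parameter lam = s^2 / W(s)^2.  In the variables y = s W'(s) / W(s) and
   v = s^2 / W(s)^2 the orbit either reaches y = 1 at some s = s1 (where v is
   stationary) or stays in y < 1 and converges to (1, lstar), the cone w = r; the
   second case needs (1, lstar) to be a stable node, that is delta to be at most
   the root in (i).

   If s1 exists, the derivative of the orbit with respect to the scaling is a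
   positive solution of the linearized problem at the solution z with parameter
   v(s1).  Pairing it (Green's identity) with F(w) - F(z) and using the strict
   convexity of G shows that no solution exists beyond v(s1), where z is the only
   one: v(s1) is the extremal value.  In case (i), Hardy's inequality shows instead
   that a solution with parameter lam >= lstar has w <= r, so it is singular, and
   for lam = lstar it is the cone.

   If phi_1 is an eigenfunction for mu and lam kappa >= mu, where
   kappa F(w) < w^(-delta-1) (kappa = 4 and kappa = delta are admissible), then an
   interior maximum of phi_1 / (F(w) + c) for a small c > 0 contradicts the
   equation. *)
Require Import Defs.
From mathcomp Require Import all_boot all_order all_algebra.
From mathcomp Require Import all_classical all_reals all_analysis.
From mathcomp Require Import ring lra.
Import Order.TTheory GRing.Theory Num.Theory.
Import numFieldNormedType.Exports.

Set Implicit Arguments.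
Unset Strict Implicit.
Unset Printing Implicit Defensive.

Local Open Scope classical_set_scope.
Local Open Scope ring_scope.

(** * One-variable calculus *)

(** Two obstacles shape the argument. A competitor may be singular at the origin, so Green's
    identity leaves a boundary term there; it suffices that [r^(n+2) F(w)] becomes small along some
    radii. Regular solutions satisfy this trivially; for all others it follows from a bound w >= c r
    together with [delta < N/2], which is where this hypothesis of (ii) enters. Secondly, the
    shooting problem is singular at 0 and W may blow up at a finite radius. In the variable P =
    int_1^W t^(-delta) dt it reads P'' + (n+1)/s P' = K(P), with K extended to a bounded Lipschitz
    function; P exists for all s, and W is recovered from it as long as [lin (P s) > 0]. The node
    condition and Hardy's inequality give the same threshold because c^2 - 8 lstar and n^2 - 4 lstar
    (delta + 1), where c = n + 2 - 2 delta, are both (n - 2 delta)^2 - 4 (n + 1). The solution of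
    the linearized problem exists because kappa z(r / kappa) solves the equation with the same
    parameter for every kappa; its kappa-derivative z - r z' vanishes at r = 1 exactly when y = 1
    there. *)

Definition der {R : realType} (f : R -> R) (x d : R) : Prop := is_derive x 1 f d.

Section Calculus.
Context {R : realType}.
Implicit Types (f g : R -> R) (x a b c d : R).

Lemma der_cst a x : der (fun _ : R => a) x 0.
Proof. exact: is_derive_cst. Qed.

Lemma der_id x : der (fun z : R => z) x 1.
Proof. exact: is_derive_id. Qed.

Lemma derD f g x a b : der f x a -> der g x b ->
  der (fun z => f z + g z) x (a + b).
Proof. exact: is_deriveD. Qed.

Lemma derN f x a : der f x a -> der (fun z => - f z) x (- a).
Proof. exact: is_deriveN. Qed.

Lemma derM f g x a b : der f x a -> der g x b ->
  der (fun z => f z * g z) x (a * g x + f x * b).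
Proof.
move=> fa gb; apply: (is_derive_eq (is_deriveM fa gb)).
by rewrite /GRing.scale /=; ring.
Qed.

Lemma derX f x a n : der f x a ->
  der (fun z => f z ^+ n) x (n%:R * f x ^+ n.-1 * a).
Proof.
move=> fa; have -> : (fun z => f z ^+ n) = f ^+ n by apply/funext => z; rewrite fctE.
exact: (is_derive_eq (is_deriveX _ fa)).
Qed.

Lemma derV f x a : f x != 0 -> der f x a ->
  der (fun z => (f z)^-1) x (- a / f x ^+ 2).
Proof.
move=> fx fa; apply: (is_derive_eq (is_deriveV fx fa)).
by rewrite /GRing.scale /=; field.
Qed.

Lemma der_comp f g x a b : der f (g x) a -> der g x b ->
  der (fun z => f (g z)) x (a * b).
Proof. exact: is_derive1_comp. Qed.

Lemma der_exp g x a : der g x a ->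
  der (fun z => expR (g z)) x (expR (g x) * a).
Proof. by move=> ga; apply: (der_comp (f := expR)) => //; exact: is_derive_expR. Qed.

Lemma der_ln g x a : 0 < g x -> der g x a ->
  der (fun z => ln (g z)) x (a / g x).
Proof.
move=> g0 ga; rewrite mulrC; apply: (der_comp (f := @ln R)) => //.
exact: is_derive1_ln.
Qed.

Lemma der_pow g x a p : 0 < g x -> der g x a ->
  der (fun z => g z `^ p) x (p * g x `^ (p - 1) * a).
Proof.
by move=> g0 ga; apply: (der_comp (f := fun y => powR y p)) => //; exact: is_derive1_powR.
Qed.

Lemma der_sqrt g x a : 0 < g x -> der g x a ->
  der (fun z => Num.sqrt (g z)) x (a / (2 * Num.sqrt (g x))).
Proof.
move=> g0 ga; rewrite mulrC; apply: (der_comp (f := Num.sqrt)) => //.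
exact: is_derive1_sqrt.
Qed.

Lemma der_cont f x a : der f x a -> {for x, continuous f}.
Proof.
move=> fa; apply: differentiable_continuous; apply/derivable1_diffP.
by case: fa.
Qed.

Lemma der_eq f x a b : der f x a -> a = b -> der f x b.
Proof. by move=> fa <-. Qed.

Lemma der_near f g x a : (\forall z \near x, f z = g z) -> der f x a ->
  der g x a.
Proof. exact: near_eq_is_derive. Qed.

Lemma near_cont f g x : (\forall z \near x, g z = f z) ->
  {for x, continuous f} -> {for x, continuous g}.
Proof.
move=> fg fc; rewrite /prop_for /continuous_at (nbhs_singleton fg).
by apply: cvg_trans fc; apply: near_eq_cvg; apply: filterS fg.
Qed.

Lemma itv_sub01 a b x : 0 < a -> b < 1 -> a <= x <= b -> 0 < x < 1.
Proof. by move=> a0 b1 /andP[ax xb]; rewrite (lt_le_trans a0 ax) (le_lt_trans xb b1). Qed.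

End Calculus.

(** Hypotheses come first, so that a function with a known derivative in the context is treated as
    an atom. Side conditions (nonvanishing, positivity) that the context does not supply are left
    over. *)
Ltac der_step := first
 [ eassumption
 | simple apply der_cst
 | lazymatch goal with
   | |- der (fun z => z) ?x _ => apply: der_id
   | |- der (fun z => @?f z + @?g z) ?x _ => apply: (@derD _ f g)
   | |- der (fun z => - @?f z) ?x _ => apply: (@derN _ f)
   | |- der (fun z => @?f z * @?g z) ?x _ => apply: (@derM _ f g)
   | |- der (fun z => (@?f z) ^+ ?n) ?x _ => apply: (@derX _ f)
   | |- der (fun z => (@?f z)^-1) ?x _ => apply: (@derV _ f)
   | |- der (fun z => expR (@?f z)) ?x _ => apply: (@der_exp _ f)
   | |- der (fun z => ln (@?f z)) ?x _ => apply: (@der_ln _ f)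
   | |- der (fun z => (@?f z) `^ ?p) ?x _ => apply: (@der_pow _ f)
   | |- der (fun z => Num.sqrt (@?f z)) ?x _ => apply: (@der_sqrt _ f)
   end
 | apply: der_cst ].

Ltac der_auto := repeat (der_step; cbv beta).

Ltac der_calc := apply: der_eq; [der_auto | cbv beta].

(** * Mean value inequalities and the second-order test at a minimum *)

Section MeanValue.
Context {R : realType}.
Implicit Types (f g df : R -> R) (x a b c d : R).

Lemma der_within f df a b : (forall z, a <= z <= b -> der f z (df z)) ->
  {within `[a, b], continuous f}.
Proof.
move=> fd; apply: derivable_within_continuous => z; rewrite in_itv /= => /fd.
by case.
Qed.

Lemma mvt f df a b : a < b -> (forall z, a <= z <= b -> der f z (df z)) ->
  exists2 c, a < c < b & f b - f a = df c * (b - a).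
Proof.
move=> ab fd; have [|//|c] := @MVT _ f df a b ab.
- by move=> z; rewrite in_itv /= => /andP[az zb]; apply: fd; rewrite !ltW.
- exact: der_within fd.
- by rewrite in_itv => cab E; exists c.
Qed.

Lemma der_le f df a b : a <= b ->
  (forall z, a <= z <= b -> der f z (df z)) ->
  (forall z, a < z < b -> 0 <= df z) -> f a <= f b.
Proof.
rewrite le_eqVlt => /predU1P[-> //|ab] fd d0.
have [c cab E] := mvt ab fd.
by rewrite -subr_ge0 E mulr_ge0 ?d0// subr_ge0 ltW.
Qed.

Lemma der_le_oo f df a b : a <= b -> {within `[a, b], continuous f} ->
  (forall z, a < z < b -> der f z (df z)) ->
  (forall z, a < z < b -> 0 <= df z) -> f a <= f b.
Proof.
rewrite le_eqVlt => /predU1P[-> //|ab] fc fd d0.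
have fd' z : z \in `]a, b[ -> der f z (df z) by rewrite in_itv; exact: fd.
have [c] := MVT ab fd' fc.
rewrite in_itv => cab E.
by rewrite -subr_ge0 E mulr_ge0 ?d0// subr_ge0 ltW.
Qed.

Lemma der_lt f df a b : a < b ->
  (forall z, a <= z <= b -> der f z (df z)) ->
  (forall z, a < z < b -> 0 < df z) -> f a < f b.
Proof.
move=> ab fd d0; have [c cab E] := mvt ab fd.
by rewrite -subr_gt0 E mulr_gt0 ?d0// subr_gt0.
Qed.

Lemma der_ge f df a b : a <= b ->
  (forall z, a <= z <= b -> der f z (df z)) ->
  (forall z, a < z < b -> df z <= 0) -> f b <= f a.
Proof.
move=> ab fd d0; rewrite -lerN2.
apply: (@der_le (fun z => - f z) (fun z => - df z)) => // z zab.
- by apply: derN; apply: fd.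
- by rewrite oppr_ge0 d0.
Qed.

Lemma ivt f a b c : a <= b -> {within `[a, b], continuous f} ->
  f a <= c <= f b -> exists2 x, a <= x <= b & f x = c.
Proof.
move=> ab fc /andP[ac cb]; have [|x] := @IVT _ f a b c ab fc.
- by rewrite ge_min ac le_max cb orbT.
- by rewrite in_itv => xab E; exists x.
Qed.

(** Fermat gives the first claim. If d2 < 0, then df < 0 just to the right of x, and the mean value
    theorem makes f drop below its minimum. *)
Lemma der2_min f df x d2 e : 0 < e ->
  (forall z, `|z - x| < e -> der f z (df z)) ->
  der df x d2 -> (forall z, `|z - x| < e -> f x <= f z) ->
  df x = 0 /\ 0 <= d2.
Proof.
move=> e0 fd dfd fmin.
have dfx : df x = 0.
  have h : der f x 0.
    apply: (@derive1_at_min _ f (x - e) (x + e)).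
    - by rewrite lerD2l; lra.
    - move=> t; rewrite in_itv /= => /andP[? ?].
      have /fd : `|t - x| < e by rewrite ltr_norml; apply/andP; split; lra.
      by case.
    - by rewrite in_itv /=; apply/andP; split; lra.
    - move=> t; rewrite in_itv /= => /andP[? ?].
      by apply: fmin; rewrite ltr_norml; apply/andP; split; lra.
  have := fd x; rewrite subrr normr0 => /(_ e0) h'.
  by rewrite -(@derive_val _ _ _ _ _ _ _ h') (@derive_val _ _ _ _ _ _ _ h).
split=> //; rewrite leNgt; apply/negP => d20.
case: dfd => dfd dfE.
have cv : h^-1 *: ((df \o shift x) (h *: 1) - df x) @[h --> 0^'] --> d2.
  by rewrite -dfE; exact: dfd.
have : \forall h \near (0:R)^', h^-1 *: ((df \o shift x) (h *: 1) - df x) < 0.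
  exact: (cvgr_lt d2).
rewrite /= near_withinE => /nbhs_ballP[r /= r0 hr].
pose m := Num.min r e.
have m0 : 0 < m by rewrite lt_min r0.
have mr : m <= r by rewrite ge_min lexx.
have me : m <= e by rewrite ge_min lexx orbT.
have neg z : x < z < x + m -> df z < 0.
  move=> /andP[xz zm].
  have := hr (z - x); rewrite /ball /= sub0r normrN gtr0_norm ?subr_gt0//.
  have zx : z - x != 0 by rewrite subr_eq0 gt_eqF.
  move=> /(_ _ zx); rewrite dfx subr0 /GRing.scale /= mulr1 subrK pmulr_rlt0.
    by apply; lra.
  by rewrite invr_gt0 subr_gt0.
have lt : x < x + m / 2 by lra.
have [z|c /andP[c1 c2] E] := @mvt f df x (x + m / 2) lt.
  by move=> /andP[? ?]; apply: fd; rewrite ltr_norml; apply/andP; split; lra.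
have := fmin (x + m / 2); rewrite addrAC subrr add0r gtr0_norm; last lra.
have -> : m / 2 < e by lra.
move=> /(_ isT); rewrite -subr_ge0 E addrAC subrr add0r.
have /neg : x < c < x + m by lra.
nra.
Qed.

End MeanValue.

(** * The nonlinear change of variable *)

Section Transform.
Context {R : realType}.
Variable delta : R.
Hypothesis delta0 : 0 < delta.
Implicit Types (w z x y : R).

(* [Fw w] is the integral of [pw] from [w] to 1: the substitution phi = Fw(1 - U)
   removes the gradient term, turning the equation into -Delta phi = lam pw w / w. *)
Definition pw w := w `^ (- delta).

Definition Fw w := if delta == 1 then - ln w
  else (w `^ (1 - delta) - 1) / (delta - 1).

Lemma pw_gt0 w : 0 < w -> 0 < pw w.
Proof. exact: powR_gt0. Qed.

Lemma pw1 : pw 1 = 1.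
Proof. by rewrite /pw powR1. Qed.

Lemma der_pw w : 0 < w -> der pw w (- delta * pw w / w).
Proof.
move=> w0; rewrite /pw; der_calc.
rewrite /pw mulr1 powRB; last by apply/implyP => _; rewrite gt_eqF.
by rewrite powRr1 ?ltW// mulrA.
Qed.

Lemma der_Fw w : 0 < w -> der Fw w (- pw w).
Proof.
move=> w0; rewrite /Fw /pw; have [d1|d1] := eqVneq delta 1.
  der_calc.
  by rewrite d1 powR_inv1 ?ltW// mul1r.
der_calc.
have -> : 1 - delta - 1 = - delta by ring.
by field; rewrite subr_eq0.
Qed.

Lemma Fw1 : Fw 1 = 0.
Proof. by rewrite /Fw ln1 powR1 subrr oppr0 mul0r if_same. Qed.

Lemma pw_lt w z : 0 < w -> w < z -> pw z < pw w.
Proof.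
move=> w0 wz; rewrite -ltrN2.
apply: (@der_lt _ (fun z => - pw z) (fun z => - (- delta * pw z / z))) => // x.
  move=> /andP[wx _]; have h : der pw x _ := der_pw (lt_le_trans w0 wx).
  by der_auto.
move=> /andP[wx _]; have x0 := lt_trans w0 wx.
by rewrite !mulNr opprK divr_gt0// mulr_gt0// pw_gt0.
Qed.

Lemma pw_le w z : 0 < w -> w <= z -> pw z <= pw w.
Proof.
by move=> w0; rewrite le_eqVlt => /predU1P[-> //|/(pw_lt w0)/ltW].
Qed.

Lemma Fw_lt w z : 0 < w -> w < z -> Fw z < Fw w.
Proof.
move=> w0 wz; rewrite -ltrN2.
apply: (@der_lt _ (fun z => - Fw z) (fun z => - - pw z)) => // x.
  by move=> /andP[wx _]; apply: derN; apply: der_Fw; exact: lt_le_trans wx.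
by move=> /andP[wx _]; rewrite opprK pw_gt0//; exact: lt_trans wx.
Qed.

Lemma Fw_le w z : 0 < w -> w <= z -> Fw z <= Fw w.
Proof.
by move=> w0; rewrite le_eqVlt => /predU1P[-> //|/(Fw_lt w0)/ltW].
Qed.

Lemma Fw_ge0 w : 0 < w <= 1 -> 0 <= Fw w.
Proof. by move=> /andP[w0 w1]; rewrite -Fw1 Fw_le. Qed.

(** [Fw w] is the integral over [w, 1] of a decreasing function whose largest value is [pw w]. *)
Lemma Fw_lt_pw w : 0 < w < 1 -> Fw w < pw w * (1 - w).
Proof.
move=> /andP[w0 w1]; rewrite -subr_gt0.
have -> : 0 = pw w * (1 - 1) - Fw 1 by rewrite Fw1 subrr mulr0 subr0.
rewrite -subr_gt0.
have h : (fun z => pw w * (z - 1) + Fw z) 1 > (fun z => pw w * (z - 1) + Fw z) w.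
  apply: (@der_lt _ (fun z => pw w * (z - 1) + Fw z) (fun z => pw w - pw z)); [exact: w1| |] => z /andP[wz _].
    have h : der Fw z _ := der_Fw (lt_le_trans w0 wz).
    by der_calc; ring.
  by rewrite subr_gt0 pw_lt.
by move: h; rewrite /= Fw1; lra.
Qed.

Lemma Fw_le_pw w : 0 < w <= 1 -> Fw w <= pw w.
Proof.
move=> /andP[w0]; rewrite le_eqVlt => /predU1P[->|w1].
  by rewrite Fw1 pw1.
have := @Fw_lt_pw w; rewrite w0 w1 => /(_ isT)/ltW/le_trans; apply.
by rewrite ler_piMr ?ltW ?pw_gt0//; lra.
Qed.

Lemma der_pwdiv w : 0 < w -> der (fun w => pw w / w) w (- (delta + 1) * pw w / w ^+ 2).
Proof.
move=> w0; have h := der_pw w0; have wn : w != 0 by rewrite gt_eqF.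
by der_calc; field.
Qed.

(* In the variable [phi = Fw w] the nonlinearity is [G(phi) = w^(-delta-1)],
   with [G'(phi) = (delta + 1) / w^2]; this is the strict convexity of [G]. *)
Lemma Fw_convex_lt w z : 0 < w -> 0 < z -> w != z ->
  (delta + 1) / z ^+ 2 * (Fw w - Fw z) < pw w / w - pw z / z.
Proof.
move=> w0 z0 wz.
(* Up to a constant, H is the gap between G and its tangent at z; the sign of dH shows that z is its
   strict minimum. *)
pose H x := pw x / x - (delta + 1) / z ^+ 2 * Fw x.
pose dH x := (delta + 1) * pw x * (z ^- 2 - x ^- 2).
have dHE x : 0 < x -> der H x (dH x).
  move=> x0; have h1 := der_pwdiv x0; have h2 := der_Fw x0.
  have xn : x != 0 by rewrite gt_eqF.
  have zn : z != 0 by rewrite gt_eqF.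
  apply: der_eq.
    apply: (@derD _ (fun x => pw x / x) (fun x => - ((delta + 1) / z ^+ 2 * Fw x))).
      exact: h1.
    apply: (@derN _ (fun x => (delta + 1) / z ^+ 2 * Fw x)).
    by apply: (@derM _ (fun=> (delta + 1) / z ^+ 2) Fw); [exact: der_cst|exact: h2].
  by rewrite /dH; field; rewrite xn zn.
have d1 : 0 < delta + 1 by have h := delta0; lra.
suff : H z < H w.
  rewrite /H mulrBr; move: (_ / z ^+ 2) (pw w / w) (pw z / z) => a b c; lra.
have [wz'|zw] : w < z \/ z < w by apply/orP; rewrite -neq_lt.
- rewrite -ltrN2; apply: (@der_lt _ (fun x => - H x) (fun x => - dH x)) => // x.
    by move=> /andP[wx _]; apply: derN; apply: dHE; exact: lt_le_trans wx.
  move=> /andP[wx xz]; have x0 := lt_trans w0 wx.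
  rewrite /dH -mulrN mulr_gt0 ?mulr_gt0 ?pw_gt0// opprB subr_gt0.
  by rewrite ltf_pV2 ?posrE ?exprn_gt0// ltrXn2r// ltW.
- apply: (@der_lt _ H dH) => // x.
    by move=> /andP[wx _]; apply: dHE; exact: lt_le_trans wx.
  move=> /andP[wx xz]; have x0 := lt_trans z0 wx.
  rewrite /dH mulr_gt0 ?mulr_gt0 ?pw_gt0// subr_gt0.
  by rewrite ltf_pV2 ?posrE ?exprn_gt0// ltrXn2r// ltW.
Qed.

Lemma Fw_convex w z : 0 < w -> 0 < z ->
  (delta + 1) / z ^+ 2 * (Fw w - Fw z) <= pw w / w - pw z / z.
Proof.
move=> w0 z0; have [->|wz] := eqVneq w z; first by rewrite !subrr mulr0.
exact/ltW/Fw_convex_lt.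
Qed.

(** The constant 4 comes from w (1 - w) <= 1/4 applied to [Fw_lt_pw]. *)
Lemma Fw_four w : 0 < w <= 1 -> 4 * Fw w < pw w / w.
Proof.
move=> /andP[w0]; rewrite le_eqVlt => /predU1P[->|w1].
  by rewrite Fw1 pw1 mulr0 divr1.
have h := @Fw_lt_pw w; rewrite w0 w1 in h; have {}h := h isT.
rewrite ltr_pdivlMr//; have p0 := pw_gt0 w0.
have : Fw w * w < pw w * (1 - w) * w by rewrite ltr_pM2r.
have : 0 <= pw w * (1 - 2 * w) ^+ 2 by rewrite mulr_ge0 ?sqr_ge0// ltW.
lra.
Qed.

(** The difference of the two sides decreases on (0, 1] and still equals 1 at w = 1. *)
Lemma Fw_delta w : 0 < w <= 1 -> delta * Fw w < pw w / w.
Proof.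
move=> /andP[w0 w1].
suff : (fun w => pw w / w - delta * Fw w) 1 <= (fun w => pw w / w - delta * Fw w) w.
  by rewrite /= Fw1 pw1 mulr0 divr1 subr0; lra.
apply: (@der_ge _ (fun w => pw w / w - delta * Fw w) (fun w => - (delta + 1) * pw w / w ^+ 2 + delta * pw w)) => // z.
  move=> /andP[wz _]; have z0 := lt_le_trans w0 wz.
  have h1 := der_pwdiv z0; have h2 := der_Fw z0.
  apply: der_eq.
    apply: (@derD _ (fun x => pw x / x) (fun x => - (delta * Fw x))).
      exact: h1.
    apply: (@derN _ (fun x => delta * Fw x)).
    by apply: (@derM _ (fun=> delta) Fw); [exact: der_cst|exact: h2].
  by rewrite mul0r add0r mulrN opprK.
move=> /andP[wz z1]; have z0 := lt_trans w0 wz; have p0 := pw_gt0 z0.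
have : 1 <= z ^- 2 by rewrite -exprVn exprn_ege1// invf_ge1// ltW.
move=> h; have : pw z * 1 <= pw z * z ^- 2 by rewrite ler_pM2l.
have : 0 <= delta * (pw z * z ^- 2 - pw z).
  by rewrite mulr_ge0 ?(ltW delta0)//; rewrite subr_ge0 -[X in X <= _]mulr1 ler_pM2l.
lra.
Qed.

(* [Om x] is the value [W >= 1] with [int_1^W t^(-delta) dt = x], and
   [Ksrc x = W^(-delta-1)], extended by 1 for [x < 0] and by 0 past the value
   where [W] becomes infinite (possible when [delta > 1]). *)
Definition lin x := 1 + (1 - delta) * x.
Definition Om x := expR (if delta == 1 then x else ln (lin x) / (1 - delta)).
Definition Kpos x := lin x / Om x ^+ 2.
Definition Ksrc x := if x <= 0 then 1 else if lin x <= 0 then 0 else Kpos x.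

Lemma Om_gt0 x : 0 < Om x.
Proof. exact: expR_gt0. Qed.

Lemma der_Om x : 0 < lin x -> der Om x (Om x / lin x).
Proof.
move=> l0; rewrite /Om; have [d1|d1] := eqVneq delta 1.
  der_calc.
  by rewrite /lin d1 subrr mul0r addr0 divr1 mulr1.
have dl : der lin x (1 - delta) by rewrite /lin; der_calc; ring.
have dn : 1 - delta != 0 by rewrite subr_eq0 eq_sym.
by (der_calc; field; rewrite dn gt_eqF).
Qed.

Lemma Om0 : Om 0 = 1.
Proof. by rewrite /Om /lin mulr0 addr0 ln1 mul0r if_same expR0. Qed.

(** With W = [Om x], integrating t^(-delta) gives [lin x] = W^(1 - delta); this also explains why
    [Kpos x] is W^(-delta-1). *)
Lemma pw_Om x : 0 < lin x -> pw (Om x) = lin x / Om x.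
Proof.
move=> l0; rewrite /pw /Om; have [d1|d1] := eqVneq delta 1.
  by rewrite /lin d1 powR_inv1 ?expR_ge0// subrr mul0r addr0 mul1r.
have dn : 1 - delta != 0 by rewrite subr_eq0 eq_sym.
rewrite -{2}(lnK l0) -expRB -expRM; congr expR.
by field.
Qed.

Lemma der_Kpos x : 0 < lin x -> der Kpos x (- (delta + 1) / Om x ^+ 2).
Proof.
move=> l0; have h := der_Om l0; have o0 : Om x != 0 by rewrite gt_eqF ?Om_gt0.
have o2 : Om x ^+ 2 != 0 by rewrite expf_neq0.
have dl : der lin x (1 - delta) by rewrite /lin; der_calc; ring.
rewrite /Kpos; der_calc.
by field; rewrite o0 gt_eqF.
Qed.

Lemma lin_between x y z : 0 < lin x -> 0 < lin y -> x <= z <= y -> 0 < lin z.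
Proof.
rewrite /lin => lx ly /andP[xz zy]; have [d|d] := leP 0 (1 - delta).
- have : 0 <= (1 - delta) * (z - x) by rewrite mulr_ge0// subr_ge0.
  lra.
- have : 0 <= - (1 - delta) * (y - z) by rewrite mulr_ge0 ?subr_ge0// oppr_ge0 ltW.
  lra.
Qed.

Lemma Om_ge1 x : 0 <= x -> 0 < lin x -> 1 <= Om x.
Proof.
move=> x0 l0; rewrite -Om0; have l1 : 0 < lin 0 by rewrite /lin mulr0 addr0.
apply: (@der_le _ Om (fun z => Om z / lin z)) => // z.
  by move=> zx; apply: der_Om; exact: lin_between zx.
move=> /andP[? ?]; rewrite divr_ge0 ?(ltW (Om_gt0 _))// ltW//.
by apply: (lin_between l1 l0); rewrite !ltW.
Qed.

(** The derivative -(delta + 1) / W^2 lies between -(delta + 1) and 0, since W >= 1 when the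
    argument is nonnegative. *)
Lemma Kpos_lip x y : 0 <= x <= y -> 0 < lin y ->
  0 <= Kpos x - Kpos y <= (delta + 1) * (y - x).
Proof.
move=> /andP[x0 xy] ly; have l1 : 0 < lin 0 by rewrite /lin mulr0 addr0.
have lz z : 0 <= z <= y -> 0 < lin z by exact: lin_between.
have zb z : x <= z <= y -> 0 <= z <= y.
  by move=> /andP[xz ->]; rewrite (le_trans x0).
have zb' z : x < z < y -> 0 <= z <= y.
  by move=> /andP[xz zy]; apply: zb; rewrite !ltW.
have d1 : 0 <= delta + 1 by have h := delta0; lra.
rewrite subr_ge0; apply/andP; split.
  apply: (@der_ge _ Kpos (fun z => - (delta + 1) / Om z ^+ 2)); [exact: xy| |] => z hz.
    by apply: der_Kpos; apply: lz; exact: zb.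
  by rewrite mulNr oppr_le0 divr_ge0// exprn_ge0// ltW// Om_gt0.
suff : (fun z => Kpos z + (delta + 1) * z) x <= (fun z => Kpos z + (delta + 1) * z) y.
  by rewrite /=; lra.
apply: (@der_le _ (fun z => Kpos z + (delta + 1) * z)
  (fun z => - (delta + 1) / Om z ^+ 2 + (delta + 1))); [exact: xy| |] => z hz.
  by have h := der_Kpos (lz _ (zb _ hz)); der_calc; ring.
rewrite mulNr addrC subr_ge0 ler_pdivrMr ?exprn_gt0 ?Om_gt0//.
rewrite ler_peMr// exprn_ege1// Om_ge1 ?lz//; last exact: zb'.
by case/andP: (zb' _ hz).
Qed.

Lemma Ksrc_ge0E x : 0 <= x -> Ksrc x = if lin x <= 0 then 0 else Kpos x.
Proof.
rewrite /Ksrc le_eqVlt => /predU1P[<-|x0]; last by rewrite leNgt x0.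
by rewrite lexx /lin mulr0 addr0 ler10 /Kpos /lin mulr0 addr0 Om0 expr1n divr1.
Qed.

Lemma Ksrc_lip_le x y : 0 <= x <= y ->
  0 <= Ksrc x - Ksrc y <= (delta + 1) * (y - x).
Proof.
move=> /[dup] xy' /andP[x0 xy]; have y0 := le_trans x0 xy.
rewrite !Ksrc_ge0E//; have [ly|ly] := leP (lin y) 0; last first.
  have lx : 0 < lin x by apply: (@lin_between 0 y x); rewrite ?x0 ?xy// /lin mulr0 addr0.
  have -> : (lin x <= 0) = false by apply/negbTE; rewrite -ltNge.
  exact: Kpos_lip.
rewrite subr0; have d1 : 0 <= delta + 1 by have h := delta0; lra.
have [lx|lx] := leP (lin x) 0; first by rewrite lexx mulr_ge0// subr_ge0.
rewrite /Kpos divr_ge0 ?(ltW lx) ?exprn_ge0 ?(ltW (Om_gt0 _))//=.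
(* When y is past the blow-up value, [lin y <= 0] bounds [lin x] by (delta - 1) (y - x), and
   [Kpos x <= lin x] because W >= 1. *)
apply: (@le_trans _ _ (lin x)); last by move: ly; rewrite /lin; lra.
rewrite ler_pdivrMr ?exprn_gt0 ?Om_gt0// ler_peMr ?(ltW lx)//.
by rewrite exprn_ege1// Om_ge1.
Qed.

Lemma Ksrc01 x : 0 <= Ksrc x <= 1.
Proof.
case: (leP x 0) => x0; first by rewrite /Ksrc x0 ler01 lexx.
have := @Ksrc_lip_le 0 x; rewrite lexx (ltW x0) => /(_ isT) /andP[+ _].
rewrite {1}/Ksrc lexx => h; apply/andP; split; last lra.
rewrite (Ksrc_ge0E (ltW x0)); case: (leP (lin x) 0) => lx //.
by apply: divr_ge0; [exact: ltW|rewrite exprn_ge0// (ltW (Om_gt0 _))].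
Qed.

Lemma Ksrc_lip x y : `|Ksrc x - Ksrc y| <= (delta + 1) * `|x - y|.
Proof.
wlog xy : x y / x <= y.
  move=> h; case: (leP x y) => [|/ltW] /h //.
  by rewrite distrC [X in _ <= _ * X]distrC.
have d1 : 0 <= delta + 1 by have h := delta0; lra.
rewrite [X in _ <= _ * X]distrC [X in _ <= _ * X]ger0_norm ?subr_ge0//.
have [y0|y0] := leP y 0.
  have x0 := le_trans xy y0.
  by rewrite /Ksrc x0 y0 subrr normr0 mulr_ge0// subr_ge0.
have [x0|x0] := leP x 0; last first.
  have /andP[? ?] : 0 <= Ksrc x - Ksrc y <= (delta + 1) * (y - x).
    by apply: Ksrc_lip_le; rewrite (ltW x0).
  by rewrite ger0_norm.
have -> : Ksrc x = Ksrc 0 by rewrite /Ksrc x0 lexx.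
have /andP[? h] : 0 <= Ksrc 0 - Ksrc y <= (delta + 1) * (y - 0).
  by apply: Ksrc_lip_le; rewrite lexx ltW.
by rewrite ger0_norm//; apply: le_trans h _; rewrite ler_wpM2l//; lra.
Qed.

End Transform.

(** * Radial initial value problems *)

Section Picard.
Context {R : realType}.
Implicit Types (f g k J P : R -> R) (s x : R).

Lemma antiderivative f : continuous f ->
  exists J, J 0 = 0 /\ forall x, -1 < x -> der J x (f x).
Proof.
move=> fc.
(* Starting at -1 rather than 0 makes 0 an interior point, so that J has a two-sided derivative
   there. *)
pose G x := (\int[lebesgue_measure]_(t in [set` `[-1, x]]) f t)%R.
exists (fun x => G x + - G 0); split=> [|x x1]; first by rewrite subrr.
have [dG Gx] : derivable G x 1 /\ G^`()%classic x = f x.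
  apply: (@continuous_FTC1_closed _ f (-1) x (x + 1)); first by rewrite ltrDl.
  - apply: continuous_compact_integrable; first exact: segment_compact.
    exact: continuous_subspaceT.
  - exact: x1.
  - exact: fc.
have hG : der G x (f x).
  by constructor; [exact: dG | rewrite -derive1E; exact: Gx].
by rewrite -[f x]addr0; apply: (@derD _ G (fun=> - G 0)); [exact: hG|exact: der_cst].
Qed.

Variables (n : nat).

(* [P] solves P'' + (n+1)/s P' = k on s > 0 with P(0) = P'(0) = 0; here
   [J] is s^(n+1) P'. *)
Definition radial_potential k J P :=
  [/\ continuous P, (forall s, s <= 0 -> P s = 0),
      {for 0, continuous J} /\ J 0 = 0,
      forall s, 0 < s -> der J s (s ^+ n.+1 * k s) &
      forall s, 0 < s -> der P s (J s / s ^+ n.+1)].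

Lemma radial_potential0 : radial_potential (fun=> 0) (fun=> 0) (fun=> 0).
Proof.
split=> //.
- by move=> s; exact: cvg_cst.
- by split=> //; exact: cvg_cst.
- by move=> s _; rewrite mulr0; exact: der_cst.
- by move=> s _; rewrite mul0r; exact: der_cst.
Qed.

Lemma within_pos f s : 0 <= s -> {for 0, continuous f} ->
  (forall z, 0 < z -> {for z, continuous f}) -> {within `[0, s], continuous f}.
Proof.
move=> s0 f0 fz; apply: continuous_in_subspaceT => z.
rewrite inE /= in_itv /= => /andP[]; rewrite le_eqVlt => /predU1P[<- _ //|z0 _].
exact: fz.
Qed.

Lemma potential_J_ge0 k J P s : radial_potential k J P ->
  (forall z, 0 < z -> 0 <= k z) -> 0 <= s -> 0 <= J s.
Proof.
move=> [_ _ [Jc J0] dJ _] k0 s0; rewrite -J0.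
apply: (@der_le_oo _ J (fun z => z ^+ n.+1 * k z)) => //.
- by apply: within_pos => // z /dJ; exact: der_cont.
- by move=> z /andP[z0 _]; exact: dJ.
- by move=> z /andP[z0 _]; rewrite mulr_ge0 ?k0// exprn_ge0// ltW.
Qed.

(** A comparison principle: combined with [potentialB], it turns inequalities between sources into
    inequalities between potentials. *)
Lemma potential_ge0 k J P s : radial_potential k J P ->
  (forall z, 0 < z -> 0 <= k z) -> 0 <= P s.
Proof.
move=> h k0; case: (h) => Pc P0 _ dJ dP.
case: (leP s 0) => [/P0 -> //|s0]; rewrite -(P0 0)//.
apply: (@der_le_oo _ P (fun z => J z / z ^+ n.+1)) => //; first exact: ltW.
- exact: continuous_subspaceT.
- by move=> z /andP[z0 _]; exact: dP.
- move=> z /andP[z0 _]; rewrite divr_ge0 ?exprn_ge0 ?(ltW z0)//.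
  by apply: (potential_J_ge0 h) => //; exact: ltW.
Qed.

(** The form c P1 - P2 covers both plain differences (c = 1) and comparison with a multiple of the
    weight. *)
Lemma potentialB k1 J1 P1 k2 J2 P2 c : radial_potential k1 J1 P1 ->
  radial_potential k2 J2 P2 ->
  radial_potential (fun s => c * k1 s - k2 s) (fun s => c * J1 s - J2 s)
    (fun s => c * P1 s - P2 s).
Proof.
move=> [c1 z1 [jc1 j1] dj1 dp1] [c2 z2 [jc2 j2] dj2 dp2]; split.
- by move=> s; apply: cvgB; [apply: cvgM; [exact: cvg_cst|exact: c1]|exact: c2].
- by move=> s s0; rewrite z1// z2// mulr0 subr0.
- split; last by rewrite j1 j2 mulr0 subr0.
  by apply: cvgB; [apply: cvgM; [exact: cvg_cst|exact: jc1]|exact: jc2].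
- move=> s s0; have h1 := dj1 _ s0; have h2 := dj2 _ s0.
  by der_calc; ring.
- move=> s s0; have h1 := dp1 _ s0; have h2 := dp2 _ s0.
  by der_calc; ring.
Qed.

Variable L : R.
Hypothesis L0 : 0 < L.

(* [s^(n+1) (e^(L s^2))' has derivative at least 2 L s^(n+1) e^(L s^2)], which
   makes the Picard map a 1/2-contraction for the corresponding weighted norm. *)
Definition weight s := expR (L * (s * s)).

(** The source is the radial Laplacian of e^(L s^2), that is 2 L e^(L s^2) (n + 2 + 2 L s^2).
    Subtracting 1 makes the potential vanish at 0. *)
Lemma weight_potential : exists2 k, radial_potential k
   (fun s => s ^+ n.+1 * (2 * L * s * weight s))
   (fun s => if s <= 0 then 0 else weight s - 1) &
   forall s, 2 * L * weight s <= k s.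
Proof.
exists (fun s => 2 * L * weight s * (n.+2%:R + 2 * L * s ^+ 2)); last first.
  move=> s; rewrite ler_peMr//.
    by rewrite mulr_ge0 ?(expR_ge0 (L * (s * s)))// mulr_ge0// ltW.
  have : 1 <= n.+2%:R :> R by rewrite ler1n.
  have : 0 <= 2 * L * s ^+ 2 by rewrite mulr_ge0 ?sqr_ge0// mulr_ge0// ltW.
  lra.
have dw s : der weight s (2 * L * s * weight s).
  by rewrite /weight; der_calc; ring.
have cw s : {for s, continuous weight} by apply: der_cont.
split.
- move=> s; case: (ltgtP s 0) => s0.
  + apply: (@near_cont _ (fun=> 0)); last exact: cvg_cst.
    near=> z; rewrite ltW//; near: z; exact: lt_nbhsl.
  + apply: (@near_cont _ (fun z => weight z - 1)).
      by near=> z; rewrite leNgt ifN// negbK; near: z; exact: lt_nbhsr.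
    by apply: cvgB; [exact: cw|exact: cvg_cst].
  + rewrite s0; apply/cvgrPdist_lt => e e0.
    have : (weight z - 1) @[z --> (0 : R)] --> weight 0 - 1.
      by apply: cvgB; [exact: cw|exact: cvg_cst].
    rewrite {2}/weight !mulr0 expR0 subrr => /cvgrPdist_lt /(_ e e0).
    apply: filterS => z; rewrite lexx; case: ifP => // _ _.
    by rewrite subrr normr0.
- by move=> s ->.
- split; last by rewrite mulr0 mul0r mulr0.
  by apply: der_cont; have h := dw 0; der_auto.
- move=> s s0; have h := dw s; der_calc.
  by rewrite /= (exprS s n) -(natr1 n.+1) -(natr1 n); ring.
- move=> s s0; have h : der (fun s => weight s - 1) s (2 * L * s * weight s).
    by have h := dw s; der_calc; ring.
  apply: der_eq.
    apply: der_near h; near=> z; rewrite leNgt ifN// negbK.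
    by near: z; exact: lt_nbhsr.
  by rewrite [RHS]mulrAC divff ?mul1r// expf_neq0// gt_eqF.
Unshelve. all: by end_near. Qed.

(** (M / 2) (e^(L s^2) - 1) is a barrier for both P1 - P2 and P2 - P1, because its source is at
    least L M e^(L s^2). *)
Lemma potential_contract k1 J1 P1 k2 J2 P2 M : 0 <= M ->
  radial_potential k1 J1 P1 -> radial_potential k2 J2 P2 ->
  (forall s, 0 < s -> `|k1 s - k2 s| <= L * M * weight s) ->
  forall s, `|P1 s - P2 s| <= M / 2 * weight s.
Proof.
move=> M0 h1 h2 hk s; have [k hw kw] := weight_potential.
have M2 : 0 <= M / 2 by lra.
have d1 : radial_potential (fun s => 1 * k1 s - k2 s) _ _ := potentialB 1 h1 h2.
have d2 : radial_potential (fun s => 1 * k2 s - k1 s) _ _ := potentialB 1 h2 h1.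
have bk z : L * M * weight z <= M / 2 * k z.
  by apply: le_trans (ler_wpM2l M2 (kw z)); rewrite le_eqVlt; apply/orP; left; apply/eqP; field.
have g1 : 0 <= M / 2 * (if s <= 0 then 0 else weight s - 1) - (1 * P1 s - P2 s).
  apply: (potential_ge0 _ (potentialB (M / 2) hw d1)) => z z0.
  have := hk _ z0; rewrite ler_norml => /andP[_ ?].
  by have := bk z; rewrite mul1r; lra.
have g2 : 0 <= M / 2 * (if s <= 0 then 0 else weight s - 1) - (1 * P2 s - P1 s).
  apply: (potential_ge0 _ (potentialB (M / 2) hw d2)) => z z0.
  have := hk _ z0; rewrite ler_norml => /andP[? _].
  by have := bk z; rewrite mul1r; lra.
have g3 : M / 2 * (if s <= 0 then 0 else weight s - 1) <= M / 2 * weight s.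
  apply: ler_wpM2l => //; case: ifP => _; first exact: expR_ge0.
  by rewrite gerBl.
by rewrite ler_norml; apply/andP; split; lra.
Qed.

Lemma potential_exists k : continuous k -> (forall s, 0 <= k s <= 1) ->
  exists JP, radial_potential k JP.1 JP.2.
Proof.
move=> kc k01.
have kc' : continuous (fun s => s ^+ n.+1 * k s).
  by move=> s; apply: cvgM; [exact: exprn_continuous|exact: kc].
have [J [J0 dJ]] := antiderivative kc'.
(* The bound k <= 1 gives J <= s^(n+2), which is what makes P' = J / s^(n+1) continuous at 0. *)
have Jb s : 0 < s -> 0 <= J s / s ^+ n.+1 <= s.
  move=> s0.
  have dJz z : 0 <= z <= s -> der J z (z ^+ n.+1 * k z).
    by move=> /andP[? _]; apply: dJ; lra.
  rewrite divr_ge0 ?exprn_ge0 ?(ltW s0)//=; last first.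
    rewrite -J0; apply: (der_le (ltW s0) dJz) => z /andP[z0 _].
    by case/andP: (k01 z) => ? _; rewrite mulr_ge0// exprn_ge0// ltW.
  rewrite ler_pdivrMr ?exprn_gt0// -subr_ge0.
  have -> : 0 = 0 * 0 ^+ n.+1 - J 0 by rewrite J0 mul0r subr0.
  apply: (@der_le _ (fun z => z * z ^+ n.+1 - J z)
     (fun z => n.+2%:R * z ^+ n.+1 - z ^+ n.+1 * k z)); first exact: ltW.
  - move=> z zs; have h := dJz _ zs; der_calc.
    by rewrite /= (exprS z n) -(natr1 n.+1); ring.
  - move=> z /andP[z0 _]; case/andP: (k01 z) => ? k1.
    have ? : 1 <= n.+2%:R :> R by rewrite ler1n.
    by rewrite [n.+2%:R * _]mulrC -mulrBr mulr_ge0 ?exprn_ge0 ?(ltW z0)//; lra.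
pose p s := if s <= 0 then 0 else J s / s ^+ n.+1.
have pc : continuous p.
  move=> s; case: (ltgtP s 0) => s0.
  - apply: (@near_cont _ (fun=> 0)); last exact: cvg_cst.
    by near=> z; rewrite /p ltW//; near: z; exact: lt_nbhsl.
  - apply: (@near_cont _ (fun z => J z / z ^+ n.+1)).
      by near=> z; rewrite /p leNgt ifN// negbK; near: z; exact: lt_nbhsr.
    have h := dJ s; apply: cvgM; first by apply: (der_cont (h _)); lra.
    apply: cvgV; first by rewrite gt_eqF// exprn_gt0.
    exact: exprn_continuous.
  - rewrite s0; apply/cvgrPdist_lt => e e0; near=> z.
    rewrite /p lexx sub0r normrN; case: ifPn => [_|]; first by rewrite normr0.
    rewrite -ltNge => z0.
    have /andP[? le] := Jb _ z0; rewrite ger0_norm//; apply: le_lt_trans le _.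
    by near: z; exact: lt_nbhsl.
have [Q [Q0 dQ]] := antiderivative pc.
exists (J, fun s => Q (Num.max s 0)); split=> /=.
- move=> s; apply: (@continuous_comp _ _ _ (fun s => Num.max s 0) Q).
    by apply: (@continuous_max _ _ id (fun=> 0)); [exact: cvg_id|exact: cvg_cst].
  by apply: der_cont (dQ _ _); rewrite lt_max; apply/orP; right; lra.
- by move=> s s0; rewrite max_r.
- by split=> //; apply: der_cont (dJ _ _); lra.
- by move=> s s0; apply: dJ; lra.
- move=> s s0; apply: (@der_near _ Q).
    near=> z; rewrite max_l// ltW//; near: z; exact: lt_nbhsr.
  have := dQ s; rewrite /p leNgt s0 /=; apply; lra.
Unshelve. all: by end_near. Qed.

(** Picard iteration from 0. The limit is not differentiated directly: the potential of its own
    source is compared with the iterates by [potential_contract], hence coincides with the limit,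
    which thereby inherits the differential relations. *)
Lemma radial_ivp (K : R -> R) : (forall x y, `|K x - K y| <= L * `|x - y|) ->
  (forall x, 0 <= K x <= 1) ->
  exists J P, radial_potential (fun s => K (P s)) J P.
Proof.
move=> KL K01.
have Kc : continuous K.
  move=> x; apply/cvgrPdist_lt => e e0; near=> z.
  apply: le_lt_trans (KL x z) _; rewrite mulrC -ltr_pdivlMr//.
  by near: z; apply: cvgr_dist_lt; [exact: cvg_id|rewrite divr_gt0].
(* Each iterate carries its continuity, which [potential_exists] needs for the next step. *)
have step (Q : {Q : (R -> R) * (R -> R) | continuous Q.2}) :
    {Q' : {Q : (R -> R) * (R -> R) | continuous Q.2} |
      radial_potential (fun s => K ((sval Q).2 s)) (sval Q').1 (sval Q').2}.
  apply: cid; case: Q => -[J P] /= Pc.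
  have [||JP hJP] := @potential_exists (fun s => K (P s)).
  - by move=> s; apply: (@continuous_comp _ _ _ P K); [exact: Pc|exact: Kc].
  - by move=> s; exact: K01.
  - have JPc : continuous JP.2 by case: hJP.
    by exists (exist _ JP JPc).
have c0 : continuous ((fun=> 0, fun=> 0) : (R -> R) * (R -> R)).2.
  by move=> s; exact: cvg_cst.
pose Q m := iter m (fun Q => sval (step Q)) (exist _ _ c0).
pose P m := (sval (Q m)).2.
have hP m : exists J, radial_potential (fun s => K (P m s)) J (P m.+1).
  by exists (sval (Q m.+1)).1; exact: (svalP (step (Q m))).
(* With L M = 1, the bound 0 <= K <= 1 is the hypothesis of [potential_contract] for the first
   step. *)
pose M := (L^-1) : R.
have M0 : 0 <= M by rewrite invr_ge0 ltW.
have w1 s : 1 <= weight s.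
  by rewrite -expR0 ler_expR mulr_ge0 ?(ltW L0)// -expr2 sqr_ge0.
have w0 s : 0 <= weight s by exact: expR_ge0.
have dP m s : `|P m.+1 s - P m s| <= M / 2 ^+ m * weight s.
  elim: m s => [|m IH] s.
    have [J hJ] := hP 0%N; rewrite expr0 divr1.
    have := potential_contract M0 hJ radial_potential0 _ s; rewrite /P /=.
    move=> h; apply: le_trans (h _) _.
      move=> z z0; rewrite subr0 divff ?gt_eqF// mul1r.
      by case/andP: (K01 0) => k0 k1; rewrite ger0_norm//; exact: le_trans (w1 z).
    by rewrite ler_wpM2r//; lra.
  have [J hJ] := hP m; have [J' hJ'] := hP m.+1.
  have M2 : 0 <= M / 2 ^+ m by rewrite divr_ge0// exprn_ge0.
  have -> : M / 2 ^+ m.+1 = M / 2 ^+ m / 2.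
    by rewrite exprS; field; rewrite expf_neq0//; lra.
  apply: (potential_contract M2 hJ' hJ) => z z0.
  by apply: le_trans (KL _ _) _; rewrite -mulrA ler_wpM2l ?IH// ltW.
have tail m j s : `|P (m + j)%N s - P m s| <= 2 * (M / 2 ^+ m) * weight s * (1 - 2^-1 ^+ j).
  elim: j => [|j IH]; first by rewrite addn0 subrr normr0 expr0 subrr mulr0.
  have := dP (m + j)%N s; rewrite addnS => h.
  have -> : P (m + j).+1 s - P m s = (P (m + j).+1 s - P (m + j)%N s) + (P (m + j)%N s - P m s) by ring.
  apply: le_trans (ler_normD _ _) _; apply: le_trans (lerD h IH) _.
  rewrite le_eqVlt; apply/orP; left; apply/eqP.
  rewrite exprD exprS !exprVn; field.
  by rewrite !expf_neq0//; lra.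
have tail' m j s : `|P (m + j)%N s - P m s| <= 2 * (M / 2 ^+ m) * weight s.
  apply: le_trans (tail m j s) _; rewrite ler_piMr ?gerBl ?exprn_ge0 ?invr_ge0//.
  by rewrite !mulr_ge0// invr_ge0 exprn_ge0.
have cvgP s : cvgn (fun m => P m s).
  have cs : cvgn (series (telescope (fun m => P m s))).
    apply: normed_cvg; apply: (@series_le_cvg _ _ (geometric (M * weight s) 2^-1)) => //=.
    - by move=> m; rewrite mulr_ge0 ?exprn_ge0 ?invr_ge0// mulr_ge0.
    - by move=> m; apply: le_trans (dP m s) _; rewrite exprVn mulrAC.
    - apply: is_cvg_geometric_series; rewrite ger0_norm ?invr_ge0//; lra.
  have key (u T : nat -> R) : (forall m, u m = u 0%N + T m) -> cvgn T -> cvgn u.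
    move=> uT cT; apply/cvg_ex; exists (u 0%N + limn T).
    have h : (u 0%N + T m) @[m --> \oo] --> u 0%N + limn T.
      by apply: cvgD; [exact: cvg_cst|exact: cT].
    by apply: cvg_trans h; apply: near_eq_cvg; apply: nearW => m; rewrite -uT.
  by apply: key cs => m; exact: eq_sum_telescope.
pose Pi (s : R) : R := limn (fun m => P m s).
have tailPi m s : `|Pi s - P m s| <= 2 * (M / 2 ^+ m) * weight s.
  have c : `|P j s - P m s| @[j --> \oo] --> `|Pi s - P m s|.
    by apply: cvg_norm; apply: cvgB; [exact: cvgP|exact: cvg_cst].
  rewrite -(cvg_lim _ c)//; apply: limr_le; first by apply/cvg_ex; exists `|Pi s - P m s|.
  near=> j; have mj : (m <= j)%N by near: j; exists m.
  by rewrite -(subnKC mj); exact: tail'.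
have geo0 (c : R) : c / 2 ^+ m @[m --> \oo] --> (0 : R).
  have := @cvg_geometric R c 2^-1; rewrite ger0_norm ?invr_ge0//.
  have h : 2^-1 < 1 :> R by lra.
  move=> /(_ h); apply: cvg_trans; apply: near_eq_cvg; near=> m.
  by rewrite /= exprVn.
have Pc m : continuous (P m) by exact: (svalP (Q m)).
have Pic : continuous Pi.
  move=> s; apply/cvgrPdist_lt => e e0.
  (* The convergence is uniform on |z| <= |s| + 1, where the weight is bounded; this gives
     continuity of the limit at s. *)
  pose C := 2 * M * weight (`|s| + 1).
  have e3 : 0 < e / 3 by lra.
  have [m hm] : exists m, C / 2 ^+ m < e / 3.
    have /cvgrPdist_lt /(_ _ e3) [m _ /(_ m)] := geo0 C.
    rewrite /= leqnn sub0r normrN => /(_ isT) h; exists m.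
    exact: le_lt_trans (ler_norm _) h.
  have hC z : `|z| <= `|s| + 1 -> `|Pi z - P m z| < e / 3.
    move=> zs; apply: le_lt_trans (tailPi m z) _; apply: le_lt_trans hm.
    rewrite /C mulrA -[leLHS]mulrA -[leRHS]mulrA [X in _ <= _ * X]mulrC -!mulrA.
    rewrite ler_pM2l// ler_wpM2l// ler_pM2l ?invr_gt0 ?exprn_gt0//.
    rewrite ler_expR ler_pM2l// -!expr2 -(real_normK (num_real z)).
    by rewrite lerXn2r ?nnegrE ?addr_ge0.
  near=> z.
  have h1 : `|P m s - P m z| < e / 3.
    by near: z; have /cvgrPdist_lt := Pc m s; apply.
  have h2 : `|z| <= `|s| + 1.
    have : `|s - z| < 1 by near: z; apply: cvgr_dist_lt; [exact: cvg_id|].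
    have -> : z = s - (s - z) by ring.
    by move=> /ltW ?; apply: le_trans (ler_normB _ _) _; rewrite lerD2l.
  have h3 := hC _ h2.
  have h4 := hC s; have := h4 _; rewrite lerDl => /(_ ler01) {}h4.
  have -> : Pi s - Pi z = (Pi s - P m s) + (P m s - P m z) + - (Pi z - P m z) by ring.
  apply: le_lt_trans (ler_normD _ _) _; rewrite normrN.
  by have := ler_normD (Pi s - P m s) (P m s - P m z); lra.
have [|JQ hQ] := @potential_exists (fun s => K (Pi s)) _ (fun s => K01 _).
  by move=> s; apply: (@continuous_comp _ _ _ Pi K); [exact: Pic|exact: Kc].
suff E : JQ.2 = Pi by exists JQ.1, JQ.2; rewrite {1}E.
apply/funext => s; apply/eqP; rewrite -subr_eq0 -normr_le0.
have bound m : `|JQ.2 s - Pi s| <= (2 * M * weight s) / 2 ^+ m.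
  have [J hJ] := hP m.
  have M2 : 0 <= 2 * (M / 2 ^+ m) by rewrite mulr_ge0// divr_ge0// exprn_ge0.
  have b1 : `|JQ.2 s - P m.+1 s| <= 2 * (M / 2 ^+ m) / 2 * weight s.
    apply: (potential_contract M2 hQ hJ) => z z0.
    by apply: le_trans (KL _ _) _; rewrite -mulrA ler_wpM2l ?tailPi// ltW.
  have b2 := tailPi m.+1 s.
  have -> : JQ.2 s - Pi s = (JQ.2 s - P m.+1 s) - (Pi s - P m.+1 s) by ring.
  apply: le_trans (ler_normB _ _) _; apply: le_trans (lerD b1 b2) _.
  rewrite le_eqVlt; apply/orP; left; apply/eqP; rewrite exprS; field.
  by rewrite expf_neq0//; lra.
rewrite leNgt; apply/negP => pos.
have /cvgrPdist_lt /(_ _ pos) [m _ /(_ m)] := geo0 (2 * M * weight s).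
rewrite /= leqnn sub0r normrN => /(_ isT) h.
have := le_lt_trans (ler_norm _) h; rewrite ltNge; move/negP; apply; exact: bound.
Unshelve. all: by end_near. Qed.

End Picard.

(** * Orbits in the Emden-Fowler plane *)

Section Plane.
Context {R : realType}.
Variables (n : nat) (delta : R) (Y V : R -> R).
Let lstar : R := n.+1%:R - delta.
Let c : R := n.+2%:R - 2 * delta.
Let Yd t := V t - n%:R * Y t + (delta - 1) * Y t ^+ 2.
Hypothesis delta0 : 0 < delta.
Hypothesis dY : forall t, 0 <= t -> der Y t (Yd t).
Hypothesis dV : forall t, 0 <= t -> der V t (2 * V t * (1 - Y t)).
Hypothesis Y01 : forall t, 0 <= t -> 0 < Y t < 1.
Hypothesis V0 : forall t, 0 <= t -> 0 < V t.

Let line (f df : R -> R) (k t x : R) : 0 <= t -> 0 <= x ->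
  (forall s, t <= s -> der f s (df s)) ->
  (forall s, t <= s <= t + x -> k <= df s) -> f t + k * x <= f (t + x).
Proof.
move=> t0 x0 fd fk.
have : (fun s => f s - k * s) t <= (fun s => f s - k * s) (t + x).
  apply: (@der_le _ (fun s => f s - k * s) (fun s => df s - k)).
  - by rewrite lerDl.
  - move=> s /andP[ts _]; have h := fd _ ts.
    by der_calc; rewrite mul0r add0r mulr1.
  - by move=> s /andP[ts sx]; rewrite subr_ge0 fk// !ltW.
rewrite /=; lra.
Qed.

Let V_lt t s : 0 <= t -> t < s -> V t < V s.
Proof.
move=> t0 ts; apply: (@der_lt _ V (fun t => 2 * V t * (1 - Y t))); first exact: ts.
- by move=> x /andP[tx _]; apply: dV; exact: le_trans tx.
- move=> x /andP[tx _]; have x0 : 0 <= x by exact: le_trans (ltW tx).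
  have /andP[_ y1] := Y01 x0; have v0 := V0 x0.
  by rewrite !mulr_gt0// subr_gt0.
Qed.

Let V_le t s : 0 <= t -> t <= s -> V t <= V s.
Proof. by move=> t0; rewrite le_eqVlt => /predU1P[->//|/(V_lt t0)/ltW]. Qed.

Let C0 : R := n%:R + delta + 1.

Let n0 : 0 <= n%:R :> R. Proof. exact: ler0n. Qed.

Let Yd_bound t : 0 <= t -> `|Yd t - V t| <= C0.
Proof.
move=> t0; have /andP[y0 y1] := Y01 t0; have d0 := delta0; have h := n0.
have hn : 0 <= n%:R * Y t <= n%:R by rewrite mulr_ge0 ?(ltW y0)//= ler_piMr ?(ltW y1).
have y2 : 0 <= Y t ^+ 2 <= 1 by rewrite exprn_ge0 ?(ltW y0)//= exprn_ile1 ?(ltW y0) ?(ltW y1).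
have dy : 0 <= delta * Y t ^+ 2 <= delta.
  by case/andP: y2 => ? ?; rewrite mulr_ge0 ?(ltW d0)//= ler_piMr ?(ltW d0).
rewrite /Yd /C0 ler_norml; move: hn y2 dy; rewrite mulrBl mul1r.
move: (n%:R * _) (_ ^+ 2) (delta * _) => a b e /andP[? ?] /andP[? ?] /andP[? ?].
apply/andP; split; lra.
Qed.

(** V increases, so once above C0 + 1 it stays there and keeps Y' >= 1; a unit of time then carries
    Y out of (0, 1). *)
Let V_bound t : 0 <= t -> V t <= C0 + 1.
Proof.
move=> t0; rewrite leNgt; apply/negP => Vt.
have h : Y t + 1 * 1 <= Y (t + 1).
  apply: (@line Y Yd) => // [s ts|s /andP[ts _]]; first by apply: dY; exact: le_trans ts.
  have s0 := le_trans t0 ts; have := V_le t0 ts; have := Yd_bound s0.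
  by rewrite ler_norml => /andP[? ?] ?; lra.
have /andP[? _] := Y01 t0; have t1 : 0 <= t + 1 by lra.
by have /andP[_ ?] := Y01 t1; lra.
Qed.

Let M : R := 2 * C0 + 1.

Let M0 : 0 < M.
Proof. by have d0 := delta0; have h := n0; rewrite /M /C0; lra. Qed.

Let Yd_M t : 0 <= t -> - M <= Yd t <= M.
Proof.
move=> t0; have := Yd_bound t0; have := V_bound t0; have := V0 t0.
by rewrite ler_norml /M => ? ? /andP[? ?]; apply/andP; split; lra.
Qed.

Let VS := [set V t | t in [set t | 0 <= t]].
Let L := sup VS.

Let VS_sup : has_sup VS.
Proof.
split; first by exists (V 0), 0 => /=.
by exists (C0 + 1) => _ [t /= t0 <-]; exact: V_bound.
Qed.

Let V_leL t : 0 <= t -> V t <= L.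
Proof. by move=> t0; apply: (sup_upper_bound VS_sup); exists t. Qed.

Let V_near e : 0 < e -> exists T, 0 <= T /\ L - e < V T.
Proof.
by move=> e0; have [_ [T /= T0 <-] h] := sup_adherent e0 VS_sup; exists T.
Qed.

(** If 1 - Y >= e at a late time, the bound M on |Y'| keeps 1 - Y >= e/2 for a duration h = e / (2
    M). Meanwhile V gains at least V(0) e h, more than remains below its supremum. *)
Let Y_near1 e : 0 < e -> exists T, 0 <= T /\ forall t, T <= t -> 1 - Y t < e.
Proof.
move=> e0; pose h := e / (2 * M).
have h0 : 0 < h by rewrite divr_gt0// mulr_gt0.
have V00 : 0 < V 0 by exact: V0.
have [T [T0 hT]] := V_near (mulr_gt0 (mulr_gt0 V00 e0) h0).
exists T; split=> // t Tt; rewrite ltNge; apply/negP => et.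
have t0 := le_trans T0 Tt.
have : V t + V 0 * e * h <= V (t + h).
  apply: (@line V (fun t => 2 * V t * (1 - Y t))) => //; first exact: ltW.
    by move=> s ts; apply: dV; exact: le_trans ts.
  move=> s /andP[ts sth]; have s0 := le_trans t0 ts.
  have Ys : - Y t + - M * (s - t) <= - Y (t + (s - t)).
    apply: (@line (fun t => - Y t) (fun t => - Yd t)) => //; first by rewrite subr_ge0.
      by move=> x tx; apply: derN; apply: dY; exact: le_trans tx.
    move=> x /andP[tx _]; rewrite lerN2.
    by have /andP[] := Yd_M (le_trans t0 tx).
  have sE : t + (s - t) = s by ring.
  rewrite sE in Ys.
  have : M * (s - t) <= e / 2.
    have -> : e / 2 = M * h by rewrite /h; field; rewrite gt_eqF.
    by rewrite ler_pM2l//; lra.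
  move=> b1; have b2 : e / 2 <= 1 - Y s.
    by move: Ys b1; rewrite mulNr; move: (M * (s - t)) => z; lra.
  have b3 : V 0 <= V s by exact: V_le.
  have -> : V 0 * e = 2 * V 0 * (e / 2) by field.
  by apply: ler_pM => //; [rewrite mulr_ge0// ltW|rewrite divr_ge0// ltW|rewrite ler_pM2l].
have := V_le T0 Tt; have := V_leL (addr_ge0 t0 (ltW h0)).
lra.
Qed.

(** Expansion about the rest point (1, lstar). *)
Let YdE t : Yd t = (V t - lstar) + c * (1 - Y t) + (delta - 1) * (1 - Y t) ^+ 2.
Proof. by rewrite /Yd /lstar /c -(natr1 n.+1) -(natr1 n); ring. Qed.

Let rest_small d : 0 < d -> exists T, 0 <= T /\ forall t, T <= t ->
  `|c * (1 - Y t) + (delta - 1) * (1 - Y t) ^+ 2| <= d.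
Proof.
move=> d0; pose k := `|c| + `|delta - 1| + 1.
have k0 : 0 < k by rewrite ltr_wpDl// addr_ge0.
have [T [T0 hT]] := Y_near1 (divr_gt0 d0 k0).
exists T; split=> // t Tt; have t0 := le_trans T0 Tt.
have /andP[y0 y1] := Y01 t0; have := hT _ Tt.
set u := 1 - Y t => uk; have u0 : 0 <= u by rewrite subr_ge0 ltW.
have u2 : u ^+ 2 <= u by rewrite expr2 ler_piMr// /u; lra.
apply: le_trans (ler_normD _ _) _; rewrite (normrM c) (normrM (delta - 1)).
rewrite (ger0_norm u0) (ger0_norm (exprn_ge0 2 u0)).
apply: (@le_trans _ _ (k * u)).
  have : `|delta - 1| * u ^+ 2 <= `|delta - 1| * u by rewrite ler_wpM2l.
  by move=> h; rewrite /k !mulrDl mul1r -addrA lerD2l; apply: le_trans h _; rewrite lerDl.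
by rewrite mulrC -ler_pdivlMr// ltW.
Qed.

(** As Y tends to 1 and V to L, Y' tends to L - lstar; a nonzero limit would push Y out of (0,
    1). *)
Let L_eq : L = lstar.
Proof.
apply/eqP; rewrite eq_le; apply/andP; split; rewrite leNgt; apply/negP => lt.
- pose d := (L - lstar) / 4; have d0 : 0 < d by rewrite divr_gt0// subr_gt0.
  have [T [T0 hT]] := rest_small d0; have [T' [T'0 hT']] := V_near d0.
  pose t := Num.max T T'; have tT : T <= t by rewrite le_max lexx.
  have tT' : T' <= t by rewrite le_max lexx orbT.
  have t0 := le_trans T0 tT; have d1 : 0 <= d^-1 by rewrite invr_ge0 ltW.
  have : Y t + d * d^-1 <= Y (t + d^-1).
    apply: (@line Y Yd) => // [s ts|s /andP[ts _]].
      by apply: dY; exact: le_trans ts.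
    have := hT _ (le_trans tT ts); rewrite ler_norml YdE => /andP[+ _].
    have := V_le T'0 (le_trans tT' ts); move: hT'; rewrite /d.
    by move: (c * _) (_ * _ ^+ 2) => a b; lra.
  rewrite divff ?gt_eqF// => h; have /andP[? _] := Y01 t0.
  by have /andP[_ ?] := Y01 (addr_ge0 t0 d1); lra.
- pose d := (lstar - L) / 2; have d0 : 0 < d by rewrite divr_gt0// subr_gt0.
  have [T [T0 hT]] := rest_small d0; have d1 : 0 <= d^-1 by rewrite invr_ge0 ltW.
  have : - Y T + d * d^-1 <= - Y (T + d^-1).
    apply: (@line (fun t => - Y t) (fun t => - Yd t)) => // [s ts|s /andP[ts _]].
      by apply: derN; apply: dY; exact: le_trans ts.
    have := hT _ ts; rewrite ler_norml YdE => /andP[_ +].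
    have := V_leL (le_trans T0 ts); rewrite /d.
    by move: (c * _) (_ * _ ^+ 2) => a b; lra.
  rewrite divff ?gt_eqF// => h; have /andP[_ ?] := Y01 T0.
  by have /andP[? _] := Y01 (addr_ge0 T0 d1); lra.
Qed.

Lemma trapped_sup e : 0 < e -> exists t, 0 <= t /\ lstar - e < V t.
Proof. by move=> /V_near; rewrite L_eq. Qed.

(* When (1, lstar) is a focus, or repelling, an orbit cannot stay in y < 1: the
   slope x = (v - lstar) / (y - 1) > 0 would satisfy x' <= -kappa < 0. *)
Lemma trapped_node : (c <= 0) \/ (c ^+ 2 < 8 * lstar) -> False.
Proof.
move=> disc.
have V_ltl t : 0 <= t -> V t < lstar.
  move=> t0; rewrite -L_eq; apply: lt_le_trans (V_leL (addr_ge0 t0 ler01)).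
  by apply: V_lt => //; rewrite ltrDl.
have ls0 : 0 < lstar by apply: lt_trans (V_ltl 0 (lexx 0)); exact: V0.
(* With the positive part of c, both alternatives of the hypothesis become 8 lstar > cp^2. *)
pose cp := Num.max c 0.
have cp0 : 0 <= cp by rewrite le_max lexx orbT.
have ccp : c <= cp by rewrite le_max lexx.
have d0 : 0 < 8 * lstar - cp ^+ 2.
  rewrite subr_gt0 /cp; case: (leP c 0) => c0; first by rewrite expr0n /= mulr_gt0.
  by case: disc => // h; rewrite ltNge h in c0.
pose d := 8 * lstar - cp ^+ 2.
pose e := Num.min 1 (d / (2 * (2 * cp + 1))).
have k0 : 0 < 2 * (2 * cp + 1) by lra.
have e0 : 0 < e by rewrite lt_min ltr01 divr_gt0.
have e1 : e <= 1 by rewrite ge_min lexx.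
have ed : e * (2 * cp + 1) <= d / 2.
  have : e <= d / (2 * (2 * cp + 1)) by rewrite ge_min lexx orbT.
  rewrite ler_pdivlMr//; lra.
have e2 : (cp + e) ^+ 2 <= 8 * lstar - d / 2.
  have -> : 8 * lstar = d + cp ^+ 2 by rewrite /d; ring.
  have : e * e <= e by rewrite ler_piMr// ltW.
  have -> : (cp + e) ^+ 2 = cp ^+ 2 + 2 * cp * e + e * e by ring.
  nra.
have d1 : 0 < delta + 1 by have h := delta0; lra.
have [T [T0 hT]] := Y_near1 (divr_gt0 e0 d1).
(* e is small enough that (cp + e)^2 <= 8 lstar - d/2; hence x^2 - (cp + e) x + 2 lstar is at least
   2 lstar - (cp + e)^2 / 4 >= d/8. *)
pose kap := d / 8.
have kap0 : 0 < kap by rewrite divr_gt0.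
pose x t := (V t - lstar) / (Y t - 1).
pose xd t := - 2 * lstar - x t ^+ 2 + c * x t + (delta + 1) * (1 - Y t) * x t.
have x_gt0 t : 0 <= t -> 0 < x t.
  move=> t0; have /andP[_ y1] := Y01 t0.
  by rewrite /x -mulrNN -invrN divr_gt0// oppr_gt0 subr_lt0// V_ltl.
have dx t : 0 <= t -> der x t (xd t).
  move=> t0; have h1 := dY t0; have h2 := dV t0.
  have /andP[_ y1] := Y01 t0; have yn : Y t - 1 != 0 by rewrite subr_eq0 lt_eqF.
  have hV : der (fun t => V t - lstar) t (2 * V t * (1 - Y t)) by der_calc; rewrite addr0.
  have hY : der (fun t => Y t - 1) t (Yd t) by der_calc; rewrite addr0.
  apply: der_eq; first by apply: (@derM _ _ (fun t => (Y t - 1)^-1)); [exact: hV|apply: derV; [exact: yn|exact: hY]].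
  by rewrite /xd YdE /x; move: (V t) (Y t) yn => v y yn; field.
have xd_le t : T <= t -> xd t <= - kap.
  move=> Tt; have t0 := le_trans T0 Tt; have x0 := x_gt0 _ t0.
  have ue : (delta + 1) * (1 - Y t) <= e.
    by rewrite mulrC -ler_pdivlMr// ltW// hT.
  have h1 : (delta + 1) * (1 - Y t) * x t <= e * x t by rewrite ler_pM2r.
  have h2 : c * x t <= cp * x t by rewrite ler_pM2r.
  have h3 : 0 <= (x t - (cp + e) / 2) ^+ 2 by exact: sqr_ge0.
  have h4 : (x t - (cp + e) / 2) ^+ 2 = x t ^+ 2 - (cp + e) * x t + (cp + e) ^+ 2 / 4 by field.
  have h5 : (cp + e) * x t = cp * x t + e * x t by rewrite mulrDl.
  rewrite h4 h5 in h3; rewrite /xd /kap; lra.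
have xT := x_gt0 _ T0.
have z0 : 0 <= x T / kap by rewrite divr_ge0 ?ltW.
have : - x T + kap * (x T / kap) <= - x (T + x T / kap).
  apply: (@line (fun t => - x t) (fun t => - xd t)) => // [s ts|s /andP[ts _]].
    by apply: derN; apply: dx; exact: le_trans ts.
  by rewrite lerNr xd_le.
rewrite mulrCA divff ?gt_eqF// mulr1 addNr oppr_ge0 leNgt x_gt0//.
exact: addr_ge0.
Qed.

End Plane.

Section FirstTime.
Context {R : realType}.

(** The infimum of the set where f >= k: continuity puts it in the set, and f < k to its left
    excludes f s > k. *)
Lemma first_time (f : R -> R) (a b k : R) : a < b ->
  (forall x, a <= x <= b -> {for x, continuous f}) -> f a < k -> k <= f b ->
  exists s, [/\ a < s <= b, f s = k & forall x, a <= x < s -> f x < k].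
Proof.
move=> ab fc fa fb; pose A := [set x | a <= x <= b /\ k <= f x].
have hA : has_inf A.
  split; first by exists b; split; rewrite ?lexx ?(ltW ab).
  by exists a => x [/andP[]].
pose s := inf A.
have as_ : a <= s by apply: lb_le_inf; [exact: hA.1|move=> x [/andP[]]].
have sb : s <= b by apply: ge_inf; [exact: hA.2|split; rewrite ?lexx ?(ltW ab)].
have below x : a <= x < s -> f x < k.
  move=> /andP[ax xs]; rewrite ltNge; apply/negP => kx.
  have : s <= x by apply: ge_inf; [exact: hA.2|split=> //; rewrite ax (le_trans (ltW xs))].
  by rewrite leNgt xs.
have sab : a <= s <= b by rewrite as_.
have fs := fc _ sab.
have ks : k <= f s.
  rewrite leNgt; apply/negP => sk.
  have : \forall x \near s, f x < k by have h : f x @[x --> s] --> f s := fs; apply: (cvgr_lt (f s) h).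
  move=> /nbhs_ballP[r /= r0 hr].
  have [x [xab kx] xs] := inf_adherent r0 hA.
  have sx : s <= x by apply: ge_inf; [exact: hA.2|].
  have := hr x; rewrite /ball /= distrC ger0_norm ?subr_ge0//.
  move=> h; have : f x < k by apply: h; rewrite -/s in xs; move: xs; rewrite addrC -ltrBlDr.
  by rewrite ltNge kx.
have asx : a < s by rewrite lt_neqAle as_ andbT; apply/eqP => E; move: ks; rewrite -E leNgt fa.
exists s; rewrite asx sb; split=> //; apply/eqP; rewrite eq_le ks andbT leNgt.
apply/negP => ks'.
have : \forall x \near s, k < f x by have h : f x @[x --> s] --> f s := fs; apply: (cvgr_gt (f s) h).
move=> /nbhs_ballP[r /= r0 hr].
pose x := Num.max a (s - r / 2).
have xs : x < s by rewrite gt_max asx; lra.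
have ax : a <= x by rewrite le_max lexx.
have := hr x; rewrite /ball /= gtr0_norm ?subr_gt0//.
have : s - r / 2 <= x by rewrite le_max lexx orbT.
move=> h1 h2; have : k < f x by apply: h2; lra.
by rewrite ltNge ltW// below// ax.
Qed.

End FirstTime.

(** * Solutions of the radial equation *)

Section RadialODE.
Context {R : realType}.
Variables (n : nat) (delta : R).
Implicit Types (w z : R -> R) (r s lam : R).

(** Replaces the passage to the limit s -> 0 in integrations that start at the origin, where the
    equation need not hold. *)
Lemma ge0_of_small r0 c (x : R) : 0 < r0 -> 0 <= c ->
  (forall s, 0 < s < r0 -> - (c * s) <= x) -> 0 <= x.
Proof.
move=> r00 c0 h; rewrite leNgt; apply/negP => x0.
pose s := Num.min (r0 / 2) (- x / (2 * (c + 1))).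
have c1 : 0 < 2 * (c + 1) by lra.
have s0 : 0 < s by rewrite lt_min; apply/andP; split; rewrite divr_gt0//; lra.
have sr : s <= r0 / 2 by rewrite ge_min lexx.
have sx : s <= - x / (2 * (c + 1)) by rewrite ge_min lexx orbT.
have h1 : - (c * s) <= x by apply: h; lra.
have : s * (2 * (c + 1)) <= - x by rewrite -ler_pdivlMr.
have : 0 <= c * s by rewrite mulr_ge0// ltW.
lra.
Qed.

(* Below, [w1] and [w2] stand for w' and w''; with N = n + 2 this is the radial
   form of  Delta w = (lam + delta |grad w|^2) / w,  where w = 1 - U. *)
Definition radial_ode lam w (w1 w2 : R -> R) := forall r, 0 < r < 1 ->
  [/\ 0 < w r < 1, der w r (w1 r), der w1 r (w2 r) &
      w2 r + n.+1%:R / r * w1 r = (lam + delta * w1 r ^+ 2) / w r].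

Section OneSolution.
Variables (lam : R) (w w1 w2 : R -> R).
Hypothesis delta0 : 0 < delta.
Hypothesis lam0 : 0 < lam.
Hypothesis ode : radial_ode lam w w1 w2.

Let flux r := r ^+ n.+1 * w1 r.

Let der_flux r : 0 < r < 1 ->
  der flux r (r ^+ n.+1 * ((lam + delta * w1 r ^+ 2) / w r)).
Proof.
move=> r01; have [w01 h1 h2 E] := ode r01; rewrite /flux -E.
have rn : r != 0 by case/andP: r01 => /gt_eqF ->.
by der_calc; rewrite /= exprS; field.
Qed.

Let rhs_gt0 r : 0 < r < 1 -> lam / w r <= (lam + delta * w1 r ^+ 2) / w r.
Proof.
move=> r01; have [/andP[w0 _] _ _ _] := ode r01.
by rewrite ler_pM2r ?invr_gt0// lerDl mulr_ge0 ?sqr_ge0// ltW.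
Qed.

Let lam_w r : 0 < r < 1 -> 0 < lam / w r.
Proof. by move=> r01; have [/andP[w0 _] _ _ _] := ode r01; rewrite divr_gt0. Qed.

Let flux_le r s : 0 < r -> r <= s -> s < 1 -> flux r <= flux s.
Proof.
move=> r0 rs s1.
have sub x := @itv_sub01 R r s x r0 s1.
apply: (@der_le _ flux (fun r => r ^+ n.+1 * ((lam + delta * w1 r ^+ 2) / w r))).
- exact: rs.
- by move=> x /sub; exact: der_flux.
- move=> x /andP[rx xs]; have x01 : 0 < x < 1 by apply: sub; rewrite !ltW.
  rewrite mulr_ge0 ?exprn_ge0//; first by case/andP: x01 => /ltW.
  exact: le_trans (ltW (lam_w x01)) (rhs_gt0 x01).
Qed.

(* A negative flux at some radius would persist towards the origin and force
   [w] to grow like [- ln r] there, since N >= 2, contradicting [w < 1]. *)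
Lemma ode_deriv_ge0 r : 0 < r < 1 -> 0 <= w1 r.
Proof.
move=> /[dup] r01 /andP[r0 r1]; rewrite leNgt; apply/negP => w1r.
pose b := - flux r.
have b0 : 0 < b by rewrite oppr_gt0 /flux pmulr_rlt0// exprn_gt0.
(* Chosen so that b (ln r - ln s) = 1, more than w can vary inside (0, 1). *)
pose s := r * expR (- b^-1).
have s0 : 0 < s by rewrite mulr_gt0 ?expR_gt0.
have sr : s < r by rewrite gtr_pMr// expR_lt1 oppr_lt0 invr_gt0.
have sub x := @itv_sub01 R s r x s0 r1.
have : (fun x => w x + b * ln x) r <= (fun x => w x + b * ln x) s.
  apply: (@der_ge _ (fun x => w x + b * ln x) (fun x => w1 x + b / x)); first exact: ltW.
  - move=> x /sub x01; have [_ h _ _] := ode x01; have x0 : 0 < x by case/andP: x01.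
    by der_calc; rewrite mul0r add0r mul1r.
  - move=> x /andP[sx xr]; have x01 : 0 < x < 1 by apply: sub; rewrite !ltW.
    have /andP[x0 x1] := x01.
    have xp : 0 < x ^+ n.+1 by rewrite exprn_gt0.
    have := flux_le x0 (ltW xr) r1; rewrite -[flux r]opprK -/b /flux => h.
    have h1 : w1 x <= - b / x ^+ n.+1 by rewrite ler_pdivlMr// mulrC.
    have : b / x <= b / x ^+ n.+1.
      rewrite ler_pM2l// lef_pV2 ?posrE// exprS ler_piMr ?(ltW x0)//.
      by rewrite exprn_ile1 ?ltW.
    by rewrite mulNr in h1; lra.
rewrite /= /s lnM ?posrE ?expR_gt0// expRK mulrDr mulrN divff ?gt_eqF//.
have s01 : 0 < s < 1 by rewrite s0 (lt_trans sr).
have [/andP[? ?] _ _ _] := ode r01; have [/andP[_ ?] _ _ _] := ode s01.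
by rewrite -/s; lra.
Qed.

Lemma ode_nondecreasing r s : 0 < r -> r <= s -> s < 1 -> w r <= w s.
Proof.
move=> r0 rs s1.
have sub x := @itv_sub01 R r s x r0 s1.
apply: (@der_le _ w w1) => [//||].
- by move=> x /sub /ode[].
- by move=> x /andP[rx xs]; apply: ode_deriv_ge0; apply: sub; rewrite !ltW.
Qed.

Let N : R := n.+2%:R.
Let N0 : 0 < N. Proof. by rewrite /N ltr0n. Qed.

(** Integrates (x^(n+1) w')' >= lam x^(n+1) / w(r), valid for x <= r because w is nondecreasing; the
    flux at the lower end is nonnegative. *)
Lemma ode_deriv_lower r : 0 < r < 1 -> lam * r / (N * w r) <= w1 r.
Proof.
move=> /[dup] r01 /andP[r0 r1]; have [/andP[wr0 _] _ _ _] := ode r01.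
have key : 0 <= flux r - lam * r ^+ n.+2 / (N * w r).
  apply: (@ge0_of_small r (lam / (N * w r))) => //.
    by rewrite divr_ge0 ?mulr_ge0 ?ltW.
  move=> s /andP[s0 sr].
  have sub x := @itv_sub01 R s r x s0 r1.
  have s1 := lt_trans sr r1.
  apply: (@le_trans _ _ (flux s - lam * s ^+ n.+2 / (N * w r))).
    have : 0 <= flux s by rewrite /flux mulr_ge0 ?exprn_ge0 ?ode_deriv_ge0 ?s0// ltW.
    have : lam / (N * w r) * s ^+ n.+2 <= lam / (N * w r) * s.
      have c0 : 0 <= lam / (N * w r) by rewrite divr_ge0 ?mulr_ge0 ?ltW.
      apply: (ler_wpM2l c0); rewrite exprS ler_piMr ?(ltW s0)//.
      by rewrite exprn_ile1 ?(ltW s0) ?(ltW s1).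
    by rewrite (mulrAC lam (s ^+ n.+2)) => h1 h2; rewrite -[leLHS]add0r lerB.
  apply: (@der_le _ (fun x => flux x - lam * x ^+ n.+2 / (N * w r))
     (fun x => x ^+ n.+1 * ((lam + delta * w1 x ^+ 2) / w x)
               - x ^+ n.+1 * (lam / w r))); first exact: ltW.
  - move=> x /sub x01; have h := der_flux x01.
    have wn : w r != 0 by rewrite gt_eqF.
    have Nn : N != 0 by rewrite gt_eqF.
    have wx : w x != 0 by have [/andP[h0 _] _ _ _] := ode x01; rewrite gt_eqF.
    by der_calc; rewrite /= -/N; move: (N) Nn => M Mn; field; rewrite wn wx.
  - move=> x /andP[sx xr]; have x01 : 0 < x < 1 by apply: sub; rewrite !ltW.
    have [/andP[wx0 _] _ _ _] := ode x01.
    have x0 : 0 <= x by case/andP: x01 => /ltW.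
    rewrite -mulrBr mulr_ge0 ?exprn_ge0// subr_ge0.
    apply: le_trans (rhs_gt0 x01); apply: (ler_wpM2l (ltW lam0)).
    rewrite lef_pV2 ?posrE//.
    by apply: ode_nondecreasing => //; [case/andP: x01|exact: ltW].
rewrite -(ler_pM2l (exprn_gt0 n.+1 r0)); move: key; rewrite subr_ge0.
apply: le_trans; rewrite (exprS r n.+1); move: (N * w r)^-1 => c.
by rewrite le_eqVlt; apply/orP; left; apply/eqP; ring.
Qed.

(** Integrates (w^2)' = 2 w w' >= 2 lam r / N. The resulting linear lower bound on w also holds for
    singular solutions. *)
Lemma ode_sqr_lower r : 0 < r < 1 -> lam / N * r ^+ 2 <= w r ^+ 2.
Proof.
move=> /[dup] r01 /andP[r0 r1]; rewrite -subr_ge0.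
have lN : 0 < lam / N by rewrite divr_gt0.
apply: (@ge0_of_small r (lam / N)) => //; first exact: ltW.
move=> s /andP[s0 sr]; have s1 := lt_trans sr r1.
apply: (@le_trans _ _ (w s ^+ 2 - lam / N * s ^+ 2)).
  have : 0 <= w s ^+ 2 by exact: sqr_ge0.
  have : lam / N * s ^+ 2 <= lam / N * s.
    by rewrite ler_pM2l// expr2 ler_piMr ?ltW.
  by move=> h1 h2; rewrite -[leLHS]add0r lerB.
apply: (@der_le _ (fun r => w r ^+ 2 - lam / N * r ^+ 2)
  (fun r => 2 * w r * w1 r - lam / N * (2 * r))); first exact: ltW.
- move=> x /andP[sx xr].
  have x01 : 0 < x < 1 by rewrite (lt_le_trans s0 sx) (le_lt_trans xr r1).
  by have [_ h _ _] := ode x01; der_calc; rewrite /= !expr1; ring.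
- move=> x /andP[sx xr].
  have x01 : 0 < x < 1 by rewrite (lt_trans s0 sx) (lt_trans xr r1).
  have [/andP[w0 _] _ _ _] := ode x01.
  have := ode_deriv_lower x01; rewrite ler_pdivrMr ?mulr_gt0// => h.
  have : lam / N * x <= w1 x * w x.
    by rewrite mulrAC ler_pdivrMr// -mulrA [w x * N]mulrC.
  move: (lam / N) => c; lra.
Qed.

(** This is -r^(n+1) times the derivative of F(w); its derivative, computed next, is the divergence
    form of the equation for phi, with the gradient term gone. *)
Definition flow r := r ^+ n.+1 * pw delta (w r) * w1 r.

Lemma der_flow r : 0 < r < 1 ->
  der flow r (lam * r ^+ n.+1 * pw delta (w r) / w r).
Proof.
move=> r01; have [/andP[w0 _] h1 h2 E] := ode r01.
have h3 : der (fun r => pw delta (w r)) r (- delta * pw delta (w r) / w r * w1 r).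
  by apply: der_comp => //; exact: der_pw.
have rn : r != 0 by case/andP: r01 => /gt_eqF ->.
have wn : w r != 0 by rewrite gt_eqF.
have -> : lam = (w2 r + n.+1%:R / r * w1 r) * w r - delta * w1 r ^+ 2.
  by rewrite E divfK// addrK.
by rewrite /flow; der_calc; rewrite /= exprS; field; rewrite rn wn.
Qed.

Lemma flow_ge0 r : 0 < r < 1 -> 0 <= flow r.
Proof.
move=> r01; have [/andP[w0 _] _ _ _] := ode r01; have /andP[r0 _] := r01.
by rewrite /flow mulr_ge0 ?ode_deriv_ge0// mulr_ge0 ?exprn_ge0 ?ltW ?pw_gt0.
Qed.

End OneSolution.
End RadialODE.

(** * Comparison with a critical orbit *)

Section Green.
Context {R : realType}.
Variables (n : nat) (delta lam lam1 : R).
Variables (w w1 w2 z z1 z2 : R -> R) (a C : R).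
Hypothesis delta0 : 0 < delta.
Hypothesis lam10 : 0 < lam1.
Hypothesis lam1_le : lam1 <= lam.
Hypothesis wode : radial_ode n delta lam w w1 w2.
Hypothesis zode : radial_ode n delta lam1 z z1 z2.
Hypothesis a0 : 0 < a.
Hypothesis za : forall r, 0 < r < 1 -> a <= z r.
Hypothesis zstar : forall r, 0 < r < 1 -> r * z1 r < z r.
Hypothesis C0 : 0 <= C.
Hypothesis z1C : forall r, 0 < r < 1 -> z1 r <= C * r.
Hypothesis near0 : forall e r, 0 < e -> 0 < r < 1 ->
  exists s, [/\ 0 < s < r, s <= e & s ^+ n.+2 * Fw delta (w s) <= e].
Hypothesis near1 : forall e r, 0 < e -> 0 < r < 1 ->
  exists s, [/\ r < s < 1, z s - s * z1 s <= e, 1 - w s <= e & 1 - z s <= e].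

Let p := pw delta.
Let F := Fw delta.
Let lstar : R := n.+1%:R - delta.
Let A := flow n delta w w1.
Let As := flow n delta z z1.
(* [psi] is the derivative of the solution family kappa z(r / kappa) at
   kappa = 1, in the variable [phi]: a positive solution of the linearized
   equation, vanishing at r = 1.  [Psi] is r^(n+1) psi'. *)
Let psi r := p (z r) * (z r - r * z1 r).
Let Psi r := lstar * As r - lam1 * r ^+ n.+2 * p (z r) / z r.
(** Q is the Wronskian r^(n+1) (D' psi - D psi'). X is the source that remains after subtracting the
    linearization at z, so that Q' = -r^(n+1) psi X. *)
Let D r := F (w r) - F (z r).
Let Q r := (As r - A r) * psi r - D r * Psi r.
Let X r := lam * (p (w r) / w r) - lam1 * (p (z r) / z r)
  - lam1 * ((delta + 1) / z r ^+ 2 * D r).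

Let der_psi r : 0 < r < 1 -> der psi r (Psi r / r ^+ n.+1).
Proof.
move=> r01; have [/andP[z0 _] h1 h2 E] := zode r01.
have h3 : der (fun r => p (z r)) r (- delta * p (z r) / z r * z1 r).
  by apply: der_comp => //; exact: der_pw.
have rn : r != 0 by case/andP: r01 => /gt_eqF ->.
have zn : z r != 0 by rewrite gt_eqF.
have E' : lam1 = (z2 r + n.+1%:R / r * z1 r) * z r - delta * z1 r ^+ 2.
  by rewrite E divfK// addrK.
have mn : r ^+ n.+1 != 0 by rewrite expf_neq0.
rewrite /psi; der_calc; rewrite /Psi /As /flow -/p E' /lstar (exprS r n.+1).
by move: (r ^+ n.+1) mn => m mn; field; rewrite rn zn mn.
Qed.

Let der_Psi r : 0 < r < 1 ->
  der Psi r (- (lam1 * (delta + 1) / z r ^+ 2) * r ^+ n.+1 * psi r).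
Proof.
move=> r01; have [/andP[z0 _] h1 _ _] := zode r01.
have h3 : der (fun r => p (z r) / z r) r (- (delta + 1) * p (z r) / z r ^+ 2 * z1 r).
  by apply: (@der_comp _ (fun y => p y / y)) => //; exact: der_pwdiv.
have h4 := der_flow zode r01.
have zn : z r != 0 by rewrite gt_eqF.
apply: der_eq.
  apply: (@derD _ (fun r => lstar * As r) (fun r => - (lam1 * r ^+ n.+2 * p (z r) / z r))).
    by apply: (@derM _ (fun=> lstar) As); [exact: der_cst|exact: h4].
  apply: (@derN _ (fun r => lam1 * r ^+ n.+2 * p (z r) / z r)).
  have -> : (fun r => lam1 * r ^+ n.+2 * p (z r) / z r) =
    (fun r => lam1 * r ^+ n.+2 * (p (z r) / z r)) by apply/funext => x; rewrite mulrA.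
  by apply: (@derM _ (fun r => lam1 * r ^+ n.+2)); [der_auto|exact: h3].
rewrite /psi /lstar -/p /= (exprS r n.+1).
move: (r ^+ n.+1) (p _) => m q.
by rewrite -(natr1 n.+1); field.
Qed.

Let der_D r : 0 < r < 1 -> der D r ((As r - A r) / r ^+ n.+1).
Proof.
move=> r01; have [/andP[z0 _] h1 _ _] := zode r01.
have [/andP[w0 _] h2 _ _] := wode r01.
have mn : r ^+ n.+1 != 0 by case/andP: r01 => r0 _; rewrite expf_neq0// gt_eqF.
have h3 : der (fun r => F (z r)) r (- p (z r) * z1 r).
  by apply: der_comp => //; exact: der_Fw.
have h4 : der (fun r => F (w r)) r (- p (w r) * w1 r).
  by apply: der_comp => //; exact: der_Fw.
rewrite /D; der_calc; rewrite /As /A /flow -/p.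
by move: (r ^+ n.+1) mn => m mn; field.
Qed.

Let der_Q r : 0 < r < 1 -> der Q r (- (r ^+ n.+1 * psi r * X r)).
Proof.
move=> r01; have [/andP[z0 _] _ _ _] := zode r01.
have [/andP[w0 _] _ _ _] := wode r01.
have mn : r ^+ n.+1 != 0 by case/andP: r01 => r0 _; rewrite expf_neq0// gt_eqF.
have h1 := der_psi r01; have h2 := der_Psi r01; have h3 := der_D r01.
have h4 := der_flow wode r01; have h5 := der_flow zode r01.
have zn : z r != 0 by rewrite gt_eqF.
have wn : w r != 0 by rewrite gt_eqF.
apply: der_eq.
  apply: (@derD _ (fun r => (As r - A r) * psi r) (fun r => - (D r * Psi r))).
    apply: (@derM _ (fun r => As r - A r) psi); last exact: h1.
    by apply: (@derD _ As (fun r => - A r)); [exact: h5|apply: derN; exact: h4].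
  by apply: (@derN _ (fun r => D r * Psi r)); apply: (@derM _ D Psi); [exact: h3|exact: h2].
rewrite /X -/p; move: (psi r) (Psi r) (D r) (As r) (A r) (p _) (p _) => x1 x2 x3 x4 x5 x6 x7.
by move: (r ^+ n.+1) mn => m mn; field; rewrite ?mn ?zn ?wn.
Qed.

Let psi_gt0 r : 0 < r < 1 -> 0 < psi r.
Proof.
move=> r01; have [/andP[z0 _] _ _ _] := zode r01.
by rewrite /psi mulr_gt0 ?pw_gt0// subr_gt0 zstar.
Qed.

Let lam0 : 0 < lam.
Proof. exact: lt_le_trans lam1_le. Qed.

(** X splits into (lam - lam1) G(w) and lam1 times the convexity gap of G. In the end the first part
    yields lam = lam1, the strict inequality w = z. *)
Let X_ge0 r : 0 < r < 1 ->
  (lam - lam1) * (p (w r) / w r) <= X r /\ (w r != z r -> 0 < X r).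
Proof.
move=> r01; have [/andP[z0 _] _ _ _] := zode r01.
have [/andP[w0 _] _ _ _] := wode r01.
have XE : X r = (lam - lam1) * (p (w r) / w r) +
   lam1 * (p (w r) / w r - p (z r) / z r - (delta + 1) / z r ^+ 2 * D r).
  by rewrite /X; move: (p _ / _) (p _ / _) (_ / _ * _) => *; ring.
have p0 : 0 <= (lam - lam1) * (p (w r) / w r).
  by rewrite mulr_ge0 ?subr_ge0// divr_ge0 ?ltW ?pw_gt0.
split=> [|wz].
  by rewrite XE lerDl mulr_ge0 ?(ltW lam10)// subr_ge0; exact: Fw_convex.
by rewrite XE ltr_wpDl// mulr_gt0// subr_gt0; exact: Fw_convex_lt.
Qed.

Let Q_nincr r s : 0 < r -> r <= s -> s < 1 -> Q s <= Q r.
Proof.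
move=> r0 rs s1.
have sub x := @itv_sub01 R r s x r0 s1.
apply: (@der_ge _ Q (fun r => - (r ^+ n.+1 * psi r * X r))); first exact: rs.
- by move=> x /sub; exact: der_Q.
- move=> x /andP[rx xs]; have x01 : 0 < x < 1 by apply: sub; rewrite !ltW.
  have [Xx _] := X_ge0 x01; have [/andP[w0 _] _ _ _] := wode x01.
  have X0 : 0 <= X x.
    by apply: le_trans Xx; rewrite mulr_ge0 ?subr_ge0// divr_ge0 ?ltW ?pw_gt0.
  have x0 : 0 <= x by case/andP: x01 => /ltW.
  by rewrite oppr_le0 mulr_ge0// mulr_ge0 ?exprn_ge0// ltW ?psi_gt0.
Qed.

Let pz_le r : 0 < r < 1 -> p (z r) <= p a.
Proof. by move=> /za; exact: pw_le. Qed.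

Let psi_le r : 0 < r < 1 -> psi r <= p a * (z r - r * z1 r).
Proof.
by move=> r01; rewrite ler_wpM2r ?pz_le// subr_ge0 ltW// zstar.
Qed.

Let p_gt0 x : 0 < x -> 0 < p x.
Proof. exact: pw_gt0. Qed.

Let As_le r : 0 < r < 1 -> As r <= p a * C * r ^+ n.+2.
Proof.
move=> r01; have [/andP[z0 _] _ _ _] := zode r01; have /andP[r0 _] := r01.
have r0' : 0 <= r ^+ n.+1 by rewrite exprn_ge0// ltW.
have -> : p a * C * r ^+ n.+2 = r ^+ n.+1 * p a * (C * r).
  by rewrite (exprS r n.+1); ring.
apply: ler_pM; rewrite ?z1C//.
- by rewrite mulr_ge0// ltW ?p_gt0.
- exact: (ode_deriv_ge0 delta0 lam10 zode).
- by rewrite ler_wpM2l ?pz_le.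
Qed.

Let K1 := `|lstar| * (p a * C) + lam1 * (p a / a).

Let K1_ge0 : 0 <= K1.
Proof.
have pa := ltW (p_gt0 a0).
exact: addr_ge0 (mulr_ge0 (normr_ge0 _) (mulr_ge0 pa C0))
  (mulr_ge0 (ltW lam10) (divr_ge0 pa (ltW a0))).
Qed.

Let Psi_le r : 0 < r < 1 -> `|Psi r| <= K1 * r ^+ n.+2.
Proof.
move=> r01; have [/andP[z0 _] _ _ _] := zode r01; have /andP[r0 _] := r01.
have r0' : 0 <= r ^+ n.+2 by rewrite exprn_ge0// ltW.
have As0 : 0 <= As r by exact: (flow_ge0 delta0 lam10 zode).
apply: le_trans (ler_normB _ _) _; rewrite /K1 [leRHS]mulrDl lerD//.
  by rewrite normrM -mulrA ler_wpM2l ?normr_ge0// (ger0_norm As0) As_le.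
have e0 : 0 <= lam1 * r ^+ n.+2 by rewrite mulr_ge0// ltW.
rewrite -mulrA ger0_norm; last by rewrite mulr_ge0// divr_ge0 ?ltW ?p_gt0.
rewrite [leRHS]mulrAC ler_wpM2l//; apply: ler_pM; rewrite ?pz_le ?invr_ge0 ?(ltW z0) ?(ltW (p_gt0 z0))//.
by rewrite lef_pV2 ?posrE ?za.
Qed.

Let F_ge0 y : 0 < y < 1 -> 0 <= F y.
Proof. by move=> /andP[y0 y1]; apply: Fw_ge0; rewrite y0 ltW. Qed.

Let D_le r : 0 < r < 1 -> `|D r| <= F (w r) + F (z r).
Proof.
move=> r01; have [z01 _ _ _] := zode r01; have [w01 _ _ _] := wode r01.
by apply: le_trans (ler_normB _ _) _; rewrite !ger0_norm ?F_ge0.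
Qed.

(** Near 0 the term -A psi has the right sign and is dropped, so no bound on w' is needed; As and
    Psi are O(s^(n+2)), and the only unbounded factor, F(w), is handled by [near0]. *)
Let Q_le0 r : 0 < r < 1 -> Q r <= 0.
Proof.
move=> /[dup] r01 /andP[r0 r1].
(* K2 sums the coefficients of the estimates b1 and b2; an error Q r / (1 + K2) then yields Q s < Q
   r for some s < r, against monotonicity. *)
pose K2 := p a * C * p a + K1 + K1 * F a.
have Fa : 0 <= F a.
  have [/andP[_ z1'] _ _ _] := zode r01.
  by apply: F_ge0; rewrite a0 (le_lt_trans (za r01)).
have pa0 := ltW (p_gt0 a0).
have K20 : 0 <= K2 by exact: addr_ge0 (addr_ge0 (mulr_ge0 (mulr_ge0 pa0 C0) pa0) K1_ge0) (mulr_ge0 K1_ge0 Fa).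
rewrite leNgt; apply/negP => Qr.
have [s [/andP[s0 sr] se Fse]] := near0 (divr_gt0 Qr (ltr_pwDl ltr01 K20)) r01.
have s1 := lt_trans sr r1; have s01 : 0 < s < 1 by rewrite s0.
have := Q_nincr s0 (ltW sr) r1; move: (Q r) Qr se Fse => q q0 se Fse.
apply/negP; rewrite -ltNge.
have [/andP[z0 z1'] _ _ _] := zode s01; have [/andP[w0 _] _ _ _] := wode s01.
have sn0 : 0 <= s ^+ n.+2 by rewrite exprn_ge0// ltW.
have sn : s ^+ n.+2 <= s by rewrite exprS ler_piMr ?(ltW s0)// exprn_ile1// ltW.
have A0 : 0 <= A s by exact: (flow_ge0 delta0 lam0 wode).
have As0 : 0 <= As s by exact: (flow_ge0 delta0 lam10 zode).
have psi0 := ltW (psi_gt0 s01).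
have b1 : (As s - A s) * psi s <= p a * C * p a * s.
  apply: (@le_trans _ _ (As s * psi s)); first by rewrite ler_wpM2r// gerBl.
  apply: (@le_trans _ _ (p a * C * s ^+ n.+2 * p a)); last first.
    by rewrite mulrAC ler_wpM2l// !mulr_ge0.
  apply: ler_pM => //; first exact: As_le.
  apply: le_trans (psi_le s01) _; rewrite ler_piMr//.
  have := ode_deriv_ge0 delta0 lam10 zode s01 => z10.
  have : 0 <= s * z1 s by rewrite mulr_ge0// ltW.
  lra.
have b2 : - (D s * Psi s) <= K1 * (s ^+ n.+2 * F (w s)) + K1 * F a * s.
  apply: le_trans (ler_norm _) _; rewrite normrN normrM.
  apply: (@le_trans _ _ ((F (w s) + F (z s)) * (K1 * s ^+ n.+2))).
    by apply: ler_pM => //; [exact: D_le|exact: Psi_le].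
  have -> : (F (w s) + F (z s)) * (K1 * s ^+ n.+2) =
    K1 * (s ^+ n.+2 * F (w s)) + K1 * (F (z s) * s ^+ n.+2) by ring.
  rewrite lerD2l -mulrA ler_wpM2l ?K1_ge0//; apply: ler_pM => //.
    by apply: F_ge0; rewrite z0.
  by apply: Fw_le => //; exact: za.
have b3 : K1 * (s ^+ n.+2 * F (w s)) <= K1 * (q / (1 + K2)).
  by rewrite ler_wpM2l ?K1_ge0.
have b4 : (p a * C * p a + K1 * F a) * s <= (p a * C * p a + K1 * F a) * (q / (1 + K2)).
  by apply: ler_wpM2l => //; exact: addr_ge0 (mulr_ge0 (mulr_ge0 pa0 C0) pa0) (mulr_ge0 K1_ge0 Fa).
apply: (@le_lt_trans _ _ (K2 * (q / (1 + K2)))).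
  by rewrite /Q /K2; lra.
rewrite mulrCA -[ltRHS]mulr1 ltr_pM2l// ltr_pdivrMr ?mul1r; lra.
Qed.

(** Near 1 the term As psi is dropped; A stays bounded because its derivative does, psi is small by
    z - s z' -> 0, and D is small since w and z tend to 1. *)
Let Q_ge0 r : 0 < r < 1 -> 0 <= Q r.
Proof.
move=> /[dup] r01 /andP[r0 r1].
have [/andP[wr0 wr1] _ _ _] := wode r01.
pose pr := p (w r).
have pr0 : 0 <= pr by exact/ltW/p_gt0.
pose CA := A r + lam * (pr / w r).
have pa0 := ltW (p_gt0 a0).
have Ar0 : 0 <= A r by exact: (flow_ge0 delta0 lam0 wode).
have CA0 : 0 <= CA by exact: addr_ge0 Ar0 (mulr_ge0 (ltW lam0) (divr_ge0 pr0 (ltW wr0))).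
pose K2 := CA * p a + pr * K1 + p a * K1.
have K20 : 0 <= K2 by exact: addr_ge0 (addr_ge0 (mulr_ge0 CA0 pa0) (mulr_ge0 pr0 K1_ge0)) (mulr_ge0 pa0 K1_ge0).
rewrite leNgt; apply/negP => Qr.
have q0 : 0 < - Q r by rewrite oppr_gt0.
have [s [/andP[rs s1] e1 e2 e3]] := near1 (divr_gt0 q0 (ltr_pwDl ltr01 K20)) r01.
have s0 := lt_trans r0 rs; have s01 : 0 < s < 1 by rewrite s0.
have := Q_nincr r0 (ltW rs) s1; move: (Q r) q0 e1 e2 e3 => q' q0 e1 e2 e3.
apply/negP; rewrite -ltNge; have [q qE] : exists q, q = - q' by exists (- q').
have -> : q' = - q by rewrite qE opprK.
rewrite -qE in q0 e1 e2 e3.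
have [/andP[z0 z1'] _ _ _] := zode s01; have [/andP[w0 w1'] _ _ _] := wode s01.
have wrs : w r <= w s by apply: (ode_nondecreasing delta0 lam0 wode); rewrite ?(ltW rs).
have sn0 : 0 <= s ^+ n.+2 by rewrite exprn_ge0// ltW.
have sn : s ^+ n.+2 <= 1 by rewrite exprn_ile1// ltW.
have As0 : 0 <= As s by exact: (flow_ge0 delta0 lam10 zode).
have A0 : 0 <= A s by exact: (flow_ge0 delta0 lam0 wode).
have psi0 := ltW (psi_gt0 s01).
have Abd : A s <= CA.
  suff : (fun x => A x - lam * (pr / w r) * x) s <= (fun x => A x - lam * (pr / w r) * x) r.
    rewrite /= /CA; have : 0 <= lam * (pr / w r) by exact: mulr_ge0 (ltW lam0) (divr_ge0 pr0 (ltW wr0)).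
    move: (lam * (pr / w r)) => c c0.
    have : c * s <= c by rewrite ler_piMr// ltW.
    have : 0 <= c * r by rewrite mulr_ge0// ltW.
    lra.
  apply: (@der_ge _ (fun x => A x - lam * (pr / w r) * x)
    (fun x => lam * x ^+ n.+1 * p (w x) / w x - lam * (pr / w r))); first exact: ltW.
  - move=> x /andP[rx xs]; have x01 : 0 < x < 1.
      by rewrite (lt_le_trans r0 rx) (le_lt_trans xs s1).
    have h : der A x _ := der_flow wode x01.
    by der_calc; rewrite mul0r add0r mulr1.
  - move=> x /andP[rx xs]; have x01 : 0 < x < 1.
      by rewrite (lt_trans r0 rx) (lt_trans xs s1).
    have [/andP[wx0 _] _ _ _] := wode x01; have /andP[x0 x1] := x01.
    have wrx : w r <= w x by apply: (ode_nondecreasing delta0 lam0 wode); rewrite ?(ltW rx).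
    rewrite subr_le0 -!mulrA ler_wpM2l ?(ltW lam0)//.
    have -> : pr / w r = 1 * (pr / w r) by rewrite mul1r.
    apply: ler_pM; rewrite ?exprn_ge0 ?exprn_ile1 ?(ltW x0) ?(ltW x1)//.
      by rewrite divr_ge0 ?ltW ?p_gt0.
    apply: ler_pM; rewrite ?invr_ge0 ?(ltW wx0) ?(ltW (p_gt0 wx0))//.
      exact: pw_le.
    by rewrite lef_pV2 ?posrE.
have b1 : - ((As s - A s) * psi s) <= CA * (p a * (z s - s * z1 s)).
  rewrite -mulNr opprB; apply: (@le_trans _ _ (A s * psi s)).
    by rewrite ler_wpM2r// gerBl.
  by apply: ler_pM => //; exact: psi_le.
have b2 : D s * Psi s <= (pr * (1 - w s) + p a * (1 - z s)) * K1.
  apply: le_trans (ler_norm _) _; rewrite normrM.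
  apply: ler_pM => //; last first.
    by apply: le_trans (Psi_le s01) _; rewrite ler_piMr ?K1_ge0.
  apply: le_trans (D_le s01) _; apply: lerD.
    apply: (@le_trans _ _ (p (w s) * (1 - w s))); first by rewrite ltW// Fw_lt_pw// w0.
    by rewrite ler_wpM2r ?subr_ge0 ?(ltW w1')//; exact: pw_le.
  apply: (@le_trans _ _ (p (z s) * (1 - z s))); first by rewrite ltW// Fw_lt_pw// z0.
  by rewrite ler_wpM2r ?subr_ge0 ?(ltW z1')//; exact: pz_le.
have b3 : CA * (p a * (z s - s * z1 s)) <= CA * (p a * (q / (1 + K2))).
  by rewrite !ler_wpM2l.
have b4 : (pr * (1 - w s) + p a * (1 - z s)) * K1 <= (pr * (q / (1 + K2)) + p a * (q / (1 + K2))) * K1.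
  by rewrite ler_wpM2r ?K1_ge0// lerD// ler_wpM2l.
have b5 : K2 * (q / (1 + K2)) < q.
  rewrite mulrCA -[ltRHS]mulr1 ltr_pM2l// ltr_pdivrMr ?mul1r; lra.
have : CA * (p a * (q / (1 + K2))) + (pr * (q / (1 + K2)) + p a * (q / (1 + K2))) * K1
  = K2 * (q / (1 + K2)) by rewrite /K2; ring.
by rewrite /Q; lra.
Qed.

(** Q is squeezed to 0, so its derivative -r^(n+1) psi X vanishes, and X = 0 because psi > 0. *)
Theorem green_unique : lam = lam1 /\ forall r, 0 < r < 1 -> w r = z r.
Proof.
have XE r : 0 < r < 1 -> X r = 0.
  move=> r01; have Q0 x : 0 < x < 1 -> Q x = 0.
    by move=> x01; apply/eqP; rewrite eq_le Q_le0// Q_ge0.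
  have h : der Q r 0.
    apply: (@der_near _ (fun=> 0)); last exact: der_cst.
    have /andP[r0 r1] := r01.
    near=> x; rewrite Q0//; apply/andP; split; near: x; [exact: lt_nbhsr|exact: lt_nbhsl].
  have := der_Q r01; rewrite /der => h'.
  have : - (r ^+ n.+1 * psi r * X r) = 0.
    by rewrite -(@derive_val _ _ _ _ _ _ _ h') (@derive_val _ _ _ _ _ _ _ h).
  have pos : 0 < r ^+ n.+1 * psi r.
    by rewrite mulr_gt0 ?psi_gt0// exprn_gt0//; case/andP: r01.
  by move/eqP; rewrite oppr_eq0 mulf_eq0 (gt_eqF pos) => /eqP.
split; last first.
  move=> r r01; apply/eqP/negP => /negP wz; have [_ /(_ wz)] := X_ge0 r01.
  by rewrite XE// ltxx.
have r01 : 0 < (2^-1 : R) < 1 by apply/andP; split; lra.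
have [+ _] := X_ge0 r01; have [/andP[w0 _] _ _ _] := wode r01.
rewrite XE// pmulr_lle0 ?divr_gt0 ?p_gt0// subr_le0 => h.
by apply/eqP; rewrite eq_le h lam1_le.
Unshelve. all: by end_near. Qed.

End Green.

(** * Comparison with the cone *)

Section Hardy.
Context {R : realType}.
Variables (n : nat) (delta lam : R).
Variables (w w1 w2 : R -> R).
Hypothesis delta0 : 0 < delta.
Let lstar : R := n.+1%:R - delta.
Let beta : R := n%:R / 2.
Hypothesis lstar0 : 0 < lstar.
Hypothesis lstar_le : lstar <= lam.
Hypothesis deltan : delta < beta.
Hypothesis hardy : lstar * (delta + 1) <= beta ^+ 2.
Hypothesis wode : radial_ode n delta lam w w1 w2.

Let p := pw delta.
Let F := Fw delta.
Let D r := F (w r) - F r.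
Let D1 r := - p (w r) * w1 r + p r.
Let D2 r := - p (w r) * w2 r + delta * p (w r) / w r * w1 r ^+ 2 - delta * p r / r.
Let q (r : R) := r `^ beta.

Let der_p r : 0 < r -> der p r (- delta * p r / r).
Proof. exact: der_pw. Qed.

Let der_q r : 0 < r -> der q r (beta * q r / r).
Proof.
move=> r0; apply: der_eq; first by rewrite /q; der_auto.
rewrite /q mulr1 powRB; last by apply/implyP => _; rewrite gt_eqF.
by rewrite powRr1 ?ltW// mulrA.
Qed.

Let der_D r : 0 < r < 1 -> der D r (D1 r).
Proof.
move=> r01; have [/andP[w0 _] h1 _ _] := wode r01; have /andP[r0 _] := r01.
have h2 : der (fun r => F (w r)) r (- p (w r) * w1 r).
  by apply: der_comp => //; exact: der_Fw.
have h3 : der F r (- p r) by exact: der_Fw.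
by rewrite /D; der_calc; rewrite /D1 opprK.
Qed.

Let der_D1 r : 0 < r < 1 -> der D1 r (D2 r).
Proof.
move=> r01; have [/andP[w0 _] h1 h2 _] := wode r01; have /andP[r0 _] := r01.
have h3 : der (fun r => p (w r)) r (- delta * p (w r) / w r * w1 r).
  by apply: der_comp => //; exact: der_pw.
have h4 := der_p r0; have wn : w r != 0 by rewrite gt_eqF.
rewrite /D1; der_calc; rewrite /D2.
by field; rewrite wn gt_eqF.
Qed.

(* The Hardy weight r^(n/2): where D < 0, Z = r^(n/2) D has no interior minimum
   since D'' + (n+1)/r D' + lstar (delta+1)/r^2 D < 0 and lstar (delta+1) <= (n/2)^2. *)
Let Z r := q r * D r.
Let Z1 r := q r * (beta * D r / r + D1 r).
Let Z2 r := q r * (beta * (beta - 1) * D r / r ^+ 2 + 2 * beta * D1 r / r + D2 r).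

Let der_Z r : 0 < r < 1 -> der Z r (Z1 r).
Proof.
move=> /[dup] r01 /andP[r0 _]; have h1 := der_q r0; have h2 := der_D r01.
have rn : r != 0 by rewrite gt_eqF.
apply: der_eq; first by apply: (@derM _ q D); [exact: h1|exact: h2].
by rewrite /Z1; field.
Qed.

Let der_Z1 r : 0 < r < 1 -> der Z1 r (Z2 r).
Proof.
move=> /[dup] r01 /andP[r0 _]; have h1 := der_q r0; have h2 := der_D r01.
have rn : r != 0 by rewrite gt_eqF.
have h3 := der_D1 r01.
apply: der_eq.
  apply: (@derM _ q (fun r => beta * D r / r + D1 r)); first exact: h1.
  apply: (@derD _ (fun r => beta * D r / r) D1); last exact: h3.
  apply: (@derM _ (fun r => beta * D r) (fun r => r^-1)).
    by apply: (@derM _ (fun=> beta) D); [exact: der_cst|exact: h2].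
  by apply: (@derV _ (fun r => r)); [exact: rn|exact: der_id].
by rewrite /Z2; cbv beta; field.
Qed.

(** Strict convexity of G at the cone, where its linearization is the Hardy potential lstar (delta +
    1) / r^2; replacing lstar by the larger lam increases the right side. *)
Let pdiv_gt r : 0 < r < 1 -> w r != r ->
  (delta + 1) * lstar / r ^+ 2 * D r < lam * (p (w r) / w r) - lstar * (p r / r).
Proof.
move=> r01 wr; have [/andP[w0 _] _ _ _] := wode r01; have /andP[r0 _] := r01.
have h := Fw_convex_lt delta0 w0 r0 wr.
apply: (@lt_le_trans _ _ (lstar * (p (w r) / w r - p r / r))).
  by rewrite [(delta + 1) * _]mulrC -!mulrA ltr_pM2l// mulrA.
by rewrite mulrBr lerD2r ler_wpM2r// divr_ge0 ?ltW ?pw_gt0.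
Qed.

Let Z2_lt0 r : 0 < r < 1 -> D r < 0 -> Z1 r = 0 -> Z2 r < 0.
Proof.
move=> r01 Dr Z10; have [/andP[w0 _] h1 h2 E] := wode r01; have /andP[r0 _] := r01.
have q0 : 0 < q r by exact: powR_gt0.
have rn : r != 0 by rewrite gt_eqF.
have wn : w r != 0 by rewrite gt_eqF.
have D1E : D1 r = - (beta * D r / r).
  move/eqP: Z10; rewrite /Z1 mulf_eq0 (gt_eqF q0) /= addrC addr_eq0 => /eqP //.
rewrite /Z2 pmulr_rlt0//.
have D2E : D2 r = - (lam * (p (w r) / w r) - lstar * (p r / r)) - n.+1%:R / r * D1 r.
  rewrite /D1 /D2.
  have -> : w2 r = (lam + delta * w1 r ^+ 2) / w r - n.+1%:R / r * w1 r by rewrite -E addrK.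
  by rewrite /lstar; field; rewrite rn wn.
have wr : w r != r by apply/eqP => wr; move: Dr; rewrite /D wr subrr ltxx.
have lt := pdiv_gt r01 wr.
rewrite D2E.
set X := lam * _ - _ in lt *.
have -> : beta * (beta - 1) * D r / r ^+ 2 + 2 * beta * D1 r / r + (- X - n.+1%:R / r * D1 r)
  = beta ^+ 2 / r ^+ 2 * D r - X.
  rewrite D1E -(natr1 n); have -> : n%:R = 2 * beta by rewrite /beta; field.
  by field.
rewrite subr_lt0; apply: le_lt_trans lt.
rewrite ler_nM2r// ler_pM2r ?invr_gt0 ?exprn_gt0//.
by rewrite mulrC.
Qed.

Let p_small r : 0 < r -> q r * F r <= r `^ (beta - delta) \/ 1 < r.
Proof.
move=> r0; case: (leP r 1) => r1; last by right.
left; have -> : r `^ (beta - delta) = q r * p r.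
  by rewrite powRD//; apply/implyP => _; rewrite gt_eqF.
by rewrite ler_pM2l ?powR_gt0//; apply: (Fw_le_pw delta0); rewrite r0.
Qed.

(** If w(r) > r, then Z(r) < 0 while Z is larger at radii near 0 and near 1; this yields an interior
    minimum, where Z' = 0 and Z'' < 0. *)
Theorem hardy_comparison r : 0 < r < 1 -> w r <= r.
Proof.
move=> /[dup] r01 /andP[r0 r1]; rewrite leNgt; apply/negP => rw.
have Dr : D r < 0 by rewrite /D subr_lt0; exact: Fw_lt.
have q0 x : 0 < x -> 0 < q x by move=> ?; exact: powR_gt0.
have Zr : Z r < 0 by rewrite /Z pmulr_rlt0// q0.
have ZF x : 0 < x < 1 -> - (q x * F x) <= Z x.
  move=> x01; have [/andP[w0 wx1] _ _ _] := wode x01; have /andP[x0 x1] := x01.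
  rewrite -mulrN ler_pM2l ?q0// /D lerBDr addrC subrr.
  by apply: Fw_ge0; rewrite w0 ltW.
(* F(w) >= 0 gives Z >= -r^beta F(r) whatever w does near 0, and r^beta F(r) <= r^(beta - delta)
   tends to 0. *)
have [s [/andP[s0 sr] Zs]] : exists s, 0 < s < r /\ Z r < Z s.
  have b0 : 0 < beta - delta by rewrite subr_gt0.
  have /cvgrPdist_lt /(_ (- Z r)) := powR_cvg0 b0.
  rewrite oppr_gt0 => /(_ Zr) h.
  have [s [s0 [sr hs]]] : exists s, 0 < s /\ (s < r /\ `|0 - s `^ (beta - delta)| < - Z r).
    have : \forall s \near (0:R)^'+, 0 < s /\ (s < r /\ `|0 - s `^ (beta - delta)| < - Z r).
      near=> s; split; first by near: s; exact: nbhs_right_gt.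
      split; first by near: s; exact: nbhs_right_lt.
      by near: s.
    by move=> /filter_ex[s hs]; exists s.
  exists s; split; first by rewrite s0.
  move: hs; rewrite sub0r normrN ger0_norm ?powR_ge0// => hs.
  have s01 : 0 < s < 1 by rewrite s0 (lt_trans sr).
  apply: lt_le_trans (ZF _ s01); rewrite ltrNr.
  case: (p_small s0) => [h'|]; first exact: le_lt_trans h' hs.
  by rewrite ltNge (ltW (lt_trans sr r1)).
have [t [/andP[rt t1] Zt]] : exists t, r < t < 1 /\ Z r < Z t.
  pose e := - Z r / (p r + 1).
  have pr0 : 0 < p r by exact: pw_gt0.
  have e0 : 0 < e by rewrite divr_gt0 ?oppr_gt0// addr_gt0.
  pose t := Num.max ((r + 1) / 2) (1 - e / 2).
  have t1 : t < 1 by rewrite gt_max; apply/andP; split; lra.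
  have rt : r < t by rewrite lt_max; apply/orP; left; lra.
  exists t; rewrite rt t1; split=> //.
  have t0 := lt_trans r0 rt; have t01 : 0 < t < 1 by rewrite t0.
  apply: lt_le_trans (ZF _ t01); rewrite ltrNr.
  have te : 1 - t < e.
    have : 1 - e / 2 <= t by rewrite le_max lexx orbT.
    by lra.
  have qt : q t <= 1.
    have b0 : 0 <= beta by exact: le_trans (ltW delta0) (ltW deltan).
    have := ge0_ler_powR b0; move=> /(_ t 1); rewrite powR1; apply.
    - by rewrite nnegrE ltW.
    - by rewrite nnegrE.
    - exact: ltW.
  have Ft : F t <= p r * (1 - t).
    apply: le_trans (ltW (Fw_lt_pw delta0 t01)) _.
    by rewrite ler_wpM2r ?subr_ge0 ?(ltW t1)// pw_le// ltW.
  have Ft0 : 0 <= F t by apply: Fw_ge0; rewrite t0 ltW.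
  apply: (@le_lt_trans _ _ (1 * (p r * (1 - t)))).
    by apply: ler_pM => //; exact/ltW/q0.
  rewrite mul1r; apply: (@lt_trans _ _ (p r * e)); first by rewrite ltr_pM2l.
  rewrite /e mulrCA -[ltRHS]mulr1 ltr_pM2l ?oppr_gt0// ltr_pdivrMr ?addr_gt0//.
  by rewrite mul1r ltrDl.
have st : s <= t by rewrite ltW// (lt_trans sr).
have sub x := @itv_sub01 R s t x s0 t1.
have Zc : {within `[s, t], continuous Z}.
  by apply: (@der_within _ Z Z1) => x /sub; exact: der_Z.
have [c cst' cmin] := EVT_min st Zc; rewrite in_itv /= in cst'.
have Zcr : Z c <= Z r.
  by apply: cmin; rewrite in_itv /= (ltW sr) (ltW rt).
have sc : s < c.
  rewrite lt_neqAle; case/andP: cst' => -> _; rewrite andbT; apply/eqP => E.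
  by move: Zcr; rewrite -E leNgt Zs.
have ct : c < t.
  rewrite lt_neqAle; case/andP: cst' => _ ->; rewrite andbT; apply/eqP => E.
  by move: Zcr; rewrite E leNgt Zt.
pose e := Num.min (c - s) (t - c).
have e0 : 0 < e by rewrite lt_min !subr_gt0 sc.
have near_c x : `|x - c| < e -> s <= x <= t.
  rewrite lt_min !ltr_norml => /andP[/andP[? ?] /andP[? ?]]; apply/andP; split; lra.
have c01 : 0 < c < 1 by exact: sub.
have [|||Z10 Z20] := @der2_min _ Z Z1 c (Z2 c) e e0.
- by move=> x /near_c /sub; exact: der_Z.
- exact: der_Z1.
- by move=> x /near_c hx; apply: cmin; rewrite in_itv.
have Dc : D c < 0.
  have : Z c < 0 by exact: le_lt_trans Zr.
  by rewrite /Z pmulr_rlt0// q0//; case/andP: c01.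
by have := Z2_lt0 c01 Dc Z10; rewrite ltNge Z20.
Unshelve. all: by end_near. Qed.

End Hardy.

(** * Uniqueness of the cone among solutions below it *)

Section SingularUnique.
Context {R : realType}.
Variables (n : nat) (delta : R).
Variables (w w1 w2 : R -> R).
Hypothesis delta0 : 0 < delta.
Let lstar : R := n.+1%:R - delta.
Let c : R := n.+2%:R - 2 * delta.
Hypothesis lstar0 : 0 < lstar.
Hypothesis c0 : 0 < c.
Hypothesis wode : radial_ode n delta lstar w w1 w2.
Hypothesis wr : forall r, 0 < r < 1 -> w r <= r.

Let p := pw delta.
Let m := Num.sqrt (lstar / n.+2%:R).

Let m0 : 0 < m.
Proof. by rewrite sqrtr_gt0 divr_gt0// ltr0n. Qed.

Let m2 : m ^+ 2 = lstar / n.+2%:R.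
Proof. by rewrite sqr_sqrtr// ltW// divr_gt0// ltr0n. Qed.

Let p_gt0 x : 0 < x -> 0 < p x.
Proof. exact: pw_gt0. Qed.

Let mw r : 0 < r < 1 -> m * r <= w r.
Proof.
move=> r01; have [/andP[w0 _] _ _ _] := wode r01; have /andP[r0 _] := r01.
have := ode_sqr_lower delta0 lstar0 wode r01; rewrite -m2 -exprMn.
by rewrite ler_pXn2r// nnegrE ltW// mulr_gt0.
Qed.

Let E r := p r ^+ 2 * r ^+ n.+2.

Let E_gt0 r : 0 < r -> 0 < E r.
Proof. by move=> r0; rewrite mulr_gt0 ?exprn_gt0 ?p_gt0. Qed.

Let der_E r : 0 < r -> der E r (c * E r / r).
Proof.
move=> r0; have h := der_pw delta r0; rewrite -/p in h.
have rn : r != 0 by rewrite gt_eqF.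
rewrite /E; der_calc; rewrite /c /= (exprS r n.+1).
by rewrite -(natr1 n.+1); move: (r ^+ n.+1) => k; field.
Qed.

Let E_powR r : 0 < r -> E r = r `^ c.
Proof.
move=> r0; rewrite /E /p /pw expr2 -powR_mulrn ?(ltW r0)//.
have d x y : r `^ x * r `^ y = r `^ (x + y).
  by rewrite powRD//; apply/implyP => _; rewrite gt_eqF.
by rewrite !d; congr powR; rewrite /c; ring.
Qed.

Let E_small r e : 0 < r -> 0 < e -> exists s, 0 < s < r /\ E s < e.
Proof.
move=> r0 e0; have /cvgrPdist_lt /(_ e e0) h := powR_cvg0 c0.
have : \forall s \near (0:R)^'+, 0 < s /\ (s < r /\ `|0 - s `^ c| < e).
  near=> s; split; first by near: s; exact: nbhs_right_gt.
  split; first by near: s; exact: nbhs_right_lt.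
  by near: s.
move=> /filter_ex[s [s0 [sr hs]]]; exists s; rewrite s0 sr E_powR//; split=> //.
by move: hs; rewrite sub0r normrN ger0_norm ?powR_ge0.
Unshelve. all: by end_near. Qed.

(** The factor between B and zeta_t: r g' = B / denom. *)
Let denom r := p r * p (w r) * r ^+ n.+1 * w r.

Let denom_gt0 r : 0 < r < 1 -> 0 < denom r.
Proof.
move=> r01; have [/andP[w0 _] _ _ _] := wode r01; have /andP[r0 _] := r01.
by rewrite /denom !mulr_gt0 ?exprn_gt0 ?p_gt0.
Qed.

(** Both sides of m r <= w <= r enter: the lower one for the decreasing p(w), the upper one for the
    factor w. *)
Let denom_le r : 0 < r < 1 -> denom r <= p m * E r.
Proof.
move=> r01; have [/andP[w0 _] _ _ _] := wode r01; have /andP[r0 _] := r01.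
have pm : p (w r) <= p m * p r.
  rewrite /p /pw -powRM ?(ltW m0) ?(ltW r0)//; apply: pw_le => //; last exact: mw.
  by rewrite mulr_gt0.
have -> : p m * E r = p r * (p m * p r) * r ^+ n.+1 * r.
  by rewrite /E (exprS r n.+1); ring.
apply: ler_pM; rewrite ?wr ?(ltW w0)//.
  by rewrite !mulr_ge0 ?exprn_ge0 ?(ltW r0) ?(ltW (p_gt0 _)).
rewrite ler_wpM2r ?exprn_ge0 ?(ltW r0)//.
by rewrite ler_wpM2l// ltW ?p_gt0.
Qed.

Let E_le1 r : 0 < r < 1 -> E r <= 1.
Proof.
move=> /andP[r0 r1]; have -> : 1 = E 1 by rewrite /E /p pw1 !expr1n mulr1.
apply: (@der_le _ E (fun r => c * E r / r)); first exact: ltW.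
- by move=> x /andP[rx _]; apply: der_E; exact: lt_le_trans rx.
- move=> x /andP[rx _]; have x0 := lt_trans r0 rx.
  by rewrite divr_ge0 ?(ltW x0)// mulr_ge0 ?(ltW c0)// ltW ?E_gt0.
Qed.

(* With zeta = ln (w / r) and t = ln r, this is B = e^(ct - (delta-1) zeta) zeta_t,
   the integrating factor form of the autonomous second order equation for zeta. *)
Let B r := p r * p (w r) * (r ^+ n.+1 * (r * w1 r - w r)).
Let B1 r := lstar * p r * p (w r) * r ^+ n * (r ^+ 2 - w r ^+ 2) / w r.

Let der_B r : 0 < r < 1 -> der B r (B1 r).
Proof.
move=> r01; have [/andP[w0 _] h1 h2 ode] := wode r01; have /andP[r0 _] := r01.
have h3 : der (fun r => p (w r)) r (- delta * p (w r) / w r * w1 r).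
  by apply: der_comp => //; exact: der_pw.
have h4 := der_pw delta r0; rewrite -/p in h4.
have rn : r != 0 by rewrite gt_eqF.
have wn : w r != 0 by rewrite gt_eqF.
rewrite /B; der_calc; rewrite /B1 /=.
have -> : w2 r = (lstar + delta * w1 r ^+ 2) / w r - n.+1%:R / r * w1 r.
  by rewrite -ode addrK.
rewrite /lstar (exprS r n); move: (r ^+ n) (p r) (p (w r)) => k x y.
by field; rewrite rn wn.
Qed.

Let g r := ln (w r) - ln r.
Let g1 r := B r / (denom r * r).

Let der_g r : 0 < r < 1 -> der g r (g1 r).
Proof.
move=> r01; have [/andP[w0 _] h1 h2 ode] := wode r01; have /andP[r0 _] := r01.
have rn : r != 0 by rewrite gt_eqF.
have wn : w r != 0 by rewrite gt_eqF.
have kn : r ^+ n.+1 != 0 by rewrite expf_neq0.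
have pn : p r != 0 by rewrite gt_eqF ?p_gt0.
have qn : p (w r) != 0 by rewrite gt_eqF ?p_gt0.
rewrite /g; der_calc; rewrite /g1 /B /denom.
move: (r ^+ n.+1) (p r) (p (w r)) kn pn qn => k x y kn pn qn.
by field; rewrite rn wn kn pn qn.
Qed.

Let g_le0 r : 0 < r < 1 -> g r <= 0.
Proof.
move=> r01; have [/andP[w0 _] _ _ _] := wode r01; have /andP[r0 _] := r01.
by rewrite /g subr_le0 ler_ln ?posrE ?wr.
Qed.

Let g_ge r : 0 < r < 1 -> ln m <= g r.
Proof.
move=> r01; have [/andP[w0 _] _ _ _] := wode r01; have /andP[r0 _] := r01.
rewrite /g lerBrDr -lnM ?posrE// ler_ln ?posrE//; first exact: mw.
by rewrite mulr_gt0.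
Qed.

Let pm0 : 0 < p m. Proof. exact: p_gt0. Qed.

Let B_nondecr r s : 0 < s -> s <= r -> r < 1 -> B s <= B r.
Proof.
move=> s0 sr r1.
have sub x := @itv_sub01 R s r x s0 r1.
apply: (@der_le _ B B1); first exact: sr.
- by move=> x /sub; exact: der_B.
- move=> x /andP[sx xr]; have x01 : 0 < x < 1 by apply: sub; rewrite !ltW.
  have [/andP[w0 _] _ _ _] := wode x01; have /andP[x0 _] := x01.
  rewrite /B1 divr_ge0 ?(ltW w0)// mulr_ge0//.
    by rewrite !mulr_ge0 ?exprn_ge0 ?(ltW x0) ?(ltW lstar0) ?(ltW (p_gt0 _)).
  by rewrite subr_ge0 ler_pXn2r ?nnegrE ?(ltW x0) ?(ltW w0) ?wr.
Qed.

Let drop_log (r k : R) : 0 < r < 1 -> 0 < k -> exists s : R, [/\ 0 < s, s < r & ln r - ln s = k].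
Proof.
move=> /andP[r0 r1] k0; exists (r * expR (- k)); split.
- by rewrite mulr_gt0 ?expR_gt0.
- by rewrite gtr_pMr// expR_lt1 oppr_lt0.
- by rewrite lnM ?posrE ?expR_gt0// expRK; ring.
Qed.

Let der_gk (k x : R) : 0 < x < 1 -> der (fun x => g x + k * ln x) x (g1 x + k / x).
Proof.
move=> x01; have h := der_g x01; have x0 : 0 < x by case/andP: x01.
apply: der_eq.
  apply: (@derD _ g (fun x => k * ln x)); first exact: h.
  by apply: (@derM _ (fun=> k) (@ln R)); [exact: der_cst|exact: (@der_ln _ (fun x => x) x 1 x0 (der_id x))].
by rewrite mul0r add0r mul1r.
Qed.

(** B is nondecreasing, so a negative value persists towards 0 and keeps zeta_t below -k; then zeta
    would become positive as t -> -oo, against w <= r. *)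
Let B_ge0 r : 0 < r < 1 -> 0 <= B r.
Proof.
move=> /[dup] r01 /andP[r0 r1]; rewrite leNgt; apply/negP => Br.
pose k := - B r / p m.
have k0 : 0 < k by rewrite divr_gt0// oppr_gt0.
have gr := g_le0 r01.
have X0 : 0 < (1 - g r) / k by rewrite divr_gt0//; lra.
have [s [s0 sr E1]] := drop_log r01 X0.
have sub x := @itv_sub01 R s r x s0 r1.
have s01 : 0 < s < 1 by apply: sub; rewrite lexx ltW.
have : (fun x => g x + k * ln x) r <= (fun x => g x + k * ln x) s.
  apply: (@der_ge _ (fun x => g x + k * ln x) (fun x => g1 x + k / x)); first exact: ltW.
  - by move=> x /sub; exact: der_gk.
  - move=> x /andP[sx xr]; have x01 : 0 < x < 1 by apply: sub; rewrite !ltW.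
    have /andP[x0 _] := x01; have d0 := denom_gt0 x01.
    have dm : denom x <= p m.
      apply: le_trans (denom_le x01) _; rewrite ler_piMr ?(ltW pm0)//; exact: E_le1.
    have Bx : B x <= B r by exact: B_nondecr (ltW xr) r1.
    have h : B x / denom x <= - k.
      rewrite ler_pdivrMr// mulNr; apply: le_trans Bx _.
      rewrite -[X in X <= _]opprK lerN2 /k mulrAC ler_pdivrMr//.
      by rewrite ler_wpM2l// oppr_ge0 ltW.
    rewrite /g1 invfM mulrA -mulrDl pmulr_lle0 ?invr_gt0//; lra.
rewrite /= => h; have := g_le0 s01; apply/negP; rewrite -ltNge.
have : k * (ln r - ln s) = 1 - g r by rewrite E1 mulrC divfK ?gt_eqF.
rewrite mulrBr; lra.
Qed.

(** If w(r) < r, then B dominates a multiple of E, hence of [denom], towards 0. So zeta_t stays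
    above a positive constant and zeta falls below ln m as t -> -oo. *)
Theorem singular_unique r : 0 < r < 1 -> w r = r.
Proof.
move=> /[dup] r01 /andP[r0 r1]; apply/eqP; rewrite eq_le wr//= leNgt.
apply/negP => wlt; have [/andP[wr0 _] _ _ _] := wode r01.
have gr : g r < 0 by rewrite /g subr_lt0 ltr_ln ?posrE.
pose th := expR (g r).
have th0 : 0 < th by exact: expR_gt0.
have th1 : th < 1 by rewrite expR_lt1.
have g_mono x : 0 < x -> x <= r -> g x <= g r.
  move=> x0 xr.
  have sub y := @itv_sub01 R x r y x0 r1.
  apply: (@der_le _ g g1); first exact: xr.
  - by move=> y /sub; exact: der_g.
  - move=> y /andP[xy yr]; have y01 : 0 < y < 1 by apply: sub; rewrite !ltW.
    rewrite /g1 divr_ge0 ?B_ge0// mulr_ge0 ?(ltW (denom_gt0 _))//.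
    by case/andP: y01 => /ltW.
have w_th x : 0 < x -> x <= r -> w x <= th * x.
  move=> x0 xr; have x01 : 0 < x < 1 by rewrite x0 (le_lt_trans xr).
  have [/andP[w0 _] _ _ _] := wode x01.
  have gE : expR (g x) = w x / x by rewrite /g expRB !lnK ?posrE.
  have : expR (g x) <= expR (g r) by rewrite ler_expR; exact: g_mono.
  by rewrite gE ler_pdivrMr.
(* Below r, w <= th x with th < 1 gives B' >= C0 E / x; since E' = c E / x, integration yields B >=
   C1 E with C1 = C0 / c. *)
pose C0 := lstar * (1 - th ^+ 2).
have C00 : 0 < C0.
  by rewrite mulr_gt0// subr_gt0 expr_lt1// ltW.
pose C1 := C0 / c.
have C10 : 0 < C1 by rewrite divr_gt0.
have B1_ge x : 0 < x -> x <= r -> C1 * (c * E x / x) <= B1 x.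
  move=> x0 xr; have x01 : 0 < x < 1 by rewrite x0 (le_lt_trans xr).
  have [/andP[w0 _] _ _ _] := wode x01.
  have -> : C1 * (c * E x / x) = lstar * p x * x ^+ n * ((1 - th ^+ 2) * x ^+ 2) * (p x / x).
    rewrite /C1 /C0 /E !exprS; move: (x ^+ n) (p x) => y z.
    by field; rewrite !gt_eqF.
  have -> : B1 x = lstar * p x * x ^+ n * (x ^+ 2 - w x ^+ 2) * (p (w x) / w x).
    by rewrite /B1; ring.
  have a0 : 0 <= lstar * p x * x ^+ n.
    by rewrite !mulr_ge0 ?exprn_ge0 ?(ltW x0) ?(ltW lstar0) ?(ltW (p_gt0 _)).
  apply: ler_pM.
  - rewrite mulr_ge0// mulr_ge0 ?exprn_ge0 ?(ltW x0)// subr_ge0.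
    by rewrite exprn_ile1// ltW.
  - by rewrite divr_ge0 ?(ltW x0) ?(ltW (p_gt0 _)).
  - rewrite ler_wpM2l// mulrBl mul1r lerD2l lerN2 -exprMn.
    by rewrite ler_pXn2r ?nnegrE ?w_th ?(ltW w0)// mulr_ge0 ?ltW.
  - apply: ler_pM; rewrite ?invr_ge0 ?(ltW x0) ?(ltW (p_gt0 _))//.
      by apply: pw_le; rewrite ?wr.
    by rewrite lef_pV2 ?posrE ?wr.
have B_ge x : 0 < x -> x <= r -> C1 * E x <= B x.
  move=> x0 xr; rewrite leNgt; apply/negP => lt.
  have e0 : 0 < (C1 * E x - B x) / C1 by rewrite divr_gt0// subr_gt0.
  have [s [/andP[s0 sx] Es]] := E_small x0 e0.
  have sub y : s <= y <= x -> 0 < y < 1.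
    by move=> /andP[xy yr]; rewrite (lt_le_trans s0 xy) (le_lt_trans (le_trans yr xr) r1).
  have s01 : 0 < s < 1 by apply: sub; rewrite lexx ltW.
  have : (fun y => B y - C1 * E y) s <= (fun y => B y - C1 * E y) x.
    apply: (@der_le _ (fun y => B y - C1 * E y) (fun y => B1 y - C1 * (c * E y / y))); first exact: ltW.
    - move=> y hy; have y01 := sub _ hy; have y0 : 0 < y by case/andP: y01.
      have h1 := der_B y01; have h2 := der_E y0.
      apply: der_eq.
        apply: (@derD _ B (fun y => - (C1 * E y))); first exact: h1.
        apply: (@derN _ (fun y => C1 * E y)).
        by apply: (@derM _ (fun=> C1) E); [exact: der_cst|exact: h2].
      by rewrite mul0r add0r.
    - move=> y /andP[sy yx]; rewrite subr_ge0 B1_ge//; first exact: lt_trans sy.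
      exact: le_trans (ltW yx) xr.
  have := B_ge0 s01.
  have : C1 * E s < C1 * E x - B x by rewrite mulrC -ltr_pdivlMr.
  rewrite /=; move: (C1 * E s) (C1 * E x) => u v; lra.
pose k := C1 / p m.
have k0 : 0 < k by rewrite divr_gt0.
have X0 : 0 < (1 + g r - ln m) / k.
  by rewrite divr_gt0//; have := g_ge r01; lra.
have [s [s0 sr E1]] := drop_log r01 X0.
have sub x := @itv_sub01 R s r x s0 r1.
have s01 : 0 < s < 1 by apply: sub; rewrite lexx ltW.
have : (fun x => g x + - k * ln x) s <= (fun x => g x + - k * ln x) r.
  apply: (@der_le _ (fun x => g x + - k * ln x) (fun x => g1 x + - k / x)); first exact: ltW.
  - by move=> x /sub; exact: der_gk.
  - move=> x /andP[sx xr]; have x01 : 0 < x < 1 by apply: sub; rewrite !ltW.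
    have /andP[x0 _] := x01; have d0 := denom_gt0 x01.
    have h : k <= B x / denom x.
      rewrite ler_pdivlMr//; apply: le_trans (B_ge x x0 (ltW xr)).
      rewrite /k [leLHS]mulrAC ler_pdivrMr// -[leRHS]mulrA; apply: (ler_wpM2l (ltW C10)).
      by apply: le_trans (denom_le x01) _; rewrite mulrC.
    rewrite /g1 invfM mulrA -mulrDl pmulr_lge0 ?invr_gt0//; lra.
rewrite /= => h; have := g_ge s01; apply/negP; rewrite -ltNge.
have : k * (ln r - ln s) = 1 + g r - ln m by rewrite E1 mulrC divfK ?gt_eqF.
rewrite mulrBr; lra.
Qed.

End SingularUnique.

(** * The shooting orbit *)

Section Orbit.
Context {R : realType}.
Variables (n : nat) (delta : R) (J P : R -> R).
Hypothesis delta0 : 0 < delta.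
Hypothesis pot : radial_potential n (fun s => Ksrc delta (P s)) J P.
Implicit Types (s r t : R).

Let K := Ksrc delta.
Let N : R := n.+2%:R.

Let N0 : 0 < N. Proof. by rewrite ltr0n. Qed.

Lemma sourced_zero s : s <= 0 -> P s = 0.
Proof. by case: pot => _ h _ _ _; exact: h. Qed.

Lemma sourced_cont : continuous P.
Proof. by case: pot. Qed.

Lemma sourced_flux_ge0 s : 0 <= s -> 0 <= J s.
Proof.
apply: (potential_J_ge0 pot) => z _.
by have /andP[] := Ksrc01 delta0 (P z).
Qed.

Lemma sourced_ge0 s : 0 <= P s.
Proof.
apply: (potential_ge0 _ pot) => z _.
by have /andP[] := Ksrc01 delta0 (P z).
Qed.

Lemma sourced_le r s : r <= s -> P r <= P s.
Proof.
move=> rs; case: (leP r 0) => r0; first by rewrite (sourced_zero r0) sourced_ge0.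
apply: (@der_le _ P (fun z => J z / z ^+ n.+1)); first exact: rs.
- move=> x /andP[rx _]; case: pot => _ _ _ _; apply; exact: lt_le_trans rx.
- move=> x /andP[rx _]; have x0 := lt_trans r0 rx.
  by rewrite divr_ge0 ?exprn_ge0 ?sourced_flux_ge0 ?ltW.
Qed.

(** On (0, s) the source is at most 1 and at least its value at s, as P increases and K
    decreases. *)
Lemma sourced_flux_bounds s : 0 < s ->
  K (P s) / N * s ^+ n.+2 <= J s <= s ^+ n.+2 / N.
Proof.
move=> s0; have [_ _ [Jc J0] dJ _] := pot.
have Jw : {within `[0, s], continuous J}.
  by apply: within_pos => // [|z /dJ]; [exact: ltW|exact: der_cont].
have Nn : N != 0 by rewrite gt_eqF.
have dm (k x : R) : der (fun x => k / N * x ^+ n.+2) x (k * x ^+ n.+1).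
  by der_calc; rewrite /= -/N; move: (N) Nn => M Mn; field.
have h2 x : der (fun x => x ^+ n.+2 / N) x (x ^+ n.+1).
  by der_calc; rewrite /= -/N; move: (N) Nn => M Mn; field.
have cm (k : R) : {within `[0, s], continuous (fun x => k / N * x ^+ n.+2)}.
  by apply: (@der_within _ _ (fun x => k * x ^+ n.+1)) => x _; exact: dm.
apply/andP; split; rewrite -subr_ge0.
- have -> : 0 = J 0 - K (P s) / N * 0 ^+ n.+2 by rewrite J0 expr0n mulr0 subr0.
  apply: (@der_le_oo _ (fun x => J x - K (P s) / N * x ^+ n.+2)
    (fun x => x ^+ n.+1 * K (P x) - K (P s) * x ^+ n.+1)); first exact: ltW.
  + by move=> x; apply: cvgB; [exact: Jw|exact: cm].
  + move=> x /andP[x0 _]; have h := dJ _ x0; have h3 := dm (K (P s)) x.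
    by apply: (@derD _ J (fun x => - (K (P s) / N * x ^+ n.+2))); [exact: h|apply: derN].
  + move=> x /andP[x0 xs]; rewrite [K (P s) * _]mulrC -mulrBr.
    rewrite mulr_ge0 ?exprn_ge0 ?(ltW x0)//.
    have := @Ksrc_lip_le _ _ delta0 (P x) (P s).
    by rewrite sourced_ge0 sourced_le ?(ltW xs)// => /(_ isT) /andP[].
- have -> : 0 = 0 ^+ n.+2 / N - J 0 by rewrite J0 expr0n mul0r subr0.
  apply: (@der_le_oo _ (fun x => x ^+ n.+2 / N - J x)
    (fun x => x ^+ n.+1 - x ^+ n.+1 * K (P x))); first exact: ltW.
  + move=> x; apply: cvgB; last exact: Jw.
    by apply: (@der_within _ (fun x => x ^+ n.+2 / N) (fun x => x ^+ n.+1)) => y _.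
  + move=> x /andP[x0 _]; have h := dJ _ x0.
    by apply: (@derD _ (fun x => x ^+ n.+2 / N) (fun x => - J x)); [exact: h2|apply: derN].
  + move=> x /andP[x0 xs]; have /andP[_ k1] := Ksrc01 delta0 (P x).
    by rewrite subr_ge0 ler_piMr// exprn_ge0// ltW.
Qed.

(* [shoot] solves the radial equation with lam = 1, [shoot 0 = 1] and zero slope
   at 0, as long as [shoot_dom] holds; [P s] is the integral of t^(-delta) from 1
   to [shoot s]. *)
Definition shoot_dom s := 0 < lin delta (P s).
Definition shoot s := Om delta (P s).
Definition shoot1 s := shoot s * (J s / s ^+ n.+1) / lin delta (P s).
Definition shoot2 s :=
  (1 + delta * shoot1 s ^+ 2) / shoot s - n.+1%:R / s * shoot1 s.

Local Notation good := shoot_dom.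
Local Notation W := shoot.
Local Notation W1 := shoot1.
Local Notation W2 := shoot2.

Lemma shoot_gt0 s : 0 < W s. Proof. exact: Om_gt0. Qed.

Lemma shoot_zero s : s <= 0 -> W s = 1.
Proof. by move=> s0; rewrite /shoot sourced_zero// Om0. Qed.

Lemma shoot_dom_zero s : s <= 0 -> good s.
Proof. by move=> s0; rewrite /shoot_dom sourced_zero// /lin mulr0 addr0. Qed.

Lemma shoot_dom_le r s : good s -> r <= s -> good r.
Proof.
move=> gs rs; have g0 : 0 < lin delta 0 by rewrite /lin mulr0 addr0.
by apply: (lin_between g0 gs); rewrite sourced_ge0 sourced_le.
Qed.

Lemma shoot_cont s : good s -> {for s, continuous W}.
Proof.
move=> gs; apply: continuous_comp; first exact: sourced_cont.
exact: der_cont (der_Om gs).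
Qed.

Lemma shoot_ge1 s : good s -> 1 <= W s.
Proof. by move=> gs; apply: Om_ge1; rewrite ?sourced_ge0. Qed.

Lemma der_shoot s : 0 < s -> good s -> der W s (W1 s).
Proof.
move=> s0 gs; have [_ _ _ _ dP] := pot.
by apply: der_eq; [apply: (der_comp (der_Om gs) (dP _ s0))|rewrite /shoot1 mulrAC].
Qed.

Lemma Ksrc_shoot s : good s -> K (P s) = lin delta (P s) / W s ^+ 2.
Proof.
move=> gs; rewrite /K Ksrc_ge0E ?sourced_ge0//.
by have -> : (lin delta (P s) <= 0) = false by apply/negbTE; rewrite -ltNge.
Qed.

(** Since [shoot2] is read off from the radial equation, this is the statement that the orbit solves
    it with parameter 1. *)
Lemma der_shoot1 s : 0 < s -> good s -> der W1 s (W2 s).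
Proof.
move=> s0 gs; have [_ _ _ dJ dP] := pot.
have h1 := der_shoot s0 gs; have h2 := dP _ s0; have h3 := dJ _ s0.
have sn : s != 0 by rewrite gt_eqF.
have kn : s ^+ n.+1 != 0 by rewrite expf_neq0.
have ln : lin delta (P s) != 0 by rewrite gt_eqF.
have wn : W s != 0 by rewrite gt_eqF ?shoot_gt0.
have h4 : der (fun s => J s / s ^+ n.+1) s (K (P s) - n.+1%:R / s * (J s / s ^+ n.+1)).
  der_calc; rewrite /= exprS -/K in kn *; move: (s ^+ n) (K _) kn => k u.
  by rewrite mulf_eq0 negb_or => /andP[_ kn]; field; rewrite sn kn.
have h5 : der (fun s => lin delta (P s)) s ((1 - delta) * (J s / s ^+ n.+1)).
  by rewrite /lin; der_calc; ring.
rewrite Ksrc_shoot// in h4; move: h4 h5 h1; rewrite /shoot1; set q := fun s => J s / s ^+ n.+1.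
rewrite -/(q s) => h4 h5 h1.
apply: der_eq.
  apply: (@derM _ (fun s => W s * q s) (fun s => (lin delta (P s))^-1)).
    by apply: (@derM _ W q); [exact: h1|exact: h4].
  by apply: (@derV _ (fun s => lin delta (P s))); [exact: ln|exact: h5].
rewrite /shoot2 /shoot1 -/(q s); move: (q s) (lin delta (P s)) (W s) ln wn => a b e bn en.
by field; rewrite sn bn en.
Qed.

Lemma shoot1_gt0 s : 0 < s -> good s -> 0 < W1 s.
Proof.
move=> s0 gs; rewrite /shoot1 divr_gt0// mulr_gt0 ?shoot_gt0// divr_gt0 ?exprn_gt0//.
have /andP[h _] := sourced_flux_bounds s0; apply: lt_le_trans h.
by rewrite mulr_gt0 ?exprn_gt0// divr_gt0// Ksrc_shoot// divr_gt0// exprn_gt0// shoot_gt0.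
Qed.

Lemma shoot_lt r s : 0 <= r -> r < s -> good s -> W r < W s.
Proof.
move=> r0 rs gs.
have Wlt a b : 0 < a -> a < b -> b <= s -> W a < W b.
  move=> a0 ab bs.
  have sub x : a <= x <= b -> 0 < x /\ good x.
    by move=> /andP[ax xb]; split; [exact: lt_le_trans ax|exact: shoot_dom_le (le_trans xb bs)].
  apply: (@der_lt _ W W1 a b ab).
  - by move=> x /sub[]; exact: der_shoot.
  - move=> x /andP[ax xb]; have [x0 gx] : 0 < x /\ good x by apply: sub; rewrite !ltW.
    exact: shoot1_gt0.
move: r0; rewrite le_eqVlt => /predU1P[r0|r0]; last exact: Wlt.
have s2 : 0 < s / 2 by lra.
have h := @Wlt (s / 2) s s2; rewrite -r0 shoot_zero//.
apply: (@le_lt_trans _ _ (W (s / 2))); last by apply: h; lra.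
by apply: shoot_ge1; apply: shoot_dom_le gs _; lra.
Qed.

(** J / s^(n+2) is squeezed between K(P s) / N and 1 / N. *)
Lemma shoot1_lim : W1 s / s @[s --> 0^'+] --> N^-1.
Proof.
have g0 := shoot_dom_zero (lexx 0).
have Pc : P s @[s --> 0^'+] --> (0 : R).
  have h : P s @[s --> 0^'+] --> P 0 by apply: cvg_at_right_filter; exact: sourced_cont.
  by rewrite (sourced_zero (lexx 0)) in h.
have lc : lin delta (P s) @[s --> 0^'+] --> (1 : R).
  have h : 1 + (1 - delta) * P s @[s --> 0^'+] --> 1 + (1 - delta) * 0.
    by apply: cvgD; [exact: cvg_cst|apply: cvgM; [exact: cvg_cst|exact: Pc]].
  by rewrite mulr0 addr0 in h.
have Wc : W s @[s --> 0^'+] --> (1 : R).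
  have h : W s @[s --> 0^'+] --> W 0 by apply: cvg_at_right_filter; exact: shoot_cont.
  by rewrite (shoot_zero (lexx 0)) in h.
have Kc : K (P s) / N @[s --> 0^'+] --> N^-1.
  have h : lin delta (P s) / W s ^+ 2 / N @[s --> 0^'+] --> (1 / 1 ^+ 2 / N : R).
    apply: cvgM; last exact: cvg_cst.
    apply: cvgM; first exact: lc.
    apply: cvgV; first by rewrite expr1n oner_neq0.
    exact: (cvgM Wc Wc).
  rewrite expr1n divr1 mul1r in h; apply: cvg_trans h; apply: near_eq_cvg.
  have : \forall s \near (0:R)^'+, 0 < lin delta (P s) by exact: (cvgr_gt (1:R) lc).
  by apply: filterS => s gs; rewrite Ksrc_shoot.
have Jc : J s / s ^+ n.+2 @[s --> 0^'+] --> N^-1.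
  apply: (@squeeze_cvgr _ _ _ _ (fun s => K (P s) / N) (fun=> N^-1)) => //.
    near=> s; have s0 : 0 < s by near: s; exact: nbhs_right_gt.
    have /andP[h1 h2] := sourced_flux_bounds s0.
    by rewrite ler_pdivlMr ?exprn_gt0// h1 ler_pdivrMr ?exprn_gt0// mulrC.
  exact: cvg_cst.
have h : W s * (J s / s ^+ n.+2) / lin delta (P s) @[s --> 0^'+] --> 1 * N^-1 / 1.
  apply: cvgM; first by apply: cvgM.
  by apply: cvgV; rewrite ?oner_neq0.
rewrite mul1r divr1 in h; apply: cvg_trans h; apply: near_eq_cvg.
near=> s; have s0 : 0 < s by near: s; exact: nbhs_right_gt.
rewrite /shoot1 (exprS s n.+1) invfM; move: (s ^+ n.+1)^-1 => k; ring.
Unshelve. all: by end_near. Qed.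

(** The equation gives 1 - (n+1) / N = 1 / N. That W'' and W' / s share their limit makes the
    function of several variables C2 at the origin. *)
Lemma shoot2_lim : W2 s @[s --> 0^'+] --> N^-1.
Proof.
have Wc : W s @[s --> 0^'+] --> (1 : R).
  have h : W s @[s --> 0^'+] --> W 0.
    by apply: cvg_at_right_filter; apply: shoot_cont; exact: shoot_dom_zero.
  by rewrite (shoot_zero (lexx 0)) in h.
have W1c : W1 s @[s --> 0^'+] --> (0 : R).
  have h : W1 s / s * s @[s --> 0^'+] --> N^-1 * 0.
    apply: cvgM; first exact: shoot1_lim.
    by apply: cvg_at_right_filter; exact: cvg_id.
  rewrite mulr0 in h; apply: cvg_trans h; apply: near_eq_cvg.
  near=> s; rewrite divfK// gt_eqF//; near: s; exact: nbhs_right_gt.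
have -> : N^-1 = (1 + delta * 0 ^+ 2) / 1 - n.+1%:R * N^-1.
  have Nn : N != 0 by rewrite gt_eqF.
  have NE : n.+1%:R = N - 1 by rewrite /N -(natr1 n.+1) addrK.
  by rewrite expr0n /= mulr0 addr0 divr1 NE; move: (N) Nn => M Mn; field.
have h : (1 + delta * W1 s ^+ 2) / W s - n.+1%:R * (W1 s / s) @[s --> 0^'+] -->
   (1 + delta * 0 ^+ 2) / 1 - n.+1%:R * N^-1.
  apply: cvgB; last by apply: cvgM; [exact: cvg_cst|exact: shoot1_lim].
  apply: cvgM; last by apply: cvgV; rewrite ?oner_neq0.
  apply: cvgD; first exact: cvg_cst.
  apply: cvgM; first exact: cvg_cst.
  exact: (cvgM W1c W1c).
apply: cvg_trans h; apply: near_eq_cvg; near=> s.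
by rewrite /shoot2; congr (_ - _); rewrite [RHS]mulrAC mulrA.
Unshelve. all: by end_near. Qed.

End Orbit.

(** * The shooting orbit in Emden-Fowler variables *)

Section Dichotomy.
Context {R : realType}.
Variables (n : nat) (delta : R) (J P : R -> R).
Hypothesis delta0 : 0 < delta.
Hypothesis pot : radial_potential n (fun s => Ksrc delta (P s)) J P.
Implicit Types (s r t : R).

Let W := shoot delta P.
Let W1 := shoot1 n delta J P.
Let W2 := shoot2 n delta J P.
Let good := shoot_dom delta P.
Let lstar : R := n.+1%:R - delta.
Let c : R := n.+2%:R - 2 * delta.

(* Emden-Fowler variables: by scaling, r -> W(s r) / W(s) solves the problem with
   parameter [vlam s], and [vlam] is stationary where [yslope] is 1. *)
Definition yslope s := s * W1 s / W s.
Definition vlam s := s ^+ 2 / W s ^+ 2.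

Let W0 s : 0 < W s. Proof. exact: shoot_gt0. Qed.

Let good_lt s r : good s -> r <= s -> good r.
Proof. exact: (shoot_dom_le delta0 pot). Qed.

Let dW s : 0 < s -> good s -> der W s (W1 s).
Proof. exact: der_shoot. Qed.

Lemma der_vlam s : 0 < s -> good s ->
  der vlam s (2 * vlam s * (1 - yslope s) / s).
Proof.
move=> s0 gs; have h := dW s0 gs; have wn : W s != 0 by rewrite gt_eqF.
have sn : s != 0 by rewrite gt_eqF.
have w2 : W s ^+ 2 != 0 by rewrite expf_neq0.
rewrite /vlam; der_calc; rewrite /yslope /= !expr1.
by field; rewrite sn wn.
Qed.

Lemma der_yslope s : 0 < s -> good s ->
  der yslope s ((vlam s - n%:R * yslope s + (delta - 1) * yslope s ^+ 2) / s).
Proof.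
move=> s0 gs; have h := dW s0 gs; have wn : W s != 0 by rewrite gt_eqF.
have sn : s != 0 by rewrite gt_eqF.
have h1 : der W1 s (W2 s) by exact: der_shoot1.
rewrite /yslope; der_calc.
rewrite /W2 /shoot2 -/W -/W1 /vlam -(natr1 n).
by field; rewrite sn wn.
Qed.

Lemma yslope_gt0 s : 0 < s -> good s -> 0 < yslope s.
Proof.
move=> s0 gs; rewrite /yslope divr_gt0// mulr_gt0//; exact: shoot1_gt0.
Qed.

Lemma vlam_gt0 s : 0 < s -> 0 < vlam s.
Proof. by move=> s0; rewrite /vlam divr_gt0 ?exprn_gt0. Qed.

Let yslope_near0 : exists2 e : R, 0 < e & forall s, 0 < s < e -> yslope s < 1.
Proof.
have Wc : W s @[s --> 0^'+] --> (1 : R).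
  have h : W s @[s --> 0^'+] --> W 0.
    by apply: cvg_at_right_filter; apply: (shoot_cont pot); exact: (shoot_dom_zero pot).
  by rewrite /W (shoot_zero pot (lexx 0)) in h.
have W1c : W1 s / s @[s --> 0^'+] --> (n.+2%:R^-1 : R) := shoot1_lim delta0 pot.
have sc : s @[s --> (0:R)^'+] --> (0 : R) by apply: cvg_at_right_filter; exact: cvg_id.
have yc : s * s * (W1 s / s) / W s @[s --> 0^'+] --> (0 * 0 * n.+2%:R^-1 / 1 : R).
  apply: cvgM; last by apply: cvgV; rewrite ?oner_neq0.
  by apply: cvgM; first exact: cvgM.
rewrite !mul0r in yc.
have : \forall s \near (0:R)^'+, s * s * (W1 s / s) / W s < 1 by exact: (cvgr_lt (0:R) yc).
rewrite near_withinE => /nbhs_ballP[e /= e0 he]; exists e => // s /andP[s0 se].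
have := he s; rewrite /ball /= sub0r normrN gtr0_norm// => /(_ se s0).
by rewrite mulrA [s * s * _]mulrAC mulfK ?gt_eqF// /yslope mulrC.
Qed.

Let y_cont s : 0 < s -> good s -> {for s, continuous yslope}.
Proof. by move=> s0 gs; apply: der_cont (der_yslope s0 gs). Qed.

Definition critical s1 := [/\ 0 < s1, good s1, yslope s1 = 1 &
  forall s, 0 < s < s1 -> yslope s < 1].

Let lin_cont s : {for s, continuous (fun s => lin delta (P s))}.
Proof.
rewrite /lin; apply: cvgD; first exact: cvg_cst.
by apply: cvgM; [exact: cvg_cst|exact: (sourced_cont pot)].
Qed.

(* Below the slope 1 the ratio W(s) / s decreases, so W cannot blow up. *)
Let all_good : (forall s, 0 < s -> good s -> yslope s < 1) -> forall s, good s.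
Proof.
move=> y1 s; rewrite /good /shoot_dom ltNge; apply/negP => bad.
have lin0 : lin delta (P 0) = 1 by rewrite (sourced_zero pot (lexx 0)) /lin mulr0 addr0.
have s0 : 0 < s.
  rewrite ltNge; apply/negP => s0; move: bad; rewrite leNgt.
  by move/negP; apply; exact: (shoot_dom_zero pot s0).
have linw a : {within `[a, s], continuous (fun x => - lin delta (P x))}.
  by apply: continuous_subspaceT => x; apply: cvgN; exact: lin_cont.
have [|r /andP[r0' rs] Er] := @ivt _ (fun x => - lin delta (P x)) 0 s (- 2^-1) (ltW s0) (linw 0).
  by rewrite lin0; apply/andP; split; lra.
have gr : good r by rewrite /good /shoot_dom; lra.
have r0 : 0 < r.
  rewrite lt_neqAle r0' andbT; apply/eqP => E; move: Er; rewrite -E lin0; lra.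
pose M := W r / r * s.
have M0 : 0 < M by rewrite mulr_gt0// divr_gt0.
have pM : 0 < pw delta M by exact: pw_gt0.
(* lin = W^(1 - delta) = p(W) W is at least p(M) as long as 1 <= W <= M; mu is a smaller value that
   lin must still take before vanishing. *)
pose mu := Num.min 2^-1 (pw delta M / 2).
have mu0 : 0 < mu by rewrite lt_min; apply/andP; split; lra.
have mu1 : mu <= 2^-1 by rewrite ge_min lexx.
have mu2 : mu < pw delta M by rewrite gt_min; apply/orP; right; lra.
have [|t /andP[rt ts] Et] := @ivt _ (fun x => - lin delta (P x)) r s (- mu) rs (linw r).
  by rewrite Er lerN2 mu1 /=; lra.
have gt : good t by rewrite /good /shoot_dom; lra.
have t0 : 0 < t by exact: lt_le_trans rt.
have Wt : W t / t <= W r / r.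
  apply: (@der_ge _ (fun x => W x / x) (fun x => W x * (yslope x - 1) / x ^+ 2) r t rt).
  - move=> x /andP[rx xt]; have x0 := lt_le_trans r0 rx.
    have h := dW x0 (good_lt gt xt); have xn : x != 0 by rewrite gt_eqF.
    have wn : W x != 0 by rewrite gt_eqF.
    by der_calc; rewrite /yslope; field; rewrite xn wn.
  - move=> x /andP[rx xt]; have x0 := lt_trans r0 rx.
    rewrite pmulr_lle0 ?invr_gt0 ?exprn_gt0// pmulr_rle0// subr_le0 ltW//.
    exact: y1 x0 (good_lt gt (ltW xt)).
have WM : W t <= M.
  move: Wt; rewrite ler_pdivrMr// => /le_trans; apply.
  by rewrite /M ler_wpM2l// divr_ge0// ltW.
have linE : lin delta (P t) = pw delta (W t) * W t.
  by rewrite pw_Om// divfK// gt_eqF// Om_gt0.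
have : pw delta M <= lin delta (P t).
  rewrite linE; apply: (@le_trans _ _ (pw delta (W t))); first exact: pw_le.
  by rewrite ler_peMr ?(ltW (pw_gt0 _ _))//; exact: (shoot_ge1 delta0 pot gt).
lra.
Qed.

Let plane_sub : (forall s, good s) -> (forall s, 0 < s -> yslope s < 1) ->
  (forall e, 0 < e -> exists2 s, 0 < s & lstar - e < vlam s) /\
  ~ ((c <= 0) \/ (c ^+ 2 < 8 * lstar)).
Proof.
move=> G y1.
pose Y t := yslope (expR t); pose V t := vlam (expR t).
have e0 t : 0 < expR t by exact: expR_gt0.
have de t : der expR t (expR t) by exact: is_derive_expR.
have dY t : 0 <= t -> der Y t (V t - n%:R * Y t + (delta - 1) * Y t ^+ 2).
  move=> _; apply: der_eq; first exact: der_comp (der_yslope (e0 t) (G _)) (de t).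
  by rewrite divfK// gt_eqF.
have dV t : 0 <= t -> der V t (2 * V t * (1 - Y t)).
  move=> _; apply: der_eq; first exact: der_comp (der_vlam (e0 t) (G _)) (de t).
  by rewrite divfK// gt_eqF.
have Y01 t : 0 <= t -> 0 < Y t < 1 by move=> _; rewrite /Y yslope_gt0 ?y1.
have V0 t : 0 <= t -> 0 < V t by move=> _; exact: vlam_gt0.
split=> [e ep|].
  by have [t [_ ht]] := trapped_sup delta0 dY dV Y01 V0 ep; exists (expR t).
exact: (trapped_node delta0 dY dV Y01 V0).
Qed.

(** A slope that never reaches 1 leaves the orbit trapped in 0 < y < 1, where the plane analysis
    applies with t = ln s. *)
Lemma orbit_dichotomy :
  (exists s1, critical s1) \/
  [/\ forall s, good s, (forall s, 0 < s -> yslope s < 1),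
      (forall e, 0 < e -> exists2 s, 0 < s & lstar - e < vlam s) &
      ~ ((c <= 0) \/ (c ^+ 2 < 8 * lstar))].
Proof.
have [[b [b0 gb yb]]|h] := pselect (exists s, [/\ 0 < s, good s & 1 <= yslope s]).
  left; have [e e0 he] := yslope_near0.
  (* The slope is below 1 on (0, e), so the first crossing on [a, b] is the first on (0, b]. *)
  pose a := Num.min (e / 2) (b / 2).
  have a0 : 0 < a by rewrite lt_min; apply/andP; split; lra.
  have ae : a <= e / 2 by rewrite ge_min lexx.
  have ab : a < b by rewrite gt_min; apply/orP; right; lra.
  have ya : yslope a < 1 by apply: he; apply/andP; split; lra.
  have fc x : a <= x <= b -> {for x, continuous yslope}.
    by move=> /andP[ax xb]; apply: y_cont; [exact: lt_le_trans ax|exact: good_lt xb].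
  have [s1 [/andP[as1 s1b] ys1 below]] := first_time ab fc ya yb.
  exists s1; split=> //; [exact: lt_trans as1|exact: good_lt s1b|].
  move=> s /andP[s0 ss1]; case: (leP a s) => [as_|sa]; first by apply: below; rewrite as_.
  by apply: he; rewrite s0 /=; lra.
right; have y1 s : 0 < s -> good s -> yslope s < 1.
  by move=> s0 gs; rewrite ltNge; apply/negP => ys; apply: h; exists s.
have G := all_good y1; have y1' s : 0 < s -> yslope s < 1 by move=> s0; exact: y1.
by have [h1 h2] := plane_sub G y1'; split.
Qed.

(** W >= 1 gives [vlam s <= s^2], so small values are taken near 0; the rest is the intermediate
    value theorem. *)
Lemma vlam_surj s1 lam : 0 < s1 -> good s1 -> 0 < lam <= vlam s1 ->
  exists s, [/\ 0 < s, s <= s1 & vlam s = lam].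
Proof.
move=> s10 gs1 /andP[lam0 lam1].
have vle s : 0 < s -> s <= s1 -> vlam s <= s ^+ 2.
  move=> s0 ss1; have h := shoot_ge1 delta0 pot (good_lt gs1 ss1).
  by rewrite /vlam ler_pdivrMr ?exprn_gt0// ler_peMr ?sqr_ge0// exprn_ege1.
pose a := Num.min (s1 / 2) (Num.min 1 (lam / 2)).
have a0 : 0 < a by rewrite !lt_min; apply/andP; split; [|apply/andP; split]; lra.
have as1 : a <= s1 / 2 by rewrite ge_min lexx.
have a1 : a <= 1 by rewrite !ge_min lexx orbT.
have al : a <= lam / 2 by rewrite !ge_min lexx !orbT.
have as1' : a <= s1 by lra.
have va : vlam a <= lam.
  apply: le_trans (vle a a0 as1') _; rewrite expr2.
  have : a * a <= a by rewrite ler_piMr// ltW.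
  lra.
have vc : {within `[a, s1], continuous vlam}.
  apply: (@der_within _ vlam (fun s => 2 * vlam s * (1 - yslope s) / s)) => x /andP[ax xs].
  by apply: der_vlam; [exact: lt_le_trans ax|exact: good_lt xs].
have [|s /andP[as_ ss] E] := ivt as1' vc (c := lam).
  by rewrite va.
by exists s; split=> //; exact: lt_le_trans as_.
Qed.

(** At s with P(s) = f the bound P(s) <= s^2 / (2 N) gives [vlam s] >= 2 N f / W^2 with W = [Om f].
    The value f0 maximizes f / [Om f]^2, where lin f = 2 f. *)
Lemma vlam_lower : exists s, [/\ 0 < s, good s & extremal_lower_bound n.+2 delta <= vlam s].
Proof.
pose f0 := (delta + 1)^-1.
have d1 : 0 < delta + 1 by have h := delta0; lra.
have f00 : 0 < f0 by rewrite invr_gt0.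
have linf : lin delta f0 = 2 / (delta + 1) by rewrite /lin /f0; field; rewrite gt_eqF.
have lf0 : 0 < lin delta f0 by rewrite linf divr_gt0.
have N0 : 0 < n.+2%:R :> R by rewrite ltr0n.
have dP s : 0 < s -> der P s (J s / s ^+ n.+1) by case: pot => _ _ _ _; exact.
pose k := Ksrc delta f0.
have k0 : 0 < k.
  rewrite /k (Ksrc_ge0E _ (ltW f00)).
  have -> : (lin delta f0 <= 0) = false by apply/negbTE; rewrite -ltNge.
  by rewrite divr_gt0// exprn_gt0// Om_gt0.
have P0 : P 0 = 0 by rewrite (sourced_zero pot).
have reach : exists2 b, 0 < b & f0 <= P b.
  (* While P < f0 the source is at least k, so P >= k s^2 / (2 N), which reaches f0 by b; b >= 1
     allows b <= b^2. *)
  pose b := Num.max 1 (2 * n.+2%:R * f0 / k).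
  have b1 : 1 <= b by rewrite le_max lexx.
  have b0 : 0 < b by exact: lt_le_trans b1.
  have bk : f0 <= k / (2 * n.+2%:R) * b ^+ 2.
    have : 2 * n.+2%:R * f0 / k <= b by rewrite le_max lexx orbT.
    rewrite ler_pdivrMr// => h.
    have h2 : b * k <= k * b ^+ 2 by rewrite mulrC ler_pM2l// expr2 ler_peMr// ltW.
    have M0 : 0 < 2 * n.+2%:R :> R by rewrite mulr_gt0.
    rewrite mulrAC ler_pdivlMr// mulrC; exact: le_trans h h2.
  exists b => //; rewrite leNgt; apply/negP => Pb.
  have : (fun s => P s - k / (2 * n.+2%:R) * s ^+ 2) 0 <= (fun s => P s - k / (2 * n.+2%:R) * s ^+ 2) b.
    apply: (@der_le_oo _ (fun s => P s - k / (2 * n.+2%:R) * s ^+ 2)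
       (fun s => J s / s ^+ n.+1 - k / n.+2%:R * s)); first exact: ltW.
    - apply: continuous_subspaceT => x; apply: cvgB; first exact: (sourced_cont pot).
      by apply: cvgM; [exact: cvg_cst|exact: exprn_continuous].
    - move=> x /andP[x0 _]; have h := dP _ x0.
      have Nn : n.+2%:R != 0 :> R by rewrite gt_eqF.
      by der_calc; rewrite /= expr1; move: (J x / _) n.+2%:R Nn => q M Mn; field.
    - move=> x /andP[x0 xb]; have /andP[h _] := sourced_flux_bounds delta0 pot x0.
      rewrite subr_ge0 ler_pdivlMr ?exprn_gt0//; apply: le_trans h.
      rewrite (exprS x n.+1) [leRHS]mulrA ler_pM2r ?exprn_gt0// ler_pM2r// ler_pM2r ?invr_gt0//.
      have := @Ksrc_lip_le _ _ delta0 (P x) f0.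
      rewrite (sourced_ge0 delta0 pot) (ltW (le_lt_trans _ Pb)) ?(sourced_le delta0 pot) ?(ltW xb)//.
      by move=> /(_ isT) /andP[+ _]; rewrite subr_ge0.
  rewrite /= P0 expr0n /= mulr0 subr0 subr_ge0 => h.
  by have := le_lt_trans (le_trans bk h) Pb; rewrite ltxx.
have [b b0 Pb] := reach.
have [||s /andP[s0' _] Ps] := @ivt _ P 0 b f0 (ltW b0).
- by apply: continuous_subspaceT; exact: (sourced_cont pot).
- by rewrite P0 (ltW f00).
have s0 : 0 < s.
  by rewrite lt_neqAle s0' andbT; apply/eqP => E; move: f00; rewrite -Ps -E P0 ltxx.
have Psle : P s <= s ^+ 2 / (2 * n.+2%:R).
  rewrite -subr_ge0.
  have -> : 0 = (fun s => s ^+ 2 / (2 * n.+2%:R) - P s) 0 by rewrite P0 expr0n mul0r subr0.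
  apply: (@der_le_oo _ (fun s => s ^+ 2 / (2 * n.+2%:R) - P s)
     (fun s => s / n.+2%:R - J s / s ^+ n.+1)); first exact: ltW.
  - apply: continuous_subspaceT => x; apply: cvgB; last exact: (sourced_cont pot).
    by apply: cvgM; [exact: exprn_continuous|exact: cvg_cst].
  - move=> x /andP[x0 _]; have h := dP _ x0.
    have Nn : n.+2%:R != 0 :> R by rewrite gt_eqF.
    by der_calc; rewrite /= expr1; move: (J x / _) n.+2%:R Nn => q M Mn; field.
  - move=> x /andP[x0 xb]; have /andP[_ h] := sourced_flux_bounds delta0 pot x0.
    rewrite subr_ge0 ler_pdivrMr ?exprn_gt0//; apply: le_trans h _.
    by rewrite (exprS x n.+1) mulrAC.
exists s; split=> //; first by rewrite /good /shoot_dom Ps.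
have -> : extremal_lower_bound n.+2 delta = 2 * n.+2%:R * f0 / W s ^+ 2.
  rewrite /W /shoot Ps /extremal_lower_bound /Om; have [d|d] := eqVneq delta 1.
    have E : 2 * f0 = 1 by rewrite /f0 d; field.
    by rewrite expRN -expRM_natl E [2 * _ * _]mulrAC E mul1r.
  rewrite linf; have l0 : 0 < 2 / (delta + 1) :> R by rewrite divr_gt0.
  rewrite /powR (gt_eqF l0).
  have dn : delta - 1 != 0 by rewrite subr_eq0.
  have dn' : 1 - delta != 0 by rewrite subr_eq0 eq_sym.
  set l := ln _.
  have -> : (delta + 1) / (delta - 1) * l = l - 2 * (l / (1 - delta)).
    by field; rewrite dn dn'.
  rewrite expRB (lnK l0) -expRM_natl /f0; ring.
rewrite /vlam ler_pM2r ?invr_gt0 ?exprn_gt0//.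
have M0 : 0 < 2 * n.+2%:R :> R by rewrite mulr_gt0.
by move: Psle; rewrite Ps ler_pdivlMr// mulrC.
Qed.

End Dichotomy.

(** * Radial functions of several variables *)

Section Continuity.
Context {R : realType} {T : topologicalType}.
Implicit Types (f g : T -> R) (x : T).

Lemma cont_add f g x : {for x, continuous f} -> {for x, continuous g} ->
  {for x, continuous (fun y => f y + g y)}.
Proof. by move=> fc gc; apply: cvgD; [exact: fc|exact: gc]. Qed.

Lemma cont_mul f g x : {for x, continuous f} -> {for x, continuous g} ->
  {for x, continuous (fun y => f y * g y)}.
Proof. by move=> fc gc; apply: cvgM; [exact: fc|exact: gc]. Qed.

Lemma cont_inv f x : f x != 0 -> {for x, continuous f} ->
  {for x, continuous (fun y => (f y)^-1)}.
Proof. by move=> f0 fc; apply: cvgV; [exact: f0|exact: fc]. Qed.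

Lemma cont_cst (a : R) x : {for x, continuous (fun=> a : R)}.
Proof. exact: cst_continuous. Qed.

Lemma cont_comp (k : R -> R) f x : {for x, continuous f} ->
  {for f x, continuous k} -> {for x, continuous (fun y => k (f y))}.
Proof. by move=> fc kc; apply: (@continuous_comp _ _ _ f k). Qed.

Lemma cont_near (A : set T) f g x : (\forall y \near x, A y) ->
  (forall y, A y -> g y = f y) -> {for x, continuous f} -> {for x, continuous g}.
Proof.
move=> xA fg fc; have E : \forall z \near x, f z = g z by apply: filterS xA => y /fg.
rewrite /prop_for /continuous_at -(nbhs_singleton E).
by apply: cvg_trans fc; apply: near_eq_cvg.
Qed.

Lemma cont_squeeze0 f g x : f x = 0 -> g x = 0 -> (forall y, `|g y| <= `|f y|) ->
  {for x, continuous f} -> {for x, continuous g}.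
Proof.
move=> fx gx gf fc; rewrite /prop_for /continuous_at gx; apply/cvgrPdist_lt => e e0.
have : f y @[y --> x] --> f x by exact: fc.
move=> /cvgrPdist_lt /(_ e e0); apply: filterS => y.
by rewrite fx !sub0r !normrN; exact: le_lt_trans.
Qed.

Lemma cont_lt f x a : {for x, continuous f} -> f x < a -> \forall y \near x, f y < a.
Proof. by move=> fc fa; exact: (cvgr_lt (f x) fc _ fa). Qed.

Lemma cont_gt f x a : {for x, continuous f} -> a < f x -> \forall y \near x, a < f y.
Proof. by move=> fc fa; exact: (cvgr_gt (f x) fc _ fa). Qed.

End Continuity.

Section Lines.
Context {R : realType} {N : nat}.
Implicit Types (x y : 'rV[R]_N) (f g : 'rV[R]_N -> R) (i j : 'I_N).

Local Notation e_ i := (delta_mx ord0 i : 'rV[R]_N).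

Definition rsq x : R := \sum_(i < N) x ord0 i ^+ 2.

Lemma rsq_ge0 x : 0 <= rsq x.
Proof. by apply: sumr_ge0 => i _; exact: sqr_ge0. Qed.

Lemma enormE x : enorm x = Num.sqrt (rsq x). Proof. by []. Qed.

Lemma enorm_ge0 x : 0 <= enorm x. Proof. exact: sqrtr_ge0. Qed.

Lemma enorm_sqr x : enorm x ^+ 2 = rsq x.
Proof. by rewrite sqr_sqrtr// rsq_ge0. Qed.

Lemma rsq_line x i h : rsq (h *: e_ i + x) = rsq x + 2 * h * x ord0 i + h ^+ 2.
Proof.
rewrite /rsq (bigD1 i)//= [in RHS](bigD1 i)//= !mxE !eqxx mulr1.
rewrite (eq_bigr (fun j => x ord0 j ^+ 2)).
  by move: (\sum_(_ | _) _) => S; ring.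
by move=> j ji; rewrite !mxE (negbTE ji) andbF mulr0 add0r.
Qed.

Lemma enorm_line x i h :
  enorm (h *: e_ i + x) = Num.sqrt (rsq x + 2 * h * x ord0 i + h ^+ 2).
Proof. by rewrite enormE rsq_line. Qed.

Lemma rsq0 : rsq 0 = 0.
Proof. by apply: big1 => i _; rewrite mxE expr0n. Qed.

Lemma enorm0 : enorm (0 : 'rV[R]_N) = 0.
Proof. by rewrite enormE rsq0 sqrtr0. Qed.

Lemma enorm_axis i r : 0 <= r -> enorm (r *: e_ i) = r.
Proof.
move=> r0; rewrite -[r *: _]addr0 enorm_line rsq0 mxE mulr0 !add0r.
by rewrite sqrtr_sqr ger0_norm.
Qed.

Lemma enorm_axis_norm i (h : R) : enorm (h *: e_ i) = `|h|.
Proof.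
rewrite -[h *: _]addr0 enorm_line rsq0 mxE mulr0 !add0r.
exact: sqrtr_sqr.
Qed.

Lemma coord_le_enorm x i : `|x ord0 i| <= enorm x.
Proof.
rewrite -(@ler_pXn2r _ 2) ?nnegrE ?enorm_ge0// enorm_sqr real_normK ?num_real//.
by rewrite /rsq (bigD1 i)//= lerDl sumr_ge0// => j _; exact: sqr_ge0.
Qed.

Lemma enorm_eq0 x : enorm x = 0 -> x = 0.
Proof.
move=> x0; apply/rowP => i; rewrite mxE; apply/eqP.
by rewrite -normr_le0 -x0 coord_le_enorm.
Qed.

Lemma enorm_gt0 x : (0 < enorm x) = (x != 0).
Proof.
rewrite lt_neqAle enorm_ge0 andbT eq_sym; congr (~~ _).
by apply/eqP/eqP => [/enorm_eq0//|->]; exact: enorm0.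
Qed.

Lemma rsq_cont : continuous rsq.
Proof.
have h (s : seq 'I_N) : continuous (fun x : 'rV[R]_N => \sum_(i <- s) x ord0 i ^+ 2).
  elim: s => [|i s IH] x.
    rewrite (_ : (fun _ => _) = (fun=> 0)); first exact: cst_continuous.
    by apply/funext => y; rewrite big_nil.
  rewrite (_ : (fun _ => _) = (fun y => y ord0 i ^+ 2 + \sum_(j <- s) y ord0 j ^+ 2)).
    have c : {for x, continuous (fun y : 'rV[R]_N => y ord0 i)} by exact: coord_continuous.
    have c2 : {for x, continuous (fun y : 'rV[R]_N => y ord0 i ^+ 2)}.
      exact: (cont_comp c (@exprn_continuous R 2 _)).
    exact: (cont_add c2 (IH x)).
  by apply/funext => y; rewrite big_cons.
exact: h.
Qed.

Lemma enorm_cont : continuous (@enorm R N).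
Proof.
move=> x; apply: (@continuous_comp _ _ _ rsq Num.sqrt); first exact: rsq_cont.
exact: sqrt_continuous.
Qed.

Lemma near_enorm_lt x a : enorm x < a -> \forall y \near x, enorm y < a.
Proof. by move=> xa; apply: cont_lt xa; exact: enorm_cont. Qed.

Lemma near_enorm_gt x a : a < enorm x -> \forall y \near x, a < enorm y.
Proof. by move=> xa; apply: cont_gt xa; exact: enorm_cont. Qed.

Lemma line_cont x i : continuous (fun h : R => h *: e_ i + x).
Proof.
move=> h; apply: cvgD; last exact: cvg_cst.
by apply: cvgZr_tmp; exact: cvg_id.
Qed.

Lemma near_line x i (A : set 'rV[R]_N) :
  (\forall y \near x, A y) -> \forall h \near (0 : R), A (h *: e_ i + x).
Proof.
move=> xA; have := @line_cont x i 0; rewrite /continuous_at scale0r add0r; exact.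
Qed.

(** Partial derivatives are treated as ordinary derivatives along lines, so that the one-variable
    rules apply. *)
Lemma partial_line f x i d : der (fun h => f (h *: e_ i + x)) 0 d ->
  derivable f x (e_ i) /\ partial i f x = d.
Proof.
rewrite /der => h; have dv : derivable f x (e_ i) by apply/derivable1P; case: h.
split=> //; rewrite /partial -(@derive_val _ _ _ _ _ _ _ h) /derive.
congr (lim _); apply/funext => A; rewrite /=.
by under [in RHS]eq_fun do rewrite /= scale0r add0r addr0 [_ *: 1]mulr1.
Qed.

Lemma line_partial0 f x i : derivable f x (e_ i) ->
  der (fun h => f (h *: e_ i + x)) 0 (partial i f x).
Proof.
move=> /derivable1P h; have := derivableP h => h'.
have [_ E] := partial_line h'.
by rewrite /der E.
Qed.

Lemma line_partial f x i t : derivable f (t *: e_ i + x) (e_ i) ->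
  der (fun h => f (h *: e_ i + x)) t (partial i f (t *: e_ i + x)).
Proof.
move=> /line_partial0 h.
have -> : (fun h => f (h *: e_ i + x)) =
    (fun h => (fun s => f (s *: e_ i + (t *: e_ i + x))) (h - t)).
  by apply/funext => s; rewrite addrA -scalerDl subrK.
rewrite -[partial _ _ _]mulr1.
apply: (@der_comp _ (fun s => f (s *: e_ i + (t *: e_ i + x))) (fun h => h - t)).
  by rewrite subrr.
by der_calc; rewrite addr0.
Qed.

End Lines.

Section DerAux.
Context {R : realType}.
Implicit Types g k : R -> R.

Lemma der_unique g x a b : der g x a -> der g x b -> a = b.
Proof.
move=> h1 h2; rewrite -(@derive_val _ _ _ _ _ _ _ h1).
exact: (@derive_val _ _ _ _ _ _ _ h2).
Qed.

(** Only continuity of k at 0 is required; this yields the second partials at the origin from a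
    gradient of the form q(|x|) x_i. *)
Lemma der_mul_id k : {for 0, continuous k} -> der (fun h => k h * h) 0 (k 0).
Proof.
move=> kc.
have cv : h^-1 *: (((fun h => k h * h) \o shift 0) (h *: 1) - k 0 * 0) @[h --> 0^'] --> k 0.
  have c : k h @[h --> 0^'] --> k 0 by apply: cvg_trans kc; apply: cvg_app; exact: cvg_within.
  apply: cvg_trans c; apply: near_eq_cvg; near=> h.
  have h0 : h != 0 by near: h; exact: nbhs_dnbhs_neq.
  by rewrite /= addr0 mulr0 subr0 [h *: 1]mulr1 /GRing.scale /= mulrC mulfK.
constructor; first by apply/cvg_ex; exists (k 0); exact: cv.
by apply/cvg_lim => //; exact: cv.
Unshelve. all: by end_near. Qed.

Lemma der_sq g C e : 0 < e -> (forall h, `|h| < e -> `|g h - g 0| <= C * h ^+ 2) ->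
  der g 0 0.
Proof.
move=> e0 hg; pose k h := (g h - g 0) / h.
have k0 : k 0 = 0 by rewrite /k invr0 mulr0.
have kc : {for 0, continuous k}.
  rewrite /prop_for /continuous_at k0; apply/cvgrPdist_lt => d d0; near=> h.
  rewrite sub0r normrN /k; have [->|h0] := eqVneq h 0; first by rewrite invr0 mulr0 normr0.
  have he : `|h| < e by near: h; apply: cvgr0_norm_lt => //; exact: cvg_id.
  rewrite normrM normfV ltr_pdivrMr ?normr_gt0//.
  apply: le_lt_trans (hg _ he) _; rewrite -real_normK ?num_real// expr2 mulrA.
  rewrite ltr_pM2r ?normr_gt0//; apply: (@le_lt_trans _ _ (`|C| * `|h|)).
    by rewrite ler_wpM2r// ler_norm.
  have C1 : 0 < `|C| + 1 by rewrite ltr_wpDl.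
  have hd : `|h| < d / (`|C| + 1).
    by near: h; apply: cvgr0_norm_lt; [exact: cvg_id|rewrite divr_gt0].
  apply: (@le_lt_trans _ _ ((`|C| + 1) * `|h|)); first by rewrite ler_wpM2r// lerDl.
  by rewrite mulrC -ltr_pdivlMr.
have h1 := der_mul_id kc; rewrite k0 in h1.
have -> : g = (fun h => k h * h + g 0).
  apply/funext => h; rewrite /k; have [->|h0] := eqVneq h 0; first by rewrite mulr0 add0r.
  by rewrite divfK// subrK.
by apply: der_eq; [apply: (@derD _ (fun h => k h * h)); [exact: h1|exact: der_cst]|rewrite addr0].
Unshelve. all: by end_near. Qed.

End DerAux.

Section Radial.
Context {R : realType} {N : nat}.
Variables (u u1 u2 : R -> R).
Implicit Types (x y : 'rV[R]_N) (i j : 'I_N).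

Local Notation e_ i := (delta_mx ord0 i : 'rV[R]_N).
Let f x : R := u (enorm x).

Hypothesis du : forall r, 0 < r < 1 -> der u r (u1 r).
Hypothesis du1 : forall r, 0 < r < 1 -> der u1 r (u2 r).
Hypothesis u2c : forall r, 0 < r < 1 -> {for r, continuous u2}.

Lemma line_coord x i j h : (h *: e_ j + x) ord0 i = h * (i == j)%:R + x ord0 i.
Proof. by rewrite !mxE eqxx. Qed.

Lemma der_enorm_line x i : 0 < enorm x ->
  der (fun h => enorm (h *: e_ i + x)) 0 (x ord0 i / enorm x).
Proof.
move=> x0; have r0 : 0 < rsq x by rewrite -enorm_sqr exprn_gt0.
have -> : (fun h => enorm (h *: e_ i + x)) =
    (fun h => Num.sqrt (rsq x + 2 * h * x ord0 i + h ^+ 2)).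
  by apply/funext => h; rewrite enorm_line.
have E : rsq x + 2 * 0 * x ord0 i + 0 ^+ 2 = rsq x.
  by rewrite expr0n mulr0 mul0r !addr0.
apply: der_eq.
  apply: (@der_sqrt _ (fun h => rsq x + 2 * h * x ord0 i + h ^+ 2)); first by rewrite E.
  by der_auto.
cbv beta; rewrite E -enormE; have xn : enorm x != 0 by rewrite gt_eqF.
by rewrite /= expr1; field.
Qed.

Lemma radial_partial x i d : 0 < enorm x -> der u (enorm x) d ->
  derivable f x (e_ i) /\ partial i f x = d * (x ord0 i / enorm x).
Proof.
move=> x0 ud; apply: partial_line.
apply: (@der_comp _ u (fun h => enorm (h *: e_ i + x))); last exact: der_enorm_line.
by rewrite scale0r add0r.
Qed.

Definition annulus : set 'rV[R]_N := punctured_unit_ball R N.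

Lemma annulus_near x : annulus x -> \forall y \near x, annulus y.
Proof.
move=> /andP[x0 x1]; have h1 := near_enorm_gt x0; have h2 := near_enorm_lt x1.
apply: filterS2 h1 h2 => y y0 y1; exact/andP.
Qed.

(** Gradient and Hessian entries of u(|x|) away from 0. *)
Let G i y : R := u1 (enorm y) / enorm y * y ord0 i.
Let H i j y : R := (u2 (enorm y) - u1 (enorm y) / enorm y) * (y ord0 i * y ord0 j / enorm y ^+ 2)
  + u1 (enorm y) / enorm y * (i == j)%:R.

Lemma annulus_partial x i : annulus x -> derivable f x (e_ i) /\ partial i f x = G i x.
Proof.
move=> /[dup] ax /andP[x0 x1]; have [h ->] := radial_partial i x0 (du ax).
by split=> //; rewrite /G mulrA mulrAC.
Qed.

Lemma der_G x i j : annulus x -> der (fun h => G i (h *: e_ j + x)) 0 (H i j x).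
Proof.
move=> /[dup] ax /andP[x0 x1]; have h1 := der_enorm_line j x0.
have xn : enorm x != 0 by rewrite gt_eqF.
have h2 : der (fun h => u1 (enorm (h *: e_ j + x))) 0 (u2 (enorm x) * (x ord0 j / enorm x)).
  apply: (@der_comp _ u1 (fun h => enorm (h *: e_ j + x))) => //.
  by rewrite scale0r add0r; exact: du1.
have h3 : der (fun h => (h *: e_ j + x) ord0 i) 0 (i == j)%:R.
  have -> : (fun h => (h *: e_ j + x) ord0 i) = (fun h => h * (i == j)%:R + x ord0 i).
    by apply/funext => h; rewrite line_coord.
  by der_calc; ring.
have z : 0 *: e_ j + x = x by rewrite scale0r add0r.
apply: der_eq.
  apply: (@derM _ (fun h => u1 (enorm (h *: e_ j + x)) / enorm (h *: e_ j + x))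
    (fun h => (h *: e_ j + x) ord0 i)); last exact: h3.
  apply: (@derM _ (fun h => u1 (enorm (h *: e_ j + x)))
     (fun h => (enorm (h *: e_ j + x))^-1)); first exact: h2.
  by apply: (@derV _ (fun h => enorm (h *: e_ j + x))); [rewrite z|exact: h1].
cbv beta; rewrite z /H.
by field.
Qed.

Lemma annulus_partial2 x i j : annulus x ->
  derivable (partial i f) x (e_ j) /\ partial j (partial i f) x = H i j x.
Proof.
move=> ax; apply: partial_line; apply: der_near (der_G i j ax).
have := near_line j (annulus_near ax); apply: filterS => h ah.
by have [_ ->] := annulus_partial i ah.
Qed.

Let enc x : {for x, continuous (@enorm R N)} := @enorm_cont R N x.

Let coc x i : {for x, continuous (fun y : 'rV[R]_N => y ord0 i)}.
Proof. exact: coord_continuous. Qed.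

Let u1q_cont x : annulus x -> {for x, continuous (fun y => u1 (enorm y) / enorm y)}.
Proof.
move=> /[dup] ax /andP[x0 x1]; have xn : enorm x != 0 by rewrite gt_eqF.
exact: (cont_mul (cont_comp (@enc x) (der_cont (du1 ax))) (cont_inv xn (@enc x))).
Qed.

Let G_cont x i : annulus x -> {for x, continuous (G i)}.
Proof. by move=> ax; have h := cont_mul (u1q_cont ax) (@coc x i); exact: h. Qed.

Let H_cont x i j : annulus x -> {for x, continuous (H i j)}.
Proof.
move=> /[dup] ax /andP[x0 x1].
have c1 : {for x, continuous (fun y => u2 (enorm y))} by exact: (cont_comp (@enc x) (u2c ax)).
have c2 : {for x, continuous (fun y => - (u1 (enorm y) / enorm y))}.
  have h := cont_mul (@cont_cst R _ (-1) x) (u1q_cont ax).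
  by rewrite (_ : (fun _ => _) = (fun y => -1 * (u1 (enorm y) / enorm y))) //; apply/funext => y; rewrite mulN1r.
have c3 : {for x, continuous (fun y => y ord0 i * y ord0 j / enorm y ^+ 2)}.
  have xn : enorm x ^+ 2 != 0 by rewrite expf_neq0// gt_eqF.
  have h1 := cont_mul (@coc x i) (@coc x j).
  have h2 := cont_comp (@enc x) (@exprn_continuous R 2 (enorm x)).
  have h3 := @cont_inv R _ (fun y : 'rV[R]_N => enorm y ^+ 2) x xn h2.
  have h4 := cont_mul h1 h3.
  exact: h4.
have h := cont_add (cont_mul (cont_add c1 c2) c3) (cont_mul (u1q_cont ax) (@cont_cst R _ (i == j)%:R x)).
exact: h.
Qed.

Lemma annulus_partial_cont x i : annulus x -> {for x, continuous (partial i f)}.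
Proof.
move=> ax; have E y : annulus y -> partial i f y = G i y.
  by move=> ay; have [_ ->] := annulus_partial i ay.
have c := cont_near (annulus_near ax) E (@G_cont x i ax).
exact: c.
Qed.

Lemma annulus_partial2_cont x i j : annulus x ->
  {for x, continuous (partial j (partial i f))}.
Proof.
move=> ax; have E y : annulus y -> partial j (partial i f) y = H i j y.
  by move=> ay; have [_ ->] := annulus_partial2 i j ay.
have c := cont_near (annulus_near ax) E (@H_cont x i j ax).
exact: c.
Qed.

Lemma radial_C2_annulus : C2_on (punctured_unit_ball R N) f.
Proof.
split=> [i x ax|i j x ax]; split.
- by have [] := annulus_partial i ax.
- exact: annulus_partial_cont.
- by have [] := annulus_partial2 i j ax.
- exact: annulus_partial2_cont.
Qed.

Lemma sum_sqr_coord x : 0 < enorm x -> \sum_(i < N) (x ord0 i * x ord0 i / enorm x ^+ 2) = 1.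
Proof.
move=> x0; rewrite -mulr_suml; have -> : \sum_(i < N) x ord0 i * x ord0 i = rsq x.
  by apply: eq_bigr => i _; rewrite expr2.
by rewrite -enorm_sqr divff// expf_neq0// gt_eqF.
Qed.

Lemma annulus_laplacian x : annulus x ->
  laplacian f x = u2 (enorm x) - u1 (enorm x) / enorm x + u1 (enorm x) / enorm x * N%:R.
Proof.
move=> /[dup] ax /andP[x0 x1]; rewrite /laplacian.
rewrite (eq_bigr (fun i => (u2 (enorm x) - u1 (enorm x) / enorm x) *
  (x ord0 i * x ord0 i / enorm x ^+ 2) + u1 (enorm x) / enorm x)).
  rewrite big_split /= -mulr_sumr sum_sqr_coord// mulr1 sumr_const card_ord.
  by rewrite mulr_natr.
by move=> i _; have [_ ->] := annulus_partial2 i i ax; rewrite /H eqxx mulr1.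
Qed.

Lemma annulus_grad x : annulus x -> sqr_norm_grad f x = u1 (enorm x) ^+ 2.
Proof.
move=> /[dup] ax /andP[x0 x1]; rewrite /sqr_norm_grad.
rewrite (eq_bigr (fun i => u1 (enorm x) ^+ 2 * (x ord0 i * x ord0 i / enorm x ^+ 2))).
  by rewrite -mulr_sumr sum_sqr_coord// mulr1.
move=> i _; have [_ ->] := annulus_partial i ax; rewrite /G.
have xn : enorm x != 0 by rewrite gt_eqF.
by field.
Qed.

(** * Extension of the derivatives of a radial function to the origin *)

Section Origin.
Variable p0 : R.
Hypothesis u0c : {for 0, continuous u}.
Hypothesis u1_lim : u1 r / r @[r --> 0^'+] --> p0.
Hypothesis u2_lim : u2 r @[r --> 0^'+] --> p0.

(** Continuous extensions of u' / r and u'' - u' / r. As u' / r and u'' have the same limit p0, k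
    vanishes at 0 and the Hessian there is p0 times the identity. *)
Let q r : R := if r <= 0 then p0 else u1 r / r.
Let k r : R := if r <= 0 then 0 else u2 r - u1 r / r.

Let ext_cont (g : R -> R) (l : R) : g r @[r --> (0 : R)^'+] --> l ->
  {for (0 : R), continuous (fun r : R => if r <= 0 then l else g r)}.
Proof.
move=> gl; rewrite /prop_for /continuous_at lexx; apply/cvgrPdist_lt => e e0.
move/cvgrPdist_lt : gl => /(_ e e0); rewrite near_withinE; apply: filterS => r hr.
case: ifPn => [_|]; first by rewrite subrr normr0.
by rewrite -ltNge => r0; exact: hr.
Qed.

Let q_cont : {for 0, continuous q}. Proof. exact: ext_cont. Qed.

Let k_cont : {for 0, continuous k}.
Proof.
have h : u2 r - u1 r / r @[r --> (0 : R)^'+] --> p0 - p0 by apply: cvgB.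
by rewrite subrr in h; exact: (ext_cont h).
Qed.

Let u_quad : exists C e, [/\ 0 < e, e < 1 & forall r, 0 <= r < e -> `|u r - u 0| <= C * r ^+ 2].
Proof.
have : \forall r \near (0:R)^'+, `|p0 - u1 r / r| < 1 by move/cvgrPdist_lt : u1_lim; apply.
rewrite near_withinE => /nbhs_ballP[e /= e0 he].
pose d := Num.min e 2^-1; have d0 : 0 < d by rewrite lt_min e0; lra.
have de : d <= e by rewrite ge_min lexx.
have d1 : d <= 2^-1 by rewrite ge_min lexx orbT.
exists (`|p0| + 1), d; split=> //; first by lra.
move=> r /andP[]; rewrite le_eqVlt => /predU1P[<- _|r0 rd].
  by rewrite subrr normr0 expr0n mulr0.
have du' (x : R) : x \in `]0, r[ -> is_derive x 1 u (u1 x).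
  by rewrite in_itv /= => /andP[x0 xr]; apply: du; rewrite x0 /=; lra.
have uc : {within `[0, r], continuous u}.
  apply: continuous_in_subspaceT => x; rewrite inE /= in_itv /= => /andP[].
  rewrite le_eqVlt => /predU1P[<- _|x0 xr]; first exact: u0c.
  by apply: der_cont (du _); rewrite x0 /=; lra.
have [c] := MVT r0 du' uc.
rewrite in_itv /= => /andP[c0 cr] ->.
have : `|p0 - u1 c / c| < 1.
  by apply: he => //; rewrite /ball /= sub0r normrN gtr0_norm//; lra.
move=> h; have : `|u1 c / c| <= `|p0| + 1.
  have -> : u1 c / c = p0 - (p0 - u1 c / c) by ring.
  by apply: le_trans (ler_normB _ _) _; rewrite lerD2l ltW.
rewrite normrM normfV (gtr0_norm c0) ler_pdivrMr// => h2.
rewrite subr0 normrM (gtr0_norm r0) expr2 mulrA ler_pM2r//.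
by apply: le_trans h2 _; rewrite ler_wpM2l ?(ltW cr).
Qed.

Let ball x := unit_ball R N x.

Let Gq i y : R := q (enorm y) * y ord0 i.
Let Hq i j y : R := k (enorm y) * (y ord0 i * y ord0 j / enorm y ^+ 2) + q (enorm y) * (i == j)%:R.

Let ball_near x : ball x -> \forall y \near x, ball y.
Proof. exact: near_enorm_lt. Qed.

Let ballP x : ball x -> x = 0 \/ annulus x.
Proof.
move=> bx; have [->|x0] := eqVneq x 0; first by left.
by right; apply/andP; rewrite enorm_gt0.
Qed.

Let qE y : annulus y -> q (enorm y) = u1 (enorm y) / enorm y.
Proof. by move=> /andP[y0 _]; rewrite /q leNgt y0. Qed.

Let kE y : annulus y -> k (enorm y) = u2 (enorm y) - u1 (enorm y) / enorm y.
Proof. by move=> /andP[y0 _]; rewrite /k leNgt y0. Qed.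

Let q0 : q 0 = p0. Proof. by rewrite /q lexx. Qed.
Let k0 : k 0 = 0. Proof. by rewrite /k lexx. Qed.

Lemma ball_partial x i : ball x -> derivable f x (e_ i) /\ partial i f x = Gq i x.
Proof.
move=> /ballP[->|ax]; last by rewrite /Gq qE//; exact: annulus_partial.
apply: partial_line; rewrite /Gq mxE mulr0.
have [C [e [e0 e1 hC]]] := u_quad.
apply: (@der_sq _ _ C e) => // h he.
rewrite scale0r !addr0 /f enorm0 enorm_axis_norm -(real_normK (num_real h)).
by apply: hC; rewrite normr_ge0.
Qed.

Lemma ball_partial2 x i j : ball x ->
  derivable (partial i f) x (e_ j) /\ partial j (partial i f) x = Hq i j x.
Proof.
move=> /[dup] bx /ballP[x0|ax]; last by rewrite /Hq qE// kE//; exact: annulus_partial2.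
apply: partial_line; rewrite x0 in bx *.
have kc : {for (0 : R), continuous (fun h : R => q `|h| * (i == j)%:R)}.
  have nc : {for (0 : R), continuous (fun h : R => `|h|)} by exact: norm_continuous.
  have qc : {for `|0 : R|, continuous q} by rewrite normr0.
  have h := cont_mul (cont_comp nc qc) (@cont_cst R _ (i == j)%:R (0 : R)).
  exact: h.
have := der_mul_id kc; rewrite normr0.
have -> : Hq i j 0 = q 0 * (i == j)%:R by rewrite /Hq enorm0 k0 mul0r add0r.
apply: der_near; have := near_line j (ball_near bx); apply: filterS => h bh.
have [_ ->] := ball_partial i bh; rewrite /Gq line_coord mxE.
by rewrite !addr0 enorm_axis_norm -mulrA [_ * h]mulrC.
Qed.

Let Gq_cont0 i : {for 0, continuous (Gq i)}.
Proof.
have qc : {for enorm (0 : 'rV[R]_N), continuous q} by rewrite enorm0.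
have h := cont_mul (cont_comp (@enc (0 : 'rV[R]_N)) qc) (@coc (0 : 'rV[R]_N) i); exact: h.
Qed.

Let Hq_cont0 i j : {for 0, continuous (Hq i j)}.
Proof.
have qc : {for enorm (0 : 'rV[R]_N), continuous q} by rewrite enorm0.
have kc0 : {for enorm (0 : 'rV[R]_N), continuous k} by rewrite enorm0.
have kc := cont_comp (@enc (0 : 'rV[R]_N)) kc0.
(* x_i x_j / |x|^2 has no limit at 0 in general, but it is bounded by 1, and its coefficient k tends
   to 0. *)
suff h : {for (0 : 'rV[R]_N), continuous
    (fun y => k (enorm y) * (y ord0 i * y ord0 j / enorm y ^+ 2))}.
  have h' := cont_add h (cont_mul (cont_comp (@enc (0 : 'rV[R]_N)) qc) (@cont_cst R _ (i == j)%:R (0 : 'rV[R]_N))).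
  exact: h'.
have h0 : (fun y : 'rV[R]_N => k (enorm y)) 0 = 0 by rewrite /= enorm0 k0.
pose g (y : 'rV[R]_N) := k (enorm y) * (y ord0 i * y ord0 j / enorm y ^+ 2).
have g0 : g 0 = 0 by rewrite /g enorm0 k0 mul0r.
suff gle y : `|g y| <= `|k (enorm y)|.
  have c := @cont_squeeze0 R _ (fun y : 'rV[R]_N => k (enorm y)) g 0 h0 g0 gle kc; exact: c.
rewrite /g normrM -[leRHS]mulr1.
rewrite ler_wpM2l// (normrM (_ * _)) normfV (normrM (y ord0 i)).
rewrite (ger0_norm (exprn_ge0 2 (enorm_ge0 y))).
have [y0|y0] := eqVneq (enorm y) 0; first by rewrite y0 expr0n /= invr0 mulr0.
have yp : 0 < enorm y by rewrite lt_neqAle eq_sym y0 enorm_ge0.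
rewrite ler_pdivrMr ?exprn_gt0// mul1r expr2.
by apply: ler_pM => //; exact: coord_le_enorm.
Qed.

Lemma radial_C2_ball : C2_on (unit_ball R N) f.
Proof.
have nb i z : ball z -> partial i f z = Gq i z by move=> bz; have [_ ->] := ball_partial i bz.
have nb2 i j z : ball z -> partial j (partial i f) z = Hq i j z.
  by move=> bz; have [_ ->] := ball_partial2 i j bz.
split=> [i x bx|i j x bx]; split.
- by have [] := ball_partial i bx.
- have [x0|ax] := ballP bx; last exact: annulus_partial_cont.
  rewrite x0 in bx *; have c := cont_near (ball_near bx) (nb i) (@Gq_cont0 i); exact: c.
- by have [] := ball_partial2 i j bx.
- have [x0|ax] := ballP bx; last exact: annulus_partial2_cont.
  rewrite x0 in bx *; have c := cont_near (ball_near bx) (nb2 i j) (@Hq_cont0 i j); exact: c.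
Qed.

Lemma ball_laplacian0 : laplacian f 0 = p0 * N%:R.
Proof.
have b0 : ball 0 by rewrite /ball /unit_ball /= enorm0.
rewrite /laplacian (eq_bigr (fun=> p0)); first by rewrite sumr_const card_ord mulr_natr.
move=> i _; have [_ ->] := ball_partial2 i i b0.
by rewrite /Hq enorm0 k0 mul0r add0r eqxx mulr1 q0.
Qed.

Lemma ball_grad0 : sqr_norm_grad f 0 = 0.
Proof.
have b0 : ball 0 by rewrite /ball /unit_ball /= enorm0.
apply: big1 => i _; have [_ ->] := ball_partial i b0.
by rewrite /Gq mxE mulr0 expr0n.
Qed.

End Origin.
End Radial.

(** * Classical solutions and the radial equation *)

Section FromOrbit.
Context {R : realType}.
Variables (n : nat) (delta : R) (J P : R -> R).
Hypothesis delta0 : 0 < delta.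
Hypothesis pot : radial_potential n (fun s => Ksrc delta (P s)) J P.
Variable s : R.
Hypothesis s0 : 0 < s.
Hypothesis gs : shoot_dom delta P s.

Let W := shoot delta P.
Let W1 := shoot1 n delta J P.
Let W2 := shoot2 n delta J P.

Definition orbit_w r := W (s * r) / W s.
Definition orbit_w1 r := s * W1 (s * r) / W s.
Definition orbit_w2 r := s ^+ 2 * W2 (s * r) / W s.

Let Ws0 : 0 < W s. Proof. exact: shoot_gt0. Qed.

Let good_sr r : r <= 1 -> shoot_dom delta P (s * r).
Proof. by move=> r1; apply: (shoot_dom_le delta0 pot gs); rewrite ler_piMr// ltW. Qed.

Let dsr r : der (fun r => s * r) r s.
Proof. by der_calc; ring. Qed.

Lemma orbit_ode : radial_ode n delta (vlam delta P s) orbit_w orbit_w1 orbit_w2.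
Proof.
move=> r /andP[r0 r1]; have g := good_sr (ltW r1); have sr0 : 0 < s * r by rewrite mulr_gt0.
have wn : W s != 0 by rewrite gt_eqF.
split.
- apply/andP; split; first by rewrite /orbit_w divr_gt0// shoot_gt0.
  rewrite /orbit_w ltr_pdivrMr// mul1r; apply: (shoot_lt delta0 pot) => //; first exact: ltW.
  by rewrite gtr_pMr.
- rewrite /orbit_w /orbit_w1.
  have h : der (fun r => W (s * r)) r (W1 (s * r) * s).
    by apply: (@der_comp _ W (fun r => s * r)) => //; exact: der_shoot.
  by der_calc; ring.
- rewrite /orbit_w1 /orbit_w2.
  have h : der (fun r => W1 (s * r)) r (W2 (s * r) * s).
    by apply: (@der_comp _ W1 (fun r => s * r)) => //; exact: der_shoot1.
  by der_calc; ring.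
- have w'n : W (s * r) != 0 by rewrite gt_eqF// shoot_gt0.
  rewrite /orbit_w /orbit_w1 /orbit_w2 /vlam /W2 /shoot2 -/W -/W1.
  by field; rewrite ?gt_eqF// ?shoot_gt0.
Qed.

Let scale_right : s * r @[r --> (0 : R)^'+] --> (0 : R)^'+.
Proof.
move=> A; rewrite /at_right /= !nbhs_simpl /within /= => /nbhs_ballP[e /= e0 he].
apply/nbhs_ballP; exists (e / s); first by rewrite /= divr_gt0.
move=> r /=; rewrite /ball /= sub0r normrN => re r0.
apply: he; last by rewrite mulr_gt0.
by rewrite /ball /= sub0r normrN normrM (gtr0_norm s0) mulrC -ltr_pdivlMr.
Qed.

Let u r := 1 - orbit_w r.
Let p0 := - (s ^+ 2 / W s * n.+2%:R^-1).

Let u1_lim : - orbit_w1 r / r @[r --> 0^'+] --> p0.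
Proof.
have h : - (s ^+ 2 / W s) * (W1 (s * r) / (s * r)) @[r --> (0:R)^'+] -->
    - (s ^+ 2 / W s) * n.+2%:R^-1.
  apply: cvgM; first exact: cvg_cst.
  exact: cvg_comp scale_right (shoot1_lim delta0 pot).
rewrite /p0 -mulNr; apply: cvg_trans h; apply: near_eq_cvg; near=> r.
have r0 : 0 < r by near: r; exact: nbhs_right_gt.
by rewrite /orbit_w1; field; rewrite !gt_eqF.
Unshelve. all: by end_near. Qed.

Let u2_lim : - orbit_w2 r @[r --> 0^'+] --> p0.
Proof.
have h : - (s ^+ 2 / W s) * W2 (s * r) @[r --> (0:R)^'+] -->
    - (s ^+ 2 / W s) * n.+2%:R^-1.
  apply: cvgM; first exact: cvg_cst.
  exact: cvg_comp scale_right (shoot2_lim delta0 pot).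
rewrite /p0 -mulNr; apply: cvg_trans h; apply: near_eq_cvg; near=> r.
by rewrite /orbit_w2; field; rewrite !gt_eqF.
Unshelve. all: by end_near. Qed.

Let sr_cont r : {for r, continuous (fun r => s * r)}.
Proof. by have h := dsr r; exact: der_cont h. Qed.

Let ow_cont r : r <= 1 -> {for r, continuous orbit_w}.
Proof.
move=> r1; have h1 := cont_comp (@sr_cont r) (shoot_cont pot (good_sr r1)).
have h := cont_mul h1 (@cont_cst R _ (W s)^-1 r); exact: h.
Qed.

Lemma orbit_w1_cont r : 0 < r <= 1 -> {for r, continuous orbit_w1}.
Proof.
move=> /andP[r0 r1]; have sr0 : 0 < s * r by rewrite mulr_gt0.
have h1 := cont_comp (@sr_cont r) (der_cont (der_shoot1 delta0 pot sr0 (good_sr r1))).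
have h := cont_mul (cont_mul (@cont_cst R _ s r) h1) (@cont_cst R _ (W s)^-1 r).
exact: h.
Qed.

Let u_cont r : r <= 1 -> {for r, continuous u}.
Proof.
move=> r1; have h := cont_add (@cont_cst R _ 1 r) (cont_mul (@cont_cst R _ (-1) r) (ow_cont r1)).
have -> : u = (fun y => 1 + -1 * orbit_w y) by apply/funext => y; rewrite /u mulN1r.
exact: h.
Qed.

Let u2_cont r : 0 < r < 1 -> {for r, continuous (fun r => - orbit_w2 r)}.
Proof.
move=> /andP[r0 r1]; have sr0 : 0 < s * r by rewrite mulr_gt0.
have g := good_sr (ltW r1).
have c1 : {for s * r, continuous W1} by exact: der_cont (der_shoot1 delta0 pot sr0 g).
have wn : W (s * r) != 0 by rewrite gt_eqF// shoot_gt0.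
have c2 := cont_inv wn (shoot_cont pot g).
have sn : s * r != 0 by rewrite gt_eqF.
have idc : {for s * r, continuous (fun x : R => x)} by exact: (der_cont (der_id (s * r))).
have ci := @cont_inv R _ (fun x : R => x) (s * r) sn idc.
have c3 := cont_mul (cont_mul (@cont_cst R _ (- n.+1%:R) (s * r)) ci) c1.
have c4 := cont_mul (cont_add (@cont_cst R _ 1 (s * r))
  (cont_mul (@cont_cst R _ delta (s * r)) (cont_mul c1 c1))) c2.
have c5 := cont_add c4 c3.
have c6 : {for s * r, continuous W2}.
  have -> : W2 = (fun y => (1 + delta * (W1 y * W1 y)) * (W y)^-1 + - n.+1%:R * y^-1 * W1 y).
    by apply/funext => y; rewrite /W2 /shoot2 -/W -/W1 expr2 !mulNr.
  exact: c5.
have c7 := cont_comp (@sr_cont r) c6.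
have c8 := cont_mul (cont_mul (@cont_cst R _ (- s ^+ 2) r) c7) (@cont_cst R _ (W s)^-1 r).
have -> : (fun r => - orbit_w2 r) = (fun y => - s ^+ 2 * W2 (s * y) * (W s)^-1).
  by apply/funext => y; rewrite /orbit_w2 !mulNr.
exact: c8.
Qed.

Lemma orbit_w0 : orbit_w 0 = (W s)^-1.
Proof. by rewrite /orbit_w mulr0 /W (shoot_zero pot)// div1r. Qed.

Lemma orbit_w_1 : orbit_w 1 = 1.
Proof. by rewrite /orbit_w mulr1 divff// gt_eqF. Qed.

Definition orbit_U (x : 'rV[R]_n.+2) := 1 - orbit_w (enorm x).

Theorem orbit_regular : regular_solution delta (vlam delta P s) orbit_U.
Proof.
have du r : 0 < r < 1 -> der u r (- orbit_w1 r).
  by move=> r01; have [_ h _ _] := orbit_ode r01; rewrite /u; der_calc; rewrite add0r.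
have du1 r : 0 < r < 1 -> der (fun r => - orbit_w1 r) r (- orbit_w2 r).
  by move=> r01; have [_ _ h _] := orbit_ode r01; exact: derN h.
have u0c : {for 0, continuous u} by exact: u_cont.
split.
- by exists u.
- have Uc x : enorm x <= 1 -> {for x, continuous orbit_U}.
    by move=> x1; have h := cont_comp (@enorm_cont R n.+2 x) (u_cont x1); exact: h.
  by apply: continuous_in_subspaceT => x; rewrite inE; exact: Uc.
- exact: (radial_C2_ball du du1 u2_cont u0c u1_lim u2_lim).
- move=> x x1; have [->|xn] := eqVneq x 0.
    have W1' : 1 < W s.
      by have := shoot_lt delta0 pot (lexx 0) s0 gs; rewrite (shoot_zero pot).
    split.
      rewrite /orbit_U enorm0 orbit_w0 subr_gt0 invf_lt1// W1' /=.
      by rewrite gtrBl invr_gt0.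
    have -> : laplacian orbit_U 0 = p0 * n.+2%:R := ball_laplacian0 du du1 u0c u1_lim.
    have -> : sqr_norm_grad orbit_U 0 = 0 := ball_grad0 du u0c u1_lim.
    rewrite /orbit_U enorm0 orbit_w0 mulr0 addr0.
    rewrite /p0 /vlam -/W; have -> : 1 - (1 - (W s)^-1) = (W s)^-1 by ring.
    by field; rewrite !gt_eqF// ltr0n.
  have ax : annulus x by apply/andP; rewrite enorm_gt0.
  have [/andP[w0 w1] _ _ E] := orbit_ode ax.
  split; first by rewrite /orbit_U subr_gt0 w1 gtrBl.
  have -> : laplacian orbit_U x = _ := annulus_laplacian du du1 ax.
  have -> : sqr_norm_grad orbit_U x = _ := annulus_grad du ax.
  rewrite sqrrN; have -> : 1 - orbit_U x = orbit_w (enorm x) by rewrite /orbit_U; ring.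
  rewrite -E -(natr1 n.+1); move: ax => /andP[x0 _].
  by field; rewrite gt_eqF.
- by move=> x x1; rewrite /orbit_U x1 orbit_w_1 subrr.
Qed.

End FromOrbit.

Section Cone.
Context {R : realType}.
Variables (n : nat) (delta : R).

(** For w = r the radial equation reads (n+1) / r = (lam + delta) / r. *)
Theorem cone_singular : 0 < n.+1%:R - delta ->
  singular_solution delta (n.+1%:R - delta) (fun x : 'rV[R]_n.+2 => 1 - enorm x).
Proof.
move=> l0; pose u (r : R) := 1 - r.
have du (r : R) : 0 < r < 1 -> der u r ((fun=> -1) r).
  by move=> _; rewrite /u; der_calc; rewrite add0r.
have du1 (r : R) : 0 < r < 1 -> der (fun=> -1) r ((fun=> 0) r) by move=> _; exact: der_cst.
have u2c (r : R) : 0 < r < 1 -> {for r, continuous (fun=> 0 : R)} by move=> _; exact: cont_cst.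
have uc (r : R) : {for r, continuous u}.
  by apply: der_cont (_ : der u r (-1)); rewrite /u; der_calc; rewrite add0r.
split; last by rewrite enorm0 subr0.
split.
- by exists u.
- apply: continuous_subspaceT => x.
  have h := cont_comp (@enorm_cont R n.+2 x) (uc (enorm x)); exact: h.
- exact: (radial_C2_annulus du du1 u2c).
- move=> x ax; have /andP[x0 x1] := ax; split.
    by rewrite subr_gt0 x1 gtrBl.
  rewrite (annulus_laplacian du du1 ax) (annulus_grad du ax) sqrrN expr1n mulr1.
  rewrite (_ : 1 - (1 - enorm x) = enorm x); last by ring.
  by rewrite -(natr1 n.+1); field; rewrite gt_eqF.
- by move=> x x1; rewrite x1 subrr.
Qed.

End Cone.

(** * From a radial solution to the equation of its profile along an axis *)

Section ToODE.
Context {R : realType}.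
Variables (n : nat) (delta lam : R) (V : 'rV[R]_n.+2 -> R).
Hypothesis sol : radial_solution_on delta (punctured_unit_ball R n.+2) lam V.

Local Notation e_ i := (delta_mx ord0 i : 'rV[R]_n.+2).

Definition profile (r : R) : R := 1 - V (r *: e_ ord0).

Definition profile1 r := - partial ord0 V (r *: e_ ord0).
Definition profile2 r := - partial ord0 (partial ord0 V) (r *: e_ ord0).

Local Notation w := profile.
Local Notation w1 := profile1.
Local Notation w2 := profile2.

Lemma solution_radial x : closed_unit_ball R n.+2 x -> V x = 1 - w (enorm x).
Proof.
move=> x1; case: sol => -[v hv] _ _ _ _; rewrite /profile subKr.
have e1 : enorm (enorm x *: e_ ord0) = enorm x by rewrite enorm_axis// enorm_ge0.
by rewrite hv// hv /closed_unit_ball /= ?e1.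
Qed.

Let ax_annulus r i : 0 < r < 1 -> punctured_unit_ball R n.+2 (r *: e_ i).
Proof. by move=> /andP[r0 r1]; rewrite /punctured_unit_ball /= enorm_axis ?(ltW r0)// r0. Qed.


Let axis0 (f : 'rV[R]_n.+2 -> R) : (fun h => f (h *: e_ ord0)) = (fun h => f (h *: e_ ord0 + 0)).
Proof. by apply/funext => h; rewrite addr0. Qed.

Let dV r : 0 < r < 1 -> der (fun h => V (h *: e_ ord0)) r (partial ord0 V (r *: e_ ord0)).
Proof.
move=> r01; have [_ _ [C1 _] _ _] := sol; have [h _] := C1 ord0 _ (ax_annulus ord0 r01).
rewrite (axis0 V) -[r *: _]addr0; apply: line_partial; rewrite addr0; exact: h.
Qed.

Let dV1 r : 0 < r < 1 -> der (fun h => partial ord0 V (h *: e_ ord0)) r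
  (partial ord0 (partial ord0 V) (r *: e_ ord0)).
Proof.
move=> r01; have [_ _ [_ C2] _ _] := sol.
have [h _] := C2 ord0 ord0 _ (ax_annulus ord0 r01).
rewrite (axis0 (partial ord0 V)) -[r *: _]addr0; apply: line_partial; rewrite addr0; exact: h.
Qed.

Let dw r : 0 < r < 1 -> der w r (w1 r).
Proof. by move=> r01; have h := dV r01; rewrite /profile; der_calc; rewrite add0r. Qed.

Let dw1 r : 0 < r < 1 -> der w1 r (w2 r).
Proof. by move=> r01; have h := dV1 r01; exact: derN h. Qed.

(* On the axis, for a transversal direction, V is u(sqrt(r^2 + h^2)). *)
Let trans r i h : 0 < r -> enorm (h *: e_ i + r *: e_ ord0) < 1 -> i != ord0 ->
  0 < enorm (h *: e_ i + r *: e_ ord0) ->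
  partial i V (h *: e_ i + r *: e_ ord0) =
   - w1 (enorm (h *: e_ i + r *: e_ ord0)) * (h / enorm (h *: e_ i + r *: e_ ord0)).
Proof.
move=> r0 x1 i0 x0; set x := h *: e_ i + r *: e_ ord0 in x0 x1 *.
have ax : punctured_unit_ball R n.+2 x by apply/andP.
have du : der (fun r => 1 - w r) (enorm x) (- w1 (enorm x)).
  by have h' := dw ax; der_calc; rewrite add0r.
have [_ E] := radial_partial i x0 du.
have -> : partial i V x = partial i (fun x => 1 - w (enorm x)) x.
  have [_ _ [C1 _] _ _] := sol; have [d _] := C1 i _ ax.
  have h1 := line_partial0 d; have [d2 _] := radial_partial i x0 du.
  have h2 := line_partial0 d2; apply: (der_unique h1); apply: der_near h2.
  have := near_line i (annulus_near ax); apply: filterS => k /andP[_ k1].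
  by rewrite solution_radial// /closed_unit_ball /= ltW.
by rewrite E /x !mxE !eqxx [i == _](negbTE i0) mulr1 mulr0 addr0.
Qed.

(** At an axis point, sqrt(r^2 + h^2) has zero first derivative in h; only the factor h / sqrt(r^2 +
    h^2) contributes to the second derivative, which gives u' / r for u = 1 - w. *)
Let trans_partial r i : 0 < r < 1 -> i != ord0 ->
  partial i V (r *: e_ ord0) = 0 /\ partial i (partial i V) (r *: e_ ord0) = - w1 r / r.
Proof.
move=> /[dup] r01 /andP[r0 r1] i0.
have er : enorm (r *: e_ ord0) = r by rewrite enorm_axis// ltW.
split.
  have := @trans r i 0 r0; rewrite scale0r add0r er => /(_ r1 i0 r0) ->.
  by rewrite mul0r mulr0.
have [_ _ [_ C2] _ _] := sol.
have [d _] := C2 i i _ (ax_annulus ord0 r01).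
have h1 := line_partial0 d; apply: (der_unique h1).
have ax := ax_annulus ord0 r01; have x0 : 0 < enorm (r *: e_ ord0) by rewrite er.
pose s (h : R) := enorm (h *: e_ i + r *: e_ ord0).
have s00 : s 0 = r by rewrite /s scale0r add0r er.
have ds : der s 0 0.
  have := der_enorm_line i x0; rewrite !mxE eqxx /= [i == _](negbTE i0) mulr0 mul0r; exact.
have rn : r != 0 by rewrite gt_eqF.
have dg : der (fun h => - w1 (s h) * (h / s h)) 0 (- w1 r / r).
  have hw : der (fun h => w1 (s h)) 0 (w2 r * 0).
    by apply: (@der_comp _ w1 s) => //; rewrite s00; exact: dw1.
  have sn : s 0 != 0 by rewrite s00.
  have hs : der (fun h => h / s h) 0 r^-1.
    apply: der_eq.
      exact: (@derM _ (fun h => h) (fun h => (s h)^-1) 0 _ _ (der_id 0) (derV sn ds)).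
    by cbv beta; rewrite s00 mul1r mul0r addr0.
  apply: der_eq.
    apply: (@derM _ (fun h => - w1 (s h)) (fun h => h / s h)); last exact: hs.
    exact: derN hw.
  by cbv beta; rewrite s00 mul0r mulr0 add0r.
apply: der_near dg.
have := near_line i (annulus_near ax); apply: filterS => h /andP[y0 y1].
by rewrite trans.
Qed.

Let sum_split (F : 'I_n.+2 -> R) a b : F ord0 = a -> (forall i, i != ord0 -> F i = b) ->
  \sum_(i < n.+2) F i = a + n.+1%:R * b.
Proof.
move=> Fa Fb; rewrite (bigD1 ord0)//= Fa; congr (_ + _).
rewrite (eq_bigr (fun=> b)) ?sumr_const; last by move=> i; exact: Fb.
by rewrite cardC1 card_ord /= mulr_natl.
Qed.

Lemma solution_ode : radial_ode n delta lam w w1 w2.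
Proof.
move=> r /[dup] r01 /andP[r0 r1]; have ax := ax_annulus ord0 r01.
have [_ _ _ eqn _] := sol; have [/andP[V0 V1] E] := eqn _ ax.
have wE : 1 - V (r *: e_ ord0) = w r by [].
split.
- by rewrite /profile subr_gt0 V1 gtrBl.
- exact: dw.
- exact: dw1.
- have lapE : laplacian V (r *: e_ ord0) = - w2 r + n.+1%:R * (- w1 r / r).
    apply: sum_split; first by rewrite /profile2 opprK.
    by move=> i i0; have [_ ->] := trans_partial r01 i0.
  have gradE : sqr_norm_grad V (r *: e_ ord0) = w1 r ^+ 2 + n.+1%:R * 0.
    apply: sum_split; first by rewrite /profile1 sqrrN.
    by move=> i i0; have [-> _] := trans_partial r01 i0; rewrite expr0n.
  rewrite -wE; move: E; rewrite lapE gradE mulr0 addr0 => <-.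
  by field; rewrite gt_eqF.
Qed.

(** V is continuous only within the closed ball, so continuity of the profile is stated with radii
    restricted to [0, 1]. *)
Lemma profile_within r : 0 <= r <= 1 -> forall e, 0 < e -> exists2 d, 0 < d &
  forall s, 0 <= s <= 1 -> `|s - r| < d -> `|w r - w s| < e.
Proof.
move=> /andP[r0 r1] e e0; have [_ Vc _ _ _] := sol.
have rb s : 0 <= s <= 1 -> closed_unit_ball R n.+2 (s *: e_ ord0).
  by move=> /andP[s0 s1]; rewrite /closed_unit_ball /= enorm_axis.
have r01 : 0 <= r <= 1 by rewrite r0.
move/subspace_continuousP : Vc => /(_ _ (rb r r01)) /cvgrPdist_lt /(_ e e0).
rewrite near_withinE => hV.
have := near_line ord0 hV.
move=> /nbhs_ballP[d /= d0 hd]; exists d => // s s01 sr.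
have := hd (s - r); rewrite /ball /= sub0r normrN => /(_ sr).
rewrite -scalerDl subrK => /(_ (rb _ s01)).
rewrite /profile; have -> : 1 - V (r *: e_ ord0) - (1 - V (s *: e_ ord0)) =
  - (V (r *: e_ ord0) - V (s *: e_ ord0)) by ring.
by rewrite normrN.
Qed.

Lemma profile_at1 : w 1 = 1.
Proof.
have [_ _ _ _ bd] := sol; rewrite /profile bd ?subr0// /unit_sphere /= enorm_axis//.
Qed.

Lemma profile_at0 : w 0 = 1 - V 0.
Proof. by rewrite /profile scale0r. Qed.

End ToODE.

(** * The eigenvalue bound *)

Section ClosedBall.
Context {R : realType} {N : nat}.

Lemma closed_unit_ball_compact : compact (closed_unit_ball R N).
Proof.
apply: bounded_closed_compact.
  exists 1; split=> [|M M1 x x1]; first exact: num_real.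
  rewrite /= [leLHS]/Num.norm /= mx_normrE; apply/bigmax_leP; split.
    exact: ltW (lt_trans ltr01 M1).
  move=> -[i j] _ /=; rewrite ord1.
  exact: le_trans (le_trans (coord_le_enorm x j) x1) (ltW M1).
have -> : closed_unit_ball R N = @enorm R N @^-1` [set r | r <= 1] by [].
by apply: preimage_closed (@closed_le R 1) => x _; exact: enorm_cont.
Qed.

Lemma closed_unit_ball_cases (x : 'rV[R]_N) :
  closed_unit_ball R N x -> unit_sphere R N x \/ unit_ball R N x.
Proof.
by rewrite /closed_unit_ball /unit_ball /unit_sphere /= le_eqVlt => /predU1P; case; [left|right].
Qed.

Lemma sum_linear (q p d s : R) (a b c : 'I_N -> R) :
  \sum_(i < N) (q * (p * a i + d * b i) - s * c i) =
  q * (p * (\sum_(i < N) a i) + d * \sum_(i < N) b i) - s * \sum_(i < N) c i.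
Proof. by rewrite sumrB -!mulr_sumr big_split /= -!mulr_sumr. Qed.

End ClosedBall.

Section EigenvalueBound.
Context {R : realType}.
Variables (N : nat) (delta lam kappa : R) (U : 'rV[R]_N -> R).
Hypothesis delta0 : 0 < delta.
Hypothesis lam0 : 0 < lam.
Hypothesis kappa0 : 0 < kappa.
Hypothesis reg : regular_solution delta lam U.
Hypothesis slack : forall w, 0 < w <= 1 -> kappa * Fw delta w < pw delta w / w.

Local Notation e_ i := (delta_mx ord0 i : 'rV[R]_N).
Local Notation K := (closed_unit_ball R N).
Let w x := 1 - U x.

Let w01 x : K x -> 0 < w x <= 1.
Proof.
rewrite /w; have [_ _ _ eqn bd] := reg => /closed_unit_ball_cases[/bd -> | /eqn[/andP[U0 U1] _]].
  by rewrite subr0 ltr01 lexx.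
by rewrite subr_gt0 U1 lerBlDr lerDl ltW.
Qed.

Let K0 : K !=set0.
Proof. by exists 0; rewrite /closed_unit_ball /= enorm0. Qed.

(** U attains its maximum, so w stays in a compact part of (0, 1], where p(w) / w - kappa F(w) has a
    positive minimum; c is that minimum over kappa + 1. Taking c > 0 keeps the quotient by F(w) + c
    defined at the boundary, where F = 0. *)
Lemma slack_uniform : exists c, [/\ 0 < c,
  (forall x, K x -> 0 < Fw delta (w x) + c) &
  forall x, K x -> kappa * (Fw delta (w x) + c) < pw delta (w x) / w x].
Proof.
have [_ Uc _ _ _] := reg.
have [x0 x0K Umax] := compact_EVT_max K0 closed_unit_ball_compact Uc.
rewrite inE in x0K; have /andP[a0 a1] := w01 x0K.
pose H z := pw delta z / z - kappa * Fw delta z.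
have Hc : {within `[w x0, 1], continuous H}.
  apply: (@der_within _ H (fun z => - (delta + 1) * pw delta z / z ^+ 2 + kappa * pw delta z)).
  move=> z /andP[az _]; have z0 := lt_le_trans a0 az.
  have h1 := der_pwdiv delta z0; have h2 := der_Fw delta z0.
  rewrite /H; der_calc; ring.
have [z1] := EVT_min a1 Hc; rewrite in_itv /= => /andP[az z11] Hmin.
have m0 : 0 < H z1 by rewrite subr_gt0 slack// z11 (lt_le_trans a0 az).
have k1 : 0 < kappa + 1 by rewrite ltr_wpDl// ltW.
have c0 : 0 < H z1 / (kappa + 1) by rewrite divr_gt0.
exists (H z1 / (kappa + 1)); split=> //.
- by move=> x xK; rewrite ltr_wpDl// Fw_ge0// w01.
move=> x xK; have /andP[wx0 wx1] := w01 xK.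
have /Hmin : w x \in `[w x0, 1].
  by rewrite in_itv /= wx1 andbT lerD2l lerN2; apply: Umax; rewrite inE.
have h1 : kappa * (H z1 / (kappa + 1)) < H z1.
  by rewrite mulrCA gtr_pMr// ltr_pdivrMr// mul1r ltrDl.
by move=> h2; rewrite mulrDr -ltrBrDl; exact: lt_le_trans h2.
Qed.

(* At an interior maximum point of phi / (F(1 - U) + c), the function
   q (F(1 - U) + c) - phi has a minimum, so its Laplacian is nonnegative there,
   while -Delta F(1 - U) = lam (1 - U)^(-delta-1) > lam kappa (F(1 - U) + c). *)
Lemma eigenvalue_bound mu : dirichlet_eigenvalue N mu -> lam * kappa < mu.
Proof.
move=> [phi0 [phi0c phi0C2 phi0eq phi0bd [x1 x1B phi0x1]]].
(* Multiplying by its value at x1 makes the eigenfunction positive somewhere, whatever its sign. *)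
pose s := phi0 x1; pose phi x := s * phi0 x.
have phibd x : unit_sphere R N x -> phi x = 0 by move=> /phi0bd; rewrite /phi => ->; rewrite mulr0.
have phix1 : 0 < phi x1 by rewrite /phi -expr2 exprn_even_gt0.
have [c [c0 fpos fslack]] := slack_uniform.
have [_ Uc [U1 U2] Ueq _] := reg; have [phi1 phi2] := phi0C2.
pose f x := Fw delta (w x) + c.
have gc : {within K, continuous (fun x => phi x / f x)}.
  apply/subspace_continuousP => x xK.
  have phx := proj1 (@subspace_continuousP _ K _ phi0) phi0c x xK.
  have Ux := proj1 (@subspace_continuousP _ K _ U) Uc x xK.
  have /andP[wx0 _] := w01 xK.
  apply: cvgM; first by apply: cvgM => //; exact: cvg_cst.
  apply: cvgV; first by rewrite gt_eqF// fpos.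
  apply: cvgD; last exact: cvg_cst.
  apply: (continuous_cvg _ (der_cont (der_Fw delta wx0))).
  by apply: cvgB => //; exact: cvg_cst.
have [x0 + gmax] := compact_EVT_max K0 closed_unit_ball_compact gc.
rewrite inE => x0K.
have x1K : K x1 by exact: ltW.
set q := phi x0 / f x0 in gmax.
have q0 : 0 < q.
  by apply: lt_le_trans (gmax x1 _); rewrite ?inE// divr_gt0// fpos.
have x0B : unit_ball R N x0.
  have [bd|//] := closed_unit_ball_cases x0K.
  by move: q0; rewrite /q phibd// mul0r ltxx.
have psi_ge0 x : K x -> 0 <= q * f x - phi x.
  by move=> xK; rewrite subr_ge0 -ler_pdivrMr ?fpos//; apply: gmax; rewrite inE.
have psi0 : q * f x0 - phi x0 = 0 by rewrite /q divfK ?subrr// gt_eqF// fpos.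
have ballK x : unit_ball R N x -> K x by move=> /ltW.
(* First and second derivatives along e_i of q f - phi; in the sum over i, the delta term of F2
   cancels the gradient term of the equation. *)
pose F1 i x := q * (pw delta (w x) * partial i U x) - s * partial i phi0 x.
pose F2 i x := q * (pw delta (w x) * partial i (partial i U) x
  + delta * (pw delta (w x) / w x) * partial i U x ^+ 2) - s * partial i (partial i phi0) x.
have d1 i x t : unit_ball R N (t *: e_ i + x) ->
    der (fun h => q * f (h *: e_ i + x) - phi (h *: e_ i + x)) t (F1 i (t *: e_ i + x)).
  move=> xB; have [dU _] := U1 i _ xB; have [dphi _] := phi1 i _ xB.
  have /andP[wx0 _] := w01 (ballK _ xB).
  have hU := line_partial dU; have hphi := line_partial dphi.
  have hw : der (fun h => w (h *: e_ i + x)) t (- partial i U (t *: e_ i + x)).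
    by rewrite /w; der_calc; rewrite add0r.
  have hF := @der_comp _ (Fw delta) (fun h => w (h *: e_ i + x)) t _ _ (der_Fw delta wx0) hw.
  by rewrite /f /F1 /phi; der_calc; ring.
have d2 i x t : unit_ball R N (t *: e_ i + x) ->
    der (fun h => F1 i (h *: e_ i + x)) t (F2 i (t *: e_ i + x)).
  move=> xB; have [dU _] := U1 i _ xB; have [dphi _] := phi2 i i _ xB.
  have [dU2 _] := U2 i i _ xB; have /andP[wx0 _] := w01 (ballK _ xB).
  have hU := line_partial dU; have hphi := line_partial dphi.
  have hU2 := line_partial dU2.
  have hw : der (fun h => w (h *: e_ i + x)) t (- partial i U (t *: e_ i + x)).
    by rewrite /w; der_calc; rewrite add0r.
  have hF := @der_comp _ (pw delta) (fun h => w (h *: e_ i + x)) t _ _ (der_pw delta wx0) hw.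
  have wn : w (t *: e_ i + x) != 0 by rewrite gt_eqF.
  have h := derD (derM (der_cst q t) (derM hF hU2)) (derN (derM (der_cst s t) hphi)).
  apply: der_eq; first exact: h.
  rewrite /F2; move: (pw _ _) (partial i (partial i U) _) (partial i U _) wn.
  move: (w _) (partial i (partial i phi0) _) (partial i phi0 _) => a b b' p u2 u1 wn.
  by field.
have F2_ge0 i : 0 <= F2 i x0.
  have := near_line i (near_enorm_lt x0B) => /nbhs_ballP[e /= e0 he].
  have hB h : `|h - 0| < e -> unit_ball R N (h *: e_ i + x0).
    by move=> hh; apply: he; rewrite /ball /= sub0r normrN -[h]subr0.
  have hx : 0 *: e_ i + x0 = x0 by rewrite scale0r add0r.
  have B0 : unit_ball R N (0 *: e_ i + x0) by rewrite hx.
  have := d2 i x0 0 B0; rewrite hx => d20.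
  have fd h : `|h - 0| < e -> der (fun h => q * f (h *: e_ i + x0) - phi (h *: e_ i + x0)) h
      (F1 i (h *: e_ i + x0)) by move=> /hB; exact: d1.
  have [h /hB hh|_ //] := der2_min e0 fd d20.
  by cbv beta; rewrite hx psi0; apply: psi_ge0; exact: ballK.
rewrite ltNge; apply/negP => mulam.
have : 0 <= \sum_(i < N) F2 i x0 by apply: sumr_ge0 => i _; exact: F2_ge0.
have [_ E] := Ueq _ x0B.
have Ephi : laplacian phi0 x0 = - (mu * phi0 x0) by rewrite -phi0eq ?opprK.
have /andP[wx0 _] := w01 x0K; have wn : w x0 != 0 by rewrite gt_eqF.
have -> : \sum_(i < N) F2 i x0 = q * (pw delta (w x0) * laplacian U x0
  + delta * (pw delta (w x0) / w x0) * sqr_norm_grad U x0) - s * laplacian phi0 x0.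
  exact: sum_linear.
have -> : laplacian U x0 = - ((lam + delta * sqr_norm_grad U x0) / w x0) by rewrite -E opprK.
have phE : phi x0 = q * f x0 by apply/eqP; rewrite -subr_eq0 -opprB psi0 oppr0.
have -> : q * (pw delta (w x0) * - ((lam + delta * sqr_norm_grad U x0) / w x0) +
   delta * (pw delta (w x0) / w x0) * sqr_norm_grad U x0) =
   - (q * (lam * (pw delta (w x0) / w x0))) by field.
have -> : s * laplacian phi0 x0 = - (mu * (q * f x0)) by rewrite Ephi -phE /phi; ring.
have hs := fslack _ x0K; have fp := fpos _ x0K; rewrite -/(f x0) in hs fp.
have h1 : q * (lam * (kappa * f x0)) < q * (lam * (pw delta (w x0) / w x0)).
  by rewrite !ltr_pM2l.
have h2 : mu * (q * f x0) <= q * (lam * (kappa * f x0)).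
  by rewrite mulrCA ler_pM2l// mulrA ler_pM2r.
rewrite opprK addrC subr_ge0 => h3.
by have := lt_le_trans (le_lt_trans h2 h1) h3; rewrite ltxx.
Qed.

End EigenvalueBound.

(** * The extremal value *)

Section Profiles.
Context {R : realType}.
Variables (n : nat) (delta : R).
Implicit Types (V U : 'rV[R]_n.+2 -> R) (lam : R).

Lemma regular_punctured lam V : regular_solution delta lam V ->
  radial_solution_on delta (punctured_unit_ball R n.+2) lam V.
Proof.
have sub x : punctured_unit_ball R n.+2 x -> unit_ball R n.+2 x by move=> /andP[].
move=> [h1 h2 [h3 h4] h5 h6]; split=> //; last by move=> x /sub; exact: h5.
by split=> [i x /sub|i j x /sub]; [exact: h3|exact: h4].
Qed.

Lemma regular_origin lam V : regular_solution delta lam V -> 0 < V 0 < 1.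
Proof.
move=> [_ _ _ eqn _]; have B0 : unit_ball R n.+2 0 by rewrite /unit_ball /= enorm0.
by have [] := eqn _ B0.
Qed.

Lemma profile_ext lam1 lam2 V U :
  radial_solution_on delta (punctured_unit_ball R n.+2) lam1 V ->
  radial_solution_on delta (punctured_unit_ball R n.+2) lam2 U ->
  (forall r, 0 < r < 1 -> profile V r = profile U r) ->
  forall x, closed_unit_ball R n.+2 x -> V x = U x.
Proof.
move=> sV sU E x xK; rewrite (solution_radial sV xK) (solution_radial sU xK).
congr (1 - _); have := enorm_ge0 x; rewrite le_eqVlt => /predU1P[x0|x0]; last first.
  have := xK; rewrite /closed_unit_ball /= le_eqVlt => /predU1P[->|x1].
    by rewrite (profile_at1 sV) (profile_at1 sU).
  by apply: E; rewrite x0.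
rewrite -x0; have z01 : 0 <= (0 : R) <= 1 by rewrite lexx ler01.
apply/eqP; rewrite -subr_eq0 -normr_le0 leNgt; apply/negP => d0.
have e0 : 0 < `|profile V 0 - profile U 0| / 2 by rewrite divr_gt0.
have [a a0 ha] := profile_within sV z01 e0.
have [b b0 hb] := profile_within sU z01 e0.
near (0 : R)^'+ => s.
have s0 : 0 < s by near: s; exact: nbhs_right_gt.
have sa : s < a by near: s; exact: nbhs_right_lt.
have sb : s < b by near: s; exact: nbhs_right_lt.
have s1 : s < 1 by near: s; exact: nbhs_right_lt.
have s01 : 0 <= s <= 1 by rewrite !ltW.
have ns : `|s - 0| = s by rewrite subr0 gtr0_norm.
have := ha s s01; rewrite ns => /(_ sa).
have := hb s s01; rewrite ns => /(_ sb); rewrite (E s) ?s0//.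
move: (profile V 0) (profile U 0) (profile U s) => p q t h1 h2.
have := ler_distD t p q; rewrite [`|t - q|]distrC.
lra.
Unshelve. all: by end_near. Qed.

(** The control at the origin that the Green comparison asks of a competitor; a sequence of radii is
    enough since Q is monotone. *)
Definition negligible_origin V := forall e r, 0 < e -> 0 < r < 1 ->
  exists s, [/\ 0 < s < r, s <= e & s ^+ n.+2 * Fw delta (profile V s) <= e].

Hypothesis delta0 : 0 < delta.

Lemma regular_negligible lam V : regular_solution delta lam V -> negligible_origin V.
Proof.
move=> rV e r e0 /andP[r0 r1]; have sV := regular_punctured rV.
have /andP[V0 V1] := regular_origin rV.
have a0 : 0 < profile V 0 / 2 by rewrite profile_at0 divr_gt0// subr_gt0.
have z01 : 0 <= (0 : R) <= 1 by rewrite lexx ler01.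
have [d d0 hd] := profile_within sV z01 a0.
have M0 : 0 <= Fw delta (profile V 0 / 2).
  by apply: Fw_ge0; rewrite // a0 profile_at0 /=; lra.
pose M := Fw delta (profile V 0 / 2) + 1.
have M1 : 1 <= M by rewrite lerDr.
have Mp : 0 < M by exact: lt_le_trans ltr01 M1.
have eM : 0 < e / M by rewrite divr_gt0.
near (0 : R)^'+ => s; exists s.
have s0 : 0 < s by near: s; exact: nbhs_right_gt.
have sd : s < d by near: s; exact: nbhs_right_lt.
have sr : s < r by near: s; exact: nbhs_right_lt.
have se : s <= e / M by near: s; exact: nbhs_right_le.
have s1 := lt_trans sr r1; split; first by rewrite s0.
  by apply: (le_trans se); rewrite ler_pdivrMr// ler_peMr// ltW.
have hs : profile V 0 / 2 < profile V s.
  have := hd s; rewrite subr0 gtr0_norm// !ltW// => /(_ isT sd).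
  rewrite ltr_norml => /andP[_]; move: (profile V 0) (profile V _) => p q; lra.
have Fs : Fw delta (profile V s) <= M.
  by apply: (@le_trans _ _ (Fw delta (profile V 0 / 2))); [apply: Fw_le => //; exact: ltW|rewrite lerDl].
apply: (@le_trans _ _ (s * M)); last by rewrite -ler_pdivlMr.
apply: (@le_trans _ _ (s ^+ n.+2 * M)).
  by rewrite ler_pM2l// exprn_gt0.
by rewrite ler_pM2r// exprS ler_piMr ?(ltW s0)// exprn_ile1// ltW.
Unshelve. all: by end_near. Qed.

(** The linear lower bound w >= c s turns s^N F(w) into at most p(c) s^(N - delta). *)
Lemma small_delta_negligible lam V : 0 < lam -> delta < n.+2%:R / 2 ->
  radial_solution_on delta (punctured_unit_ball R n.+2) lam V -> negligible_origin V.
Proof.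
move=> lam0 dN sV e r e0 /andP[r0 r1].
have ode := solution_ode sV.
pose c := Num.sqrt (lam / n.+2%:R).
have c0 : 0 < c by rewrite sqrtr_gt0 divr_gt0// ltr0n.
have low s : 0 < s < 1 -> c * s <= profile V s.
  move=> s01; have := ode_sqr_lower delta0 lam0 ode s01; have /andP[s0 _] := s01.
  have [/andP[w0 _] _ _ _] := ode s s01.
  rewrite -(@ler_pXn2r _ 2) ?nnegrE ?(ltW w0) ?mulr_ge0 ?(ltW c0) ?(ltW s0)//.
  by rewrite exprMn sqr_sqrtr// divr_ge0 ?(ltW lam0).
pose M := pw delta c + 1.
have M1 : 1 <= M by rewrite lerDr ltW// pw_gt0.
have Mp : 0 < M by exact: lt_le_trans ltr01 M1.
have eM : 0 < e / M by rewrite divr_gt0.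
near (0 : R)^'+ => s; exists s.
have s0 : 0 < s by near: s; exact: nbhs_right_gt.
have sr : s < r by near: s; exact: nbhs_right_lt.
have se : s <= e / M by near: s; exact: nbhs_right_le.
have s1 := lt_trans sr r1; have s01 : 0 < s < 1 by rewrite s0.
have [/andP[w0 w1] _ _ _] := ode s s01.
split; first by rewrite s0.
  by apply: (le_trans se); rewrite ler_pdivrMr// ler_peMr// ltW.
have cs0 : 0 < c * s by rewrite mulr_gt0.
have F1 : Fw delta (profile V s) <= pw delta c * s `^ (- delta).
  rewrite /pw -powRM ?(ltW c0) ?(ltW s0)//.
  apply: (le_trans (Fw_le_pw delta0 _)); first by rewrite w0 ltW.
  exact: pw_le (low s s01).
apply: (@le_trans _ _ (s * M)); last by rewrite -ler_pdivlMr.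
apply: (@le_trans _ _ (s ^+ n.+2 * (pw delta c * s `^ (- delta)))).
  by rewrite ler_pM2l// exprn_gt0.
rewrite mulrCA [s * M]mulrC; apply: ler_pM.
- by rewrite ltW// pw_gt0.
- by rewrite mulr_ge0// ?exprn_ge0 ?(ltW s0)// powR_ge0.
- by rewrite lerDl.
rewrite -powR_mulrn ?(ltW s0)// -powRD; last by rewrite (gt_eqF s0) implybT.
rewrite -[leRHS]powRr1 ?(ltW s0)//.
(* The exponent N - delta is at least 1 because delta < N/2 and N >= 2. *)
apply: ger_powR; first by rewrite s0 ltW.
have h2 : (2 : R) <= n.+2%:R by rewrite ler_nat.
lra.
Unshelve. all: by end_near. Qed.

End Profiles.

(** * Comparison of all solutions with the critical rescaled orbit *)

Section CriticalOrbit.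
Context {R : realType}.
Variables (n : nat) (delta : R) (J P : R -> R).
Hypothesis delta0 : 0 < delta.
Hypothesis pot : radial_potential n (fun s => Ksrc delta (P s)) J P.
Implicit Types (V U : 'rV[R]_n.+2 -> R) (lam : R).

(** J <= s^(n+2) / N, and W is bounded up to s1. Since [lin (P s)] is monotone in s, the smaller of
    its end values 1 and [lin (P s1)] bounds it from below. *)
Lemma shoot1_le s1 : shoot_dom delta P s1 -> exists2 C, 0 <= C &
  forall s, 0 < s <= s1 -> shoot1 n delta J P s <= C * s.
Proof.
move=> g1; pose m := Num.min 1 (lin delta (P s1)).
have m0 : 0 < m by rewrite lt_min ltr01.
exists (shoot delta P s1 / n.+2%:R / m).
  by rewrite !divr_ge0 ?(ltW m0)// ltW// shoot_gt0.
move=> s /andP[s0 ss]; have gs := shoot_dom_le delta0 pot g1 ss.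
have Ws : shoot delta P s <= shoot delta P s1.
  move: ss; rewrite le_eqVlt => /predU1P[-> //|ss].
  exact: ltW (shoot_lt delta0 pot (ltW s0) ss g1).
have ml : m <= lin delta (P s).
  rewrite /m /lin; have [d1|d1] := leP delta 1.
    by rewrite ge_min lerDl mulr_ge0 ?(sourced_ge0 delta0 pot)// subr_ge0.
  rewrite ge_min; apply/orP; right; rewrite lerD2l ler_nM2l ?subr_lt0//.
  exact: (sourced_le delta0 pot ss).
have /andP[_ Js] := sourced_flux_bounds delta0 pot s0.
have J0 : 0 <= J s by exact: (sourced_flux_ge0 delta0 pot (ltW s0)).
rewrite /shoot1.
have -> : shoot delta P s1 / n.+2%:R / m * s = shoot delta P s1 * (s / n.+2%:R) / m.
  by rewrite mulrAC -(mulrA _ _ s) [_^-1 * s]mulrC.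
have q0 : 0 <= J s / s ^+ n.+1 by rewrite divr_ge0// exprn_ge0// ltW.
have q1 : J s / s ^+ n.+1 <= s / n.+2%:R.
  by rewrite ler_pdivrMr ?exprn_gt0// mulrAC -exprS.
have W0 : 0 <= shoot delta P s by rewrite ltW// shoot_gt0.
apply: ler_pM.
- by rewrite mulr_ge0.
- by rewrite invr_ge0 ltW.
- exact: ler_pM.
- by rewrite lef_pV2.
Qed.

Variable s1 : R.
Hypothesis crit : critical n delta J P s1.

Let s10 : 0 < s1. Proof. by case: crit. Qed.
Let g1 : shoot_dom delta P s1. Proof. by case: crit. Qed.

Let z := orbit_w delta P s1.
Let z1 := orbit_w1 n delta J P s1.
Let Z := orbit_U delta P s1 : 'rV[R]_n.+2 -> R.

Let regZ : regular_solution delta (vlam delta P s1) Z := orbit_regular delta0 pot s10 g1.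

Let W0 s : 0 < shoot delta P s. Proof. exact: shoot_gt0. Qed.

Let sr s : 0 < s < 1 -> 0 < s1 * s < s1.
Proof. by move=> /andP[s0 s11]; rewrite mulr_gt0//= gtr_pMr. Qed.

Lemma profile_orbit r : 0 <= r -> profile Z r = z r.
Proof. by move=> r0; rewrite /profile /Z /orbit_U enorm_axis// subKr. Qed.

(** Criticality of s1 means z'(1) = 1 = z(1), so z - s z' tends to 0 at the boundary. *)
Let near1 w : w 1 = 1 -> (forall e, 0 < e -> exists2 d, 0 < d &
    forall s, 0 <= s <= 1 -> `|s - 1| < d -> `|w 1 - w s| < e) ->
  forall e r, 0 < e -> 0 < r < 1 -> exists s,
    [/\ r < s < 1, z s - s * z1 s <= e, 1 - w s <= e & 1 - z s <= e].
Proof.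
move=> w1 wc e r e0 /andP[r0 r1].
have e20 : 0 < e / 2 by rewrite divr_gt0.
have z1c : {for 1, continuous z1} by apply: orbit_w1_cont => //; rewrite ltr01 lexx.
have z11 : z1 1 = 1.
  by case: crit => _ _ E _; rewrite /z1 /orbit_w1 mulr1; exact: E.
have [d d0 hd] : exists2 d, 0 < d & forall s, `|s - 1| < d -> `|z1 1 - z1 s| < e / 2.
  move/cvgrPdist_lt : z1c => /(_ _ e20) /nbhs_ballP[d /= d0 hd].
  by exists d => // s ss; apply: hd; rewrite /ball /= distrC.
have [d2 d20 hd2] := wc _ e0.
have o01 : 0 <= (1 : R) <= 1 by rewrite lexx ler01.
have [d3 d30 hd3] := profile_within (regular_punctured regZ) o01 e0.
have left d' : 0 < d' -> \forall s \near (1 : R)^'-, 1 - d' < s.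
  by move=> d'0; apply: nbhs_left_gt; rewrite gtrBl.
near (1 : R)^'- => s; exists s.
have rs : r < s by near: s; exact: nbhs_left_gt.
have ss : s < 1 by near: s; exact: nbhs_left_lt.
have ns d' : 1 - d' < s -> `|s - 1| < d'.
  by move=> h; rewrite distrC gtr0_norm ?subr_gt0//; lra.
have nd : `|s - 1| < d by apply: ns; near: s; exact: left.
have nd2 : `|s - 1| < d2 by apply: ns; near: s; exact: left.
have nd3 : `|s - 1| < d3 by apply: ns; near: s; exact: left.
have ne : `|s - 1| < e / 2 by apply: ns; near: s; exact: left.
have s0 := ltW (lt_trans r0 rs).
have s01 : 0 <= s <= 1 by rewrite s0 ltW.
have s01' : 0 < s < 1 by rewrite ss (lt_trans r0 rs).
have h1 := hd s nd.
have h2 := hd2 s s01 nd2.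
have h3 := hd3 s s01 nd3.
split; first by rewrite rs.
- have [/andP[_ zs1] _ _ _] := orbit_ode delta0 pot s10 g1 s01'.
  rewrite z11 in h1; move: ne h1; rewrite -/z in zs1; rewrite !ltr_norml.
  move: (z s) (z1 s) zs1 => a b *; nra.
- by move: h2; rewrite w1 => /(le_lt_trans (ler_norm _))/ltW.
- move: h3; rewrite (profile_at1 (regular_punctured regZ)) profile_orbit//.
  by move=> /(le_lt_trans (ler_norm _))/ltW.
Unshelve. all: by end_near. Qed.

(** It gives nonexistence beyond the critical parameter and uniqueness at it; applied to the cone,
    it also locates lstar relative to that parameter. *)
Lemma critical_green lam V : vlam delta P s1 <= lam ->
  radial_solution_on delta (punctured_unit_ball R n.+2) lam V ->
  negligible_origin delta V ->
  lam = vlam delta P s1 /\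
  forall x, closed_unit_ball R n.+2 x -> V x = Z x.
Proof.
move=> ll sV neg; have [C C0 hC] := shoot1_le g1.
have v0 : 0 < vlam delta P s1 by rewrite divr_gt0// exprn_gt0.
(* The lower bound a of z is its value 1 / W(s1) at the origin. *)
have [] := @green_unique _ _ _ _ _ _ _ _ _ _ _ (shoot delta P s1)^-1
  (s1 ^+ 2 * C / shoot delta P s1) delta0 v0 ll (solution_ode sV)
  (orbit_ode delta0 pot s10 g1).
- by rewrite invr_gt0.
- move=> r /andP[r0 r1]; rewrite /orbit_w ler_peMl ?invr_ge0 ?(ltW (W0 _))//.
  apply: (shoot_ge1 delta0 pot); apply: (shoot_dom_le delta0 pot g1).
  by rewrite ler_piMr ?(ltW r1)// ltW.
- move=> r r01; have /andP[sr0 sr1] := sr r01.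
  case: crit => _ _ _ /(_ _ (sr r01)).
  rewrite /yslope ltr_pdivrMr// mul1r /orbit_w1 /orbit_w => h.
  by rewrite mulrA ltr_pM2r ?invr_gt0// mulrA [r * _]mulrC.
- by rewrite !mulr_ge0 ?invr_ge0 ?exprn_ge0 ?(ltW s10) ?(ltW (W0 _)).
- move=> r r01; have /andP[sr0 sr1] := sr r01; rewrite /orbit_w1.
  have := hC (s1 * r); rewrite sr0 (ltW sr1) => /(_ isT) h.
  have -> : s1 ^+ 2 * C / shoot delta P s1 * r = s1 * (C * (s1 * r)) / shoot delta P s1.
    by rewrite mulrAC; congr (_ / _); ring.
  by rewrite ler_pM2r ?invr_gt0// ler_pM2l.
- exact: neg.
- move=> e r e0 r01; apply: (near1 (profile_at1 sV)) => // e' e'0.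
  have o01 : 0 <= (1 : R) <= 1 by rewrite lexx ler01.
  by have [d d0 hd] := profile_within sV o01 e'0; exists d.
move=> -> E; split=> //; apply: (profile_ext sV (regular_punctured regZ)) => r r01.
by rewrite E// profile_orbit// ltW//; case/andP: r01.
Qed.

End CriticalOrbit.

Lemma extremal_value_unique (R : realType) N (delta l1 l2 : R) :
  is_extremal_value N delta l1 -> is_extremal_value N delta l2 -> l1 = l2.
Proof.
have le a b : is_extremal_value N delta a -> is_extremal_value N delta b -> a <= b.
  move=> [a0 ha _] [b0 _ hb]; rewrite leNgt; apply/negP => ba.
  apply: (hb ((a + b) / 2)); first lra.
  by apply: ha; lra.
by move=> h1 h2; apply/eqP; rewrite eq_le !le.
Qed.

Section Extremal.
Context {R : realType}.
Variables (n : nat) (delta : R).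
Hypothesis delta0 : 0 < delta.
Implicit Types (V U : 'rV[R]_n.+2 -> R) (lam mu : R).

Let lstar : R := n.+1%:R - delta.
Let root : R := (n%:R - 2 * Num.sqrt n.+1%:R) / 2.

Lemma shooting_potential :
  exists J P, radial_potential n (fun s : R => Ksrc delta (P s)) J P.
Proof.
apply: (@radial_ivp _ n (delta + 1)); first by rewrite addr_gt0.
  exact: Ksrc_lip.
exact: Ksrc01.
Qed.

Let sqrt_n1 : 1 <= Num.sqrt (n.+1%:R : R) /\ Num.sqrt (n.+1%:R : R) ^+ 2 = n%:R + 1.
Proof.
split; last by rewrite sqr_sqrtr ?ler0n// natr1.
by rewrite -[leLHS]sqrtr1 ler_wsqrtr// ler1n.
Qed.

(** 8 lstar - c^2 = 4 (n+1) - (n - 2 delta)^2 factors as a difference of squares; one factor is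
    positive above the root, the other because c > 0. *)
Lemma above_root : root < delta ->
  n.+2%:R - 2 * delta <= 0 \/ (n.+2%:R - 2 * delta) ^+ 2 < 8 * lstar.
Proof.
have [q1 q2] := sqrt_n1; have h := delta0; rewrite /root /lstar -(natr1 n.+1) -(natr1 n).
rewrite -(natr1 n) in q1 q2 *.
move: (Num.sqrt _) q1 q2 => q q1 q2 hr.
have [c0|c0] := leP (n%:R + 1 + 1 - 2 * delta) 0; [by left|right].
have h1 : 0 < n%:R + 2 * q - 2 * delta by lra.
have h2 : 0 < 2 * delta - n%:R + 2 * q by lra.
have := mulr_gt0 h1 h2; nra.
Qed.

Lemma below_root : delta <= root ->
  [/\ 0 < lstar, delta < n%:R / 2, 0 < n.+2%:R - 2 * delta
    & lstar * (delta + 1) <= (n%:R / 2) ^+ 2].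
Proof.
have [q1 q2] := sqrt_n1; have h := delta0; rewrite /root /lstar -(natr1 n.+1) -(natr1 n).
rewrite -(natr1 n) in q1 q2 *.
move: (Num.sqrt _) q1 q2 => q q1 q2 hr; split; try lra.
have h1 : 0 <= n%:R - 2 * delta - 2 * q by lra.
have h2 : 0 <= n%:R - 2 * delta + 2 * q by lra.
have := mulr_ge0 h1 h2; nra.
Qed.

Let cone := (fun x : 'rV[R]_n.+2 => 1 - enorm x).

Lemma profile_cone r : 0 <= r -> profile cone r = r.
Proof. by move=> r0; rewrite /profile /cone enorm_axis// subKr. Qed.

(** The comparison w <= r forces w to tend to 0 at the origin, whereas w(0) = 1 - V(0) > 0. *)
Lemma hardy_no_regular lam V : delta <= root -> lstar <= lam ->
  ~ regular_solution delta lam V.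
Proof.
move=> /below_root[l0 dn c0 hardy] ll rV; have sV := regular_punctured rV.
have /andP[V0 V1] := regular_origin rV.
have a0 : 0 < profile V 0 / 2 by rewrite profile_at0 divr_gt0// subr_gt0.
have a1 : profile V 0 <= 1 by rewrite profile_at0 lerBlDr lerDl ltW.
have z01 : 0 <= (0 : R) <= 1 by rewrite lexx ler01.
have [d d0 hd] := profile_within sV z01 a0.
near (0 : R)^'+ => m.
have m0 : 0 < m by near: m; exact: nbhs_right_gt.
have md : m < d by near: m; exact: nbhs_right_lt.
have ma : m < profile V 0 / 2 by near: m; exact: nbhs_right_lt.
have m1 : m < 1 by move: (profile V 0) ma a1 => p *; lra.
have m01 : 0 < m < 1 by rewrite m0.
have := hardy_comparison delta0 l0 ll dn hardy (solution_ode sV) m01.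
have m01' : 0 <= m <= 1 by rewrite !ltW.
have := hd m m01'; rewrite subr0 gtr0_norm// => /(_ md).
rewrite ltr_norml => /andP[_]; move: (profile V 0) (profile V m) ma => p q; lra.
Unshelve. all: by end_near. Qed.

Lemma extremal_below_root : delta <= root ->
  is_extremal_value n.+2 delta lstar /\
  the_extremal_solution delta lstar (@singular_solution R n.+2 delta lstar).
Proof.
move=> dr; have [l0 dn c0 hardy] := below_root dr.
have [J [P pot]] := shooting_potential.
have coneS : singular_solution delta lstar cone by exact: cone_singular.
have dN : delta < n.+2%:R / 2.
  by apply: (lt_le_trans dn); rewrite ler_pM2r ?invr_gt0// ler_nat -[n.+2]addn2 leq_addr.
split.
  split=> // [lam lam0 laml|lam laml [V]]; last exact: (hardy_no_regular dr (ltW laml)).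
  have [s1 [s10 g1 v1]] : exists s1, [/\ 0 < s1, shoot_dom delta P s1 & lam <= vlam delta P s1].
    (* A critical radius is not excluded beforehand. If its parameter were below lam < lstar, the
       cone would be a solution beyond it, against [critical_green]; otherwise [vlam] approaches
       lstar. *)
    have [[s1 crit]|[allgood _ sup _]] := orbit_dichotomy delta0 pot.
      exists s1; have [s10 g1 _ _] := crit; split=> //.
      rewrite leNgt; apply/negP => vl; have vl' := lt_trans vl laml.
      have [E _] := critical_green delta0 pot crit (ltW vl') coneS.1
        (small_delta_negligible delta0 l0 dN coneS.1).
      by move: vl'; rewrite E ltxx.
    have e0 : 0 < lstar - lam by rewrite subr_gt0.
    have [s1 s10 vs] := sup _ e0; exists s1; split=> //.
    by move: vs; rewrite subKr => /ltW.
  have lam01 : 0 < lam <= vlam delta P s1 by rewrite lam0.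
  have [s [s0 ss E]] := vlam_surj delta0 pot s10 g1 lam01.
  exists (orbit_U delta P s); rewrite -E.
  exact: (orbit_regular delta0 pot s0 (shoot_dom_le delta0 pot g1 ss)).
exists cone; split=> //; first by right.
move=> V [/(hardy_no_regular dr (lexx _)) //|[sV _]].
apply: (profile_ext sV coneS.1) => r r01; rewrite profile_cone; last by case/andP: r01 => /ltW.
have ode := solution_ode sV.
exact: (singular_unique delta0 l0 c0 ode (hardy_comparison delta0 l0 (lexx _) dn hardy ode)).
Qed.

Lemma extremal_above_root mu : root < delta -> dirichlet_eigenvalue n.+2 mu ->
  exists lbar, [/\ is_extremal_value n.+2 delta lbar,
    lbar < Num.min (mu / 4) (mu / delta),
    extremal_lower_bound n.+2 delta <= lbar &
    delta < n.+2%:R / 2 -> lstar < lbar /\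
      the_extremal_solution delta lbar (@regular_solution R n.+2 delta lbar)].
Proof.
move=> dr eig.
have [J [P pot]] := shooting_potential.
have [[s1 crit]|[_ _ _ []]] := orbit_dichotomy delta0 pot; last exact: above_root.
have [s10 g1 _ _] := crit; pose lbar := vlam delta P s1; exists lbar.
have lbar0 : 0 < lbar by rewrite divr_gt0// exprn_gt0// shoot_gt0.
have reg : regular_solution delta lbar (orbit_U delta P s1 : 'rV[R]_n.+2 -> R).
  exact: (orbit_regular delta0 pot s10 g1).
have noreg lam V : lbar < lam -> ~ regular_solution delta lam V.
  move=> ll rV; have [E _] := critical_green delta0 pot crit (ltW ll)
    (regular_punctured rV) (regular_negligible rV).
  by move: ll; rewrite E ltxx.
split.
- split=> // [lam lam0 laml|lam laml [V]]; last exact: noreg.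
  have lam01 : 0 < lam <= vlam delta P s1 by rewrite lam0 ltW.
  have [s [s0 ss E]] := vlam_surj delta0 pot s10 g1 lam01.
  exists (orbit_U delta P s); rewrite -E.
  exact: (orbit_regular delta0 pot s0 (shoot_dom_le delta0 pot g1 ss)).
- rewrite lt_min !ltr_pdivlMr//; apply/andP; split.
    by apply: (eigenvalue_bound lbar0 _ reg _ eig) => // w; exact: Fw_four.
  by apply: (eigenvalue_bound lbar0 _ reg _ eig) => // w; exact: Fw_delta.
- have [s [s0 gs h]] := vlam_lower delta0 pot; rewrite leNgt; apply/negP => h2.
  apply: (noreg _ _ (lt_le_trans h2 h)); exact: (orbit_regular delta0 pot s0 gs).
move=> dN; split.
  (* If lbar <= lstar, the comparison would identify the cone, whose value at 0 is 1, with a regular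
     solution. *)
  rewrite ltNge; apply/negP => ll; have l0 := lt_le_trans lbar0 ll.
  have coneS : singular_solution delta lstar cone by exact: cone_singular.
  have [_ E] := critical_green delta0 pot crit ll coneS.1
    (small_delta_negligible delta0 l0 dN coneS.1).
  have /andP[_] := regular_origin reg; rewrite -E; last first.
    by rewrite /closed_unit_ball /= enorm0.
  by rewrite coneS.2 ltxx.
exists (orbit_U delta P s1); split=> //; first by left.
move=> V [rV|[sV _]].
  by have [] := critical_green delta0 pot crit (lexx _) (regular_punctured rV)
    (regular_negligible rV).
by have [] := critical_green delta0 pot crit (lexx _) sV
  (small_delta_negligible delta0 lbar0 dN sV).
Qed.

End Extremal.

Local Close Scope classical_set_scope.

Theorem corollary1p3 (R : realType) (N : nat) (delta mu1 : R)
  (hN : (2 <= N)%N) (hdelta : 0 < delta)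
  (hmu1_gt0 : 0 < mu1) (hmu1 : first_dirichlet_eigenvalue N mu1) :
  (exists lbar : R, is_extremal_value N delta lbar) /\
  forall lbar : R, is_extremal_value N delta lbar ->
  let lstar : R := N%:R - 1 - delta in
  [/\ (delta <= (N%:R - 2 - 2 * Num.sqrt (N%:R - 1)) / 2 ->
        lbar = lstar /\
        the_extremal_solution delta lbar (@singular_solution R N delta lbar)),
      ((N%:R - 2 - 2 * Num.sqrt (N%:R - 1)) / 2 < delta ->
       delta < N%:R / 2 ->
        [/\ lstar < lbar,
            lbar < Num.min (mu1 / 4) (mu1 / delta) &
            the_extremal_solution delta lbar
              (@regular_solution R N delta lbar)]) &
      (N%:R / 2 <= delta ->
        extremal_lower_bound N delta <= lbar /\
        lbar < Num.min (mu1 / 4) (mu1 / delta))].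
Proof.
case: N hN hmu1 => [|[|n]] // _ [eig _].
have N1 : n.+2%:R - 1 = n.+1%:R :> R by rewrite -(natr1 n.+1) addrK.
have N2 : n.+2%:R - 2 = n%:R :> R by rewrite -(natr1 n.+1) -(natr1 n); ring.
rewrite N1 N2.
have [dr|dr] := leP delta ((n%:R - 2 * Num.sqrt n.+1%:R) / 2).
  have [ext sol] := extremal_below_root hdelta dr.
  split; first by exists (n.+1%:R - delta).
  move=> lbar /(extremal_value_unique ext) <-; split=> [_|//|dN]; first by split.
  (* The range of (iii) is empty here: below the root, delta < n/2 < N/2. *)
  have [_ dn _ _] := below_root hdelta dr.
  have : n%:R / 2 <= n.+2%:R / 2 :> R.
    by rewrite ler_pM2r ?invr_gt0// ler_nat -[n.+2]addn2 leq_addr.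
  by move=> /(lt_le_trans dn) /lt_le_trans /(_ dN); rewrite ltxx.
have [lbar [ext up low reg]] := extremal_above_root hdelta dr eig.
split; first by exists lbar.
move=> l /(extremal_value_unique ext) <-; split=> [//||_]; last by split.
by move=> _ /reg[h1 h2].
Qed.
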